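(* Let $m\ge 2$, $n=2m-1$, $G=F_{n}$ with Lie algebra $\mathfrak{g}=\mathcal{L}_n(\mathbb{R})$, equipped with a left invariant symplectic form $\omega^+$ (with value $\omega$ at the identity). Let $H=Z(G)$ be the center of $G$, and let $\Gamma=L\rtimes_{g(1)}\mathbb{Z}$ be a lattice in $G$, where $L=\Gamma\cap H_n$ and $g(1)$ is the action of the generator of $\mathbb{Z}$ on $L$. Then: (1) $H^\perp$ does not depend on the left invariant symplectic form; in fact $H^\perp$ is the connected subgroup of $G$ associated to the unique abelian ideal of codimension 1 of $\mathfrak{g}$. (2) $\Gamma\cap H$ and $\Gamma\cap H^\perp$ are lattices in $H$ and $H^\perp$ respectively. (3) $\Gamma_1:=L/\ker(g(1)-\mathrm{Id})$ is a lattice of the abelian Lie group $K:=H\backslash H^\perp$. (4) The torus $R:=\Gamma_1\backslash K$ is a reduced manifold of the symplectic nilmanifold $M:=\Gamma\backslash G$ (with symplectic form $\Omega$ induced by $\omega^+$).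
   Context: $\mathcal{L}_n(\mathbb{R})$ is the real Lie algebra with basis $e_0,e_1,\dots,e_n$ whose only nonzero brackets (up to antisymmetry) are $[e_0,e_i]=e_{i+1}$ for $1\le i\le n-1$; $F_n$ is the simply connected Lie group with this Lie algebra; $H_n$ is the connected abelian normal subgroup of codimension 1, with Lie algebra $\mathrm{Span}\{e_1,\dots,e_n\}$. A lattice is a discrete cocompact subgroup. Every lattice $\Gamma$ of $F_n$ is a semidirect product $L\rtimes_{g(1)}\mathbb{Z}$ with $L=\Gamma\cap H_n$ and $g(1)$ unipotent. For a left invariant symplectic form $\omega^+$ on $G$ and a connected central subgroup $H$ with Lie algebra $\mathfrak{h}$, $H^\perp$ denotes the connected (closed) subgroup of $G$ with Lie algebra $\mathfrak{h}^\perp=\{x\in\mathfrak{g}:\omega(x,y)=0\ \forall y\in\mathfrak{h}\}$. ''$R$ is a reduced manifold of $M$'' means: with $N:=(\Gamma\cap H^\perp)\backslash H^\perp$, $i:N\to M$ the natural embedding, and the circle $C:=(\Gamma\cap H)\backslash H$ acting freely on $N$ by multiplication, one has $R=C\backslash N$, and there is a symplectic form $\Omega_R$ on $R$ with $\pi^*\Omega_R=i^*\Omega$, where $\pi:N\to R$ is the quotient map. *)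

(* Defs.v *)
From HB Require Import structures.
From mathcomp Require Import all_boot all_order all_algebra.
From mathcomp Require Import ring.
From mathcomp Require Import all_classical all_reals all_analysis.
Set Implicit Arguments.
Unset Strict Implicit.
Unset Printing Implicit Defensive.
Import Order.TTheory GRing.Theory Num.Theory.
Import numFieldNormedType.Exports.
Local Open Scope classical_set_scope.
Local Open Scope ring_scope.

Section Manifolds.
Variable R : realType.

(* C^infinity maps between open subsets of coordinate spaces *)

Definition basis_vec d (i : 'I_d) : 'rV[R]_d := delta_mx 0 i.

Fixpoint Ck (k : nat) d (W : set 'rV[R]_d) (f : 'rV[R]_d -> R) : Prop :=
  match k with
  | 0%N => forall x, W x -> {for x, continuous f}
  | k'.+1 => (forall x, W x -> differentiable f x) /\
             forall i, Ck k' W (fun x => 'D_(basis_vec i) f x)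
  end.

Definition smooth_on d (W : set 'rV[R]_d) (f : 'rV[R]_d -> R) : Prop :=
  forall k, Ck k W f.

Definition smooth_at d d' (g : 'rV[R]_d -> 'rV[R]_d') (u : 'rV[R]_d) : Prop :=
  exists W, [/\ open W, W u & forall j, smooth_on W (fun x => g x 0 j)].

(* A d-manifold carried by a subset [pts] of a type T.  A chart is stored as a
   local parametrization (U, phi), with phi : U -> T; the values of phi outside
   U are irrelevant. *)
Definition chart d (T : Type) : Type :=
  (set 'rV[R]_d * ('rV[R]_d -> T))%type.

Record mfd d (T : Type) := Mfd { pts : set T ; charts : set (chart d T) }.

(* g is the expression of f, near u, in the charts c and c' *)
Definition local_rep d d' T T' (f : T -> T') (c : chart d T) (c' : chart d' T')
    (u : 'rV[R]_d) (g : 'rV[R]_d -> 'rV[R]_d') : Prop :=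
  [/\ smooth_at g u, c'.1 (g u) & (\forall w \near u, f (c.2 w) = c'.2 (g w))].

Definition smooth_map d d' T T' (X : mfd d T) (Y : mfd d' T') (f : T -> T')
    : Prop :=
  (forall x, pts X x -> pts Y (f x)) /\
  forall c c' u v, charts X c -> charts Y c' -> c.1 u -> c'.1 v ->
    f (c.2 u) = c'.2 v -> exists g, local_rep f c c' u g.

Definition mopen d T (X : mfd d T) : set (set T) :=
  [set W | W `<=` pts X /\ forall c, charts X c -> open (c.1 `&` c.2 @^-1` W)].

Definition is_manifold d T (X : mfd d T) : Prop :=
  [/\ (forall c, charts X c ->
         [/\ open c.1, {in c.1 &, injective c.2} & c.2 @` c.1 `<=` pts X]),
      (forall x, pts X x -> exists2 c, charts X c & (c.2 @` c.1) x),
      smooth_map X X id,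
      (forall x y, pts X x -> pts X y -> x <> y ->
         exists U V, [/\ mopen X U, mopen X V, U x, V y & U `&` V = set0])
    & exists B : set (set T), [/\ countable B, B `<=` mopen X &
         forall W x, mopen X W -> W x -> exists b, [/\ B b, b x & b `<=` W]]].

Definition diffeo d d' T T' (X : mfd d T) (Y : mfd d' T') (f : T -> T')
    : Prop :=
  smooth_map X Y f /\ exists f', [/\ smooth_map Y X f',
    (forall x, pts X x -> f' (f x) = x) & (forall y, pts Y y -> f (f' y) = y)].

(* q is a smooth submersion over the chart c': it is smooth there, and through
   every point lying over the chart there passes a smooth local section. *)
Definition submersive_over d d' T T' (X : mfd d T) (q : T -> T')
    (c' : chart d' T') : Prop :=
  forall c u v, charts X c -> c.1 u -> c'.1 v -> q (c.2 u) = c'.2 v ->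
    (exists g, local_rep q c c' u g) /\
    exists s, [/\ smooth_at s v, s v = u &
                 (\forall w \near v, q (c.2 (s w)) = c'.2 w)].

Definition submersion d d' T T' (X : mfd d T) (Y : mfd d' T') (q : T -> T')
    : Prop :=
  (forall x, pts X x -> pts Y (q x)) /\
  forall c', charts Y c' -> submersive_over X q c'.

Definition immersion d d' T T' (X : mfd d T) (Y : mfd d' T') (f : T -> T')
    : Prop :=
  smooth_map X Y f /\
  forall c c' u g, charts X c -> charts Y c' -> c.1 u ->
    local_rep f c c' u g -> \rank ('J g u) = d.

Definition embedding d d' T T' (X : mfd d T) (Y : mfd d' T') (f : T -> T')
    : Prop :=
  [/\ immersion X Y f, {in pts X &, injective f} &
      forall W, mopen X W ->
        exists2 O, mopen Y O & f @` W = O `&` f @` pts X].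

Definition euclid_chart d : chart d 'rV[R]_d := (setT, id).
Definition euclid d : mfd d 'rV[R]_d := Mfd setT [set euclid_chart d].

(* Embedded submanifolds of R^N: a local parametrization is a smooth bijection
   onto a relatively open subset of S whose inverse extends locally to a smooth
   map r of the ambient space. *)
Definition submfd d N (S : set 'rV[R]_N) : mfd d 'rV[R]_N :=
  Mfd S [set c : chart d 'rV[R]_N | [/\ open c.1, {in c.1 &, injective c.2}, c.2 @` c.1 `<=` S &
    forall u, c.1 u -> smooth_at c.2 u /\
      exists r, [/\ smooth_at r (c.2 u), r (c.2 u) = u &
                   (\forall x \near c.2 u, S x -> c.2 (r x) = x)]]].

(* The quotient smooth structure on q(X): the maximal atlas for which q is a
   submersion (a local diffeomorphism when d is the dimension of X). *)
Definition quotient_mfd d d' T T' (X : mfd d T) (q : T -> T') : mfd d' T' :=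
  Mfd (q @` pts X)
    [set c : chart d' T' | [/\ open c.1, {in c.1 &, injective c.2},
                 c.2 @` c.1 `<=` q @` pts X & submersive_over X q c]].

Definition prod_chart d d' T T' (c : chart d T) (c' : chart d' T')
    : chart (d + d') (T * T') :=
  ([set w | c.1 (lsubmx w) /\ c'.1 (rsubmx w)],
   fun w => (c.2 (lsubmx w), c'.2 (rsubmx w))).

Definition prod_mfd d d' T T' (X : mfd d T) (Y : mfd d' T')
    : mfd (d + d') (T * T') :=
  Mfd (pts X `*` pts Y)
    [set e | exists c c', [/\ charts X c, charts Y c' & e = prod_chart c c']].

(* A 2-form is given by its matrix in each chart.  With row vectors,
   Omega(x, y) = x *m Omega *m y^T, and the differential of g at u is
   x |-> x *m 'J g u. *)
Definition form2 d T : Type := chart d T -> 'rV[R]_d -> 'M[R]_d.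

(* f^* OmY = OmX *)
Definition is_pullback d d' T T' (X : mfd d T) (Y : mfd d' T') (f : T -> T')
    (OmY : form2 d' T') (OmX : form2 d T) : Prop :=
  smooth_map X Y f /\
  forall c c' u g, charts X c -> charts Y c' -> c.1 u -> local_rep f c c' u g ->
    OmX c u = 'J g u *m OmY c' (g u) *m ('J g u)^T.

Definition is_form2 d T (X : mfd d T) (Om : form2 d T) : Prop :=
  [/\ (forall c u, charts X c -> c.1 u -> (Om c u)^T = - Om c u),
      (forall c i j, charts X c -> smooth_on c.1 (fun w => Om c w i j))
    & is_pullback X X id Om Om].

Definition closed_form d T (X : mfd d T) (Om : form2 d T) : Prop :=
  forall c u i j k, charts X c -> c.1 u ->
    'D_(basis_vec i) (fun w => Om c w j k) u
    + 'D_(basis_vec j) (fun w => Om c w k i) u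
    + 'D_(basis_vec k) (fun w => Om c w i j) u = 0.

Definition symplectic d T (X : mfd d T) (Om : form2 d T) : Prop :=
  [/\ is_form2 X Om, closed_form X Om &
      forall c u, charts X c -> c.1 u -> Om c u \in unitmx].

End Manifolds.

Section LieGroups.
Variable R : realType.

Definition subgroup T (mul : T -> T -> T) (e : T) (S : set T) : Prop :=
  [/\ S e, (forall x y, S x -> S y -> S (mul x y)) &
      (forall x, S x -> exists2 y, S y & mul y x = e)].

Definition lie_group d T (X : mfd R d T) (mul : T -> T -> T) (e : T) : Prop :=
  [/\ is_manifold X, pts X e,
      [/\ (forall x y z, pts X x -> pts X y -> pts X z ->
             mul x (mul y z) = mul (mul x y) z)
        & (forall x, pts X x -> mul e x = x)],
      smooth_map (prod_mfd X X) X (fun p => mul p.1 p.2)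
    & exists2 inv, smooth_map X X inv & forall x, pts X x -> mul (inv x) x = e].

(* A \cdot B = {a b}, and the right coset S x = {s x} *)
Definition set_mul T (mul : T -> T -> T) (A B : set T) : set T :=
  [set mul a b | a in A & b in B].
Definition coset T (mul : T -> T -> T) (S : set T) (x : T) : set T :=
  [set mul s x | s in S].

Definition compact_space T (Y : set T) (op : set (set T)) : Prop :=
  forall F : set (set T), F `<=` op -> Y `<=` \bigcup_(W in F) W ->
    exists D : set (set T),
      [/\ finite_set D, D `<=` F & Y `<=` \bigcup_(W in D) W].

Definition quotient_opens d T T' (X : mfd R d T) (q : T -> T')
    : set (set T') :=
  [set W | W `<=` q @` pts X /\ mopen X (pts X `&` q @^-1` W)].

Definition lattice d T (X : mfd R d T) (mul : T -> T -> T) (e : T)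
    (Gam : set T) : Prop :=
  [/\ subgroup mul e Gam, Gam `<=` pts X,
      (forall x, Gam x -> exists2 O, mopen X O & O `&` Gam = [set x])
    & compact_space (coset mul Gam @` pts X)
        (quotient_opens X (coset mul Gam))].

(* X is a vector group R^d and Gam a lattice of it, so that Gam\X is a torus *)
Definition torus_presentation d T (X : mfd R d T) (mul : T -> T -> T) (e : T)
    (Gam : set T) : Prop :=
  lattice X mul e Gam /\
  exists2 th : 'rV[R]_d -> T, diffeo (euclid R d) X th &
    forall x y, th (x + y) = mul (th x) (th y).

(* [Rm] is a reduced manifold of (M, Om), M = Gam\G, where G is a Lie group on
   R^N, H a connected central subgroup, [Hp] is H^perp with its submanifold
   structure, and pi : N -> Rm is the projection exhibiting Rm as C\N.
   The points of M, N, C are cosets, i.e. subsets of G; the natural map N -> M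
   is A |-> Gam A, and C acts on N by the product of subsets. *)
Definition reduced_manifold N dH dP dR T
    (mul : 'rV[R]_N -> 'rV[R]_N -> 'rV[R]_N) (e : 'rV[R]_N)
    (Gam : set 'rV[R]_N) (Om : form2 R N (set 'rV[R]_N))
    (H : mfd R dH 'rV[R]_N) (Hp : mfd R dP 'rV[R]_N)
    (Rm : mfd R dR T) (pi : set 'rV[R]_N -> T) : Prop :=
  let M := quotient_mfd N (euclid R N) (coset mul Gam) in
  let GamP := Gam `&` pts Hp in
  let Nm := quotient_mfd dP Hp (coset mul GamP) in
  let GamH := Gam `&` pts H in
  let C := coset mul GamH @` pts H in
  let i := set_mul mul Gam in
  [/\ is_manifold Nm /\ embedding Nm M i,
      (* C is a circle, acting freely on N *)
      dH = 1%N /\ torus_presentation H mul e GamH,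
      (forall c A, C c -> pts Nm A -> pts Nm (set_mul mul c A)) /\
      (forall c A, C c -> pts Nm A -> set_mul mul c A = A -> c = GamH),
      (* Rm = C\N *)
      [/\ is_manifold Rm, submersion Nm Rm pi, pi @` pts Nm = pts Rm &
          forall A B, pts Nm A -> pts Nm B ->
            (pi A = pi B <-> exists2 c, C c & B = set_mul mul c A)]
    & exists OmR th, [/\ symplectic Rm OmR, is_form2 Nm th,
        is_pullback Nm M i Om th & is_pullback Nm Rm pi OmR th]].

End LieGroups.

Section Filiform.
Variables (R : realType) (n : nat).

Local Notation V := 'rV[R]_n.+1.

(* The Lie algebra L_n(R): e_0, ..., e_n is the standard basis of R^(n+1) and
   [e_0, e_i] = e_(i+1) for 1 <= i <= n - 1. *)
Definition e_ (i : nat) : V := delta_mx 0 (inord i).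

Definition lbr (x y : V) : V :=
  \sum_(1 <= i < n)
    (x 0 0 * y 0 (inord i) - x 0 (inord i) * y 0 0) *: e_ i.+1.

(* The simply connected group F_n = R \ltimes R^n on the manifold R^(n+1), with
   g h = g + exp(g_0 ad e_0) h.  [ad_e0] is the (nilpotent) matrix of ad e_0 for
   row vectors, so the exponential is a finite sum. *)
Definition ad_e0 : 'M[R]_n.+1 :=
  \matrix_(i, j) ((0 < i)%N && (j == i.+1 :> nat))%:R.

Definition exp_ad (t : R) : 'M[R]_n.+1 :=
  \sum_(k < n.+1) (t ^+ k / k`!%:R) *: ad_e0 ^+ k.

Definition fmul (g h : V) : V := g + h *m exp_ad (g 0 0).
Definition fginv (g : V) : V := - (g *m exp_ad (- g 0 0)).
Definition Fn : mfd R n.+1 V := euclid R n.+1.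

End Filiform.

Arguments fmul {R n} g h.
Arguments fginv {R n} g.

Section FiliformTheory.
Variables (R : realType) (n : nat).
Local Notation V := 'rV[R]_n.+1.

Lemma ad_e0X k (i j : 'I_n.+1) :
  (ad_e0 R n ^+ k.+1) i j = ((0 < i)%N && (j == i + k.+1 :> nat)%N)%:R.
Proof.
elim: k i j => [|k IHk] i j; first by rewrite expr1 mxE addn1.
rewrite exprS mxE; case: (posnP i) => [i0|ipos].
  by rewrite big1 // => l _; rewrite mxE i0 /= mul0r.
have [lt_i|ge_i] := ltnP i.+1 n.+1; last first.
  have -> : (j == i + k.+2 :> nat)%N = false.
    by apply/ltn_eqF/(leq_trans (ltn_ord j))/(leq_trans ge_i); rewrite addnS ltnS
       leq_addr.
  rewrite big1 ?andbF // => l _.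
  by rewrite mxE ltn_eqF ?andbF ?mul0r //; exact: leq_trans (ltn_ord l) _.
rewrite (bigD1 (Ordinal lt_i)) //= mxE IHk ipos /= eqxx mul1r addSnnS.
rewrite big1 ?addr0 // => l neq_l; rewrite mxE ipos /=.
case: eqP => [E|]; last by rewrite mul0r.
by case/eqP: neq_l; apply/val_inj.
Qed.

Lemma ad_e0_nilpotent k : (n < k)%N -> ad_e0 R n ^+ k = 0.
Proof.
case: k => // k; rewrite ltnS => le_nk; apply/matrixP => i j.
rewrite ad_e0X mxE; case: (posnP i) => //= ipos.
have -> // : (j == i + k.+1 :> nat)%N = false.
apply/ltn_eqF/(leq_trans (ltn_ord j)).
by rewrite addnS ltnS (leq_trans le_nk) // leq_addl.
Qed.

Lemma exp_ad0 : exp_ad n (0 : R) = 1%:M.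
Proof.
rewrite /exp_ad big_ord_recl /= expr0 fact0 divr1 scale1r expr0 big1 ?addr0 //.
by move=> k _; rewrite /= exprS !mul0r scale0r.
Qed.

Lemma exp_adD (s t : R) : exp_ad n (s + t) = exp_ad n s *m exp_ad n t.
Proof.
pose p t := \poly_(k < n.+1) ((t ^+ k / k`!%:R) *: ad_e0 R n ^+ k).
have pE x k : (p x)`_k = (x ^+ k / k`!%:R) *: ad_e0 R n ^+ k.
  by rewrite coef_poly; case: ltnP => // ?; rewrite ad_e0_nilpotent ?scaler0.
have p1 x : exp_ad n x = (p x).[1].
  rewrite (horner_coef_wide _ (size_poly _ _)); apply: eq_bigr => k _.
  by rewrite pE expr1n mulr1.
rewrite -[RHS]/(exp_ad n s * exp_ad n t) !p1 -hornerM_comm; last first.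
  by rewrite /comm_poly mulr1 mul1r.
congr (_.[_]); apply/polyP => k; rewrite coefM pE addrC exprDn.
rewrite mulr_suml scaler_suml; apply: eq_bigr => i _.
have le_ik : (i <= k)%N by rewrite -ltnS.
rewrite !pE -scalerAl -scalerAr scalerA -exprD subnKC //; congr (_ *: _).
have F x : (x`!%:R : R) != 0 by rewrite pnatr_eq0 -lt0n fact_gt0.
apply: (mulIf (F k)); rewrite mulfVK // -[in RHS](bin_fact le_ik) !natrM.
rewrite -mulr_natr -!mulrA mulrCA; congr (_ * _).
rewrite [RHS]mulrC -!mulrA.
by field; rewrite !F.
Qed.

Lemma exp_ad_col0 (y : V) t : (y *m exp_ad n t) 0 0 = y 0 0.
Proof.
rewrite mxE (bigD1 0) //= big1 ?addr0 => [|i ni]; rewrite /exp_ad summxE.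
  rewrite big_ord_recl big1 => [|k _]; rewrite /= mxE.
    by rewrite addr0 !expr0 fact0 divr1 mul1r mxE mulr1.
  by rewrite ad_e0X mulr0.
rewrite big1 ?mulr0 // => -[[|k] ?] _ /=; rewrite mxE.
  by rewrite expr0 mxE (negPf ni) mulr0.
by rewrite ad_e0X addnS andbF mulr0.
Qed.

Lemma fmulA (x y z : V) : fmul x (fmul y z) = fmul (fmul x y) z.
Proof.
rewrite /fmul mulmxDl addrA -mulmxA -exp_adD; congr (_ + _ *m exp_ad n _).
by rewrite [RHS]mxE exp_ad_col0 addrC.
Qed.

Lemma fmul0g (g : V) : fmul 0 g = g.
Proof. by rewrite /fmul mxE exp_ad0 mulmx1 add0r. Qed.

Lemma fmulVg (g : V) : fmul (fginv g) g = 0.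
Proof. by rewrite /fmul /fginv mxE exp_ad_col0 addNr. Qed.

Lemma derive_expansion (f : V -> V) (x a : V) (w : nat -> V) N :
  (forall h : R, f (h *: x + a) = f a + \sum_(k < N) h ^+ k.+1 *: w k.+1) ->
  'D_x f a = \sum_(k < N) (k == 0 :> nat)%:R *: w k.+1.
Proof.
move=> fE; apply: cvg_lim => //.
have : (fun h : R => \sum_(k < N) h ^+ k *: w k.+1) @ (0:R)^' -->
       \sum_(k < N) (k == 0 :> nat)%:R *: w k.+1.
  elim: N {fE} => [|N IHN].
    by rewrite big_ord0; under eq_fun do rewrite big_ord0; exact: cvg_cst.
  rewrite big_ord_recr /=; under eq_fun do rewrite big_ord_recr /=.
  apply: cvgD => //; apply: cvgZr_tmp.
  rewrite -(expr0n R N); apply: cvg_within_filter.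
  exact: exprn_continuous.
apply: cvg_trans; apply: near_eq_cvg; near=> h.
have h0 : h != 0 by near: h; exact: nbhs_dnbhs_neq.
rewrite /= fE addrAC subrr add0r scaler_sumr; apply: eq_bigr => k _.
by rewrite scalerA exprS mulKf.
Unshelve. all: by end_near. Qed.

(* lbr is the bracket of left invariant vector fields of F_n, the field with
   value x at the identity being g |-> 'D_x (fmul g) 0. *)
Lemma left_invariant_field (x g : V) : 'D_x (fmul g) 0 = x *m exp_ad n (g 0 0).
Proof.
rewrite (@derive_expansion _ _ _ (fun=> x *m exp_ad n (g 0 0)) 1).
  by rewrite big_ord1 scale1r.
by move=> h; rewrite big_ord1 expr1 /fmul mul0mx !addr0 -scalemxAl.
Qed.

Lemma ad_e0E (x : V) : x *m ad_e0 R n = \sum_(1 <= i < n) x 0 (inord i) *: e_ R n i.+1.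
Proof.
apply/rowP => j; rewrite mxE summxE.
under eq_bigr do rewrite mxE.
transitivity (\sum_(0 <= i < n.+1)
    x 0 (inord i) * ((0 < i)%N && (j == i.+1 :> nat))%:R).
  by rewrite big_mkord; apply: eq_bigr => i _; rewrite inord_val.
rewrite big_ltn // mulr0 add0r; have [n0|n_gt0] := posnP n.
  by rewrite !big_geq ?n0.
rewrite big_nat_recr //= [X in _ + X](_ : _ = 0) ?addr0; last first.
  by rewrite n_gt0 /= ltn_eqF ?mulr0.
apply: eq_big_nat => i /andP[i0 lt_ip]; rewrite i0 !mxE eqxx /=.
by congr (_ * _%:R); congr nat_of_bool; rewrite -val_eqE /= inordK.
Qed.

Lemma lie_bracketE (x y : V) :
  'D_x (fun g => 'D_y (fmul g) 0) 0 - 'D_y (fun g => 'D_x (fmul g) 0) 0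
    = lbr x y.
Proof.
have H (u v : V) : 'D_u (fun g => 'D_v (fmul g) 0) 0 = u 0 0 *: (v *m ad_e0 R n).
  under eq_fun do rewrite left_invariant_field.
  rewrite (@derive_expansion _ _ _
    (fun k => (u 0 0 ^+ k / k`!%:R) *: (v *m ad_e0 R n ^+ k)) n).
    case: (posnP n) => [n0|n_gt0].
      rewrite (_ : ad_e0 R n = 0) ?mulmx0 ?scaler0; last first.
        by rewrite -[LHS]expr1 ad_e0_nilpotent // n0.
      by rewrite big1 // => k; have := ltn_ord k; rewrite {2}n0.
    rewrite (bigD1 (Ordinal n_gt0)) //= big1 ?addr0 => [|k nk].
      by rewrite scale1r !expr1 divr1.
    by rewrite (_ : (k == 0 :> nat) = false) ?scale0r //; apply/negbTE.
  move=> h; rewrite !mxE addr0 exp_ad0 mulmx1 mulmx_sumr big_ord_recl /=.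
  rewrite expr0 fact0 divr1 scale1r expr0 mulmx1; congr (_ + _).
  apply: eq_bigr => k _; rewrite -scalemxAr scalerA exprMn mulrA.
  by [].
rewrite !H !ad_e0E !scaler_sumr -sumrB /lbr; apply: eq_bigr => i _.
by rewrite !scalerA -scalerBl [y 0 0 * _]mulrC.
Qed.

End FiliformTheory.

Section FiliformSubgroups.
Variables (R : realType) (n : nat).
Local Notation V := 'rV[R]_n.+1.

Definition fzpow (g : V) (k : int) : V :=
  match k with
  | Posz p => iter p (fmul g) 0
  | Negz p => iter p.+1 (fmul (fginv g)) 0
  end.

Definition fcenter : set V := [set z | forall g, fmul z g = fmul g z].

Definition one_param (c : R -> V) : Prop :=
  (forall s t, c (s + t) = fmul (c s) (c t)) /\ forall t, derivable c t 1.

(* the Lie algebra of a closed subgroup *)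
Definition lie_alg (S : set V) : set V :=
  [set x | exists c, [/\ one_param c, (forall t, S (c t)) & 'D_1 c 0 = x]].

(* the connected subgroup with Lie algebra h: the subgroup generated by exp h *)
Definition conn_subgroup (h : set V) : set V :=
  \bigcap_(S in [set S : set V | subgroup fmul 0 S /\
     forall c, one_param c -> h ('D_1 c 0) -> forall t, S (c t)]) S.

Definition Hn : set V :=
  conn_subgroup [set` <<[seq e_ R n i | i <- iota 1 n]>>%VS].

Definition left_invariant (om : form2 R n.+1 V) : Prop :=
  forall g, is_pullback (Fn R n) (Fn R n) (fmul g) om om.

Definition at_id (om : form2 R n.+1 V) (x y : V) : R :=
  (x *m om (euclid_chart R n.+1) 0 *m y^T) 0 0.

Definition lie_perp (om : form2 R n.+1 V) (h : set V) : set V :=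
  [set x | forall y, h y -> at_id om x y = 0].

Definition perp (om : form2 R n.+1 V) (H : set V) : set V :=
  conn_subgroup (lie_perp om (lie_alg H)).

Definition abelian_ideal_codim1 (I : {vspace V}) : Prop :=
  [/\ (forall x y, y \in I -> lbr x y \in I),
      (forall x y, x \in I -> y \in I -> lbr x y = 0) & (\dim I).+1 = n.+1].

(* g(1): conjugation by the generator gam of Z in Gam = L \rtimes Z *)
Definition act1 (gam l : V) : V := fmul (fmul gam l) (fginv gam).

(* Gam is the internal semidirect product of L and the infinite cyclic group
   generated by gam. *)
Definition semidirect (Gam L : set V) (gam : V) : Prop :=
  [/\ (forall l, L l -> L (act1 gam l)),
      (forall x, Gam x <-> exists l k, L l /\ x = fmul l (fzpow gam k))
    & (forall k, L (fzpow gam k) -> k = 0)].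

(* ker (g(1) - Id) on the abelian group L, whose difference is l l'^-1 *)
Definition ker_act1 (gam : V) (L : set V) : set V :=
  [set l | L l /\ fmul (act1 gam l) (fginv l) = 0].

End FiliformSubgroups.

(* Main.v *)
(* Closedness of a left invariant omega is the cocycle identity, which on
   e_1, ..., e_n reads B(a+1,b) + B(a,b+1) = 0; since n is odd, it forces
   B(n,j) = 0 for all j >= 1.  As the centre is R e_n, its orthogonal is the
   hyperplane x_0 = 0, whatever omega is, and this hyperplane is the abelian
   ideal of codimension 1.

   On x_0 = 0 the group law is vector addition.  The map g(1) - Id sends L to
   itself and has kernel Gam /\ H.  Its (n-1)-st power maps an element of L with
   nonzero e_1-coordinate to a nonzero multiple of e_n, so Gam /\ H is a lattice
   of the line H; and since it embeds R^n / R e_n linearly with L mapped into the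
   discrete group L, the image Gam1 of L in K is discrete.  Cocompactness of L
   comes from that of Gam, because the coordinates x_0 of Gam form the group
   gam_0 Z.

   Each of M, N, H, H^perp, K and Rm is the quotient of a coordinate space by a
   group of deck transformations, so that its forms are the deck invariant forms
   upstairs, transported along local sections.  The restriction of omega to
   x_0 = 0 is constant with kernel R e_n, and hence descends to a constant
   symplectic form on Rm. *)
Require Import Defs.
From HB Require Import structures.
From mathcomp Require Import all_boot all_order all_algebra.
From mathcomp Require Import ring lra zify finmap.
From mathcomp Require Import all_classical all_reals all_analysis.
Set Implicit Arguments.
Unset Strict Implicit.
Unset Printing Implicit Defensive.
Import Order.TTheory GRing.Theory Num.Theory.
Import numFieldNormedType.Exports.
Local Open Scope classical_set_scope.
Local Open Scope ring_scope.

(** * Smooth maps between coordinate spaces *)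

Section SmoothCalculus.
Variable R : realType.

(** No computation can therefore start from explicit coordinates. A chart is reached through a
    smooth local section [s] of the projection, and a form downstairs is the pullback by [s] of the
    form upstairs. Since [s] is an arbitrary smooth map, closedness of a descended form involves its
    second derivatives, hence the symmetry of mixed derivatives below. The spaces [K], [Nm] and [Rm]
    are iterated quotients; surjective submersions can be cancelled, so each of them is literally
    one quotient of a coordinate space. On the group side, exp(tA) - 1 = tA(1 + AW), where A is the
    nilpotent matrix of ad e_0 and W commutes with A. For nonzero t this matrix has the kernel of A,
    and its (n-1)-st power is t^(n-1) A^(n-1). The centre, the kernel of g(1) - Id and a nonzero
    central lattice element all come from this factorisation. The bound n >= 3 is what makes the
    ideal unique: for n = 2 the span of e_0 and e_2 is another abelian ideal of codimension 1. *)

Lemma near_eq_differentiable (V W : normedModType R) (f g : V -> W) (x : V) :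
  (\near x, f x = g x) -> differentiable f x -> differentiable g x.
Proof.
move=> fg df; have -> : g = f + (g - f) by rewrite addrC subrK.
apply: differentiableD => //.
(* [g - f] vanishes near [x], so it is trivially o(h) there and its differential is zero. *)
have Z : (g - f) \o shift x = cst ((g - f) x) + \0 +o_ 0 id.
  have N : \forall h \near (0 : V), f (h + x) = g (h + x).
    by move: fg; rewrite (near_shift 0 x); apply: filterS => h; rewrite /= subr0.
  apply/eqaddoP => _/posnumP[e] /=; apply: filterS N => h Eh.
  have E0 : g x = f x by rewrite (nbhs_singleton fg).
  rewrite !fctE /= E0 -Eh !subrr addr0 subr0 normr0.
  by rewrite mulr_ge0.
have c0 : continuous (\0 : V -> W) by exact: cst_continuous.
have D : 'd (g - f) x = \0 :> (V -> W) by exact: diff_unique c0 Z.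
by apply/diff_locallyP; rewrite D.
Qed.

Lemma differentiable_rV (V : normedModType R) d (g : V -> 'rV[R]_d) (x : V) :
  (forall j, differentiable (fun y => g y 0 j) x) -> differentiable g x.
Proof.
move=> H; have -> : g = \sum_j (fun y => g y 0 j *: (delta_mx 0 j : 'rV[R]_d)).
  by rewrite funeqE => y; rewrite fct_sumE; exact: row_sum_delta.
by apply: differentiable_sum => j; exact: differentiableZl.
Qed.

Lemma Ck_sub k d (W W' : set 'rV[R]_d) f : W' `<=` W -> Ck k W f -> Ck k W' f.
Proof.
move=> WW; elim: k f => [|k IH] f /=; first by move=> H x /WW /H.
by case=> H1 H2; split=> [x /WW /H1 //|i]; exact: IH.
Qed.

(** Openness of [W] is essential: continuity and derivatives at a point of [W] see a whole
    neighbourhood, on which [f] and [g] must agree. *)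
Lemma Ck_eq k d (W : set 'rV[R]_d) f g : open W ->
  (forall x, W x -> f x = g x) -> Ck k W f -> Ck k W g.
Proof.
move=> oW; elim: k f g => [|k IH] f g fg.
  move=> H x Wx; have nW : nbhs x W by apply: open_nbhs_nbhs.
  suff : g @ x --> f x by rewrite fg.
  apply: cvg_trans (H x Wx).
  by apply: (@near_eq_cvg _ _ (nbhs x)); apply: filterS nW => y /fg.
case=> H1 H2; split=> [x Wx|i].
  apply: near_eq_differentiable (H1 x Wx); have nW := open_nbhs_nbhs (conj oW Wx).
  by apply: filterS nW => y /fg.
apply: IH (H2 i) => x Wx; apply: near_eq_derive.
have nW := open_nbhs_nbhs (conj oW Wx).
by apply: filterS nW => y /fg.
Qed.

Lemma Ck_S k d (W : set 'rV[R]_d) f : Ck k.+1 W f -> Ck k W f.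
Proof.
elim: k f => [|k IH] f [H1 H2].
  by move=> x Wx; apply: differentiable_continuous; exact: H1.
by split=> // i; apply: IH; exact: H2.
Qed.

Lemma Ck_cst k d (W : set 'rV[R]_d) (a : R) : Ck k W (fun=> a).
Proof.
elim: k a => [|k IH] a; first by move=> x _; exact: cst_continuous.
split=> [x _|i]; first exact: differentiable_cst.
have -> : 'D_(basis_vec R i) (fun=> a) = fun=> 0.
  by rewrite funeqE => x; rewrite derive_cst.
exact: IH.
Qed.

Lemma derive_coord d (v x : 'rV[R]_d) j : 'D_v (fun y : 'rV[R]_d => y 0 j) x = v 0 j.
Proof.
have E : derivable (@id 'rV[R]_d) x v by exact: derivable_id.
by have := derive_mx E; rewrite derive_id => /matrixP /(_ 0 j); rewrite mxE.
Qed.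

Lemma Ck_coord k d (W : set 'rV[R]_d) (j : 'I_d) : Ck k W (fun x => x 0 j).
Proof.
case: k => [|k]; first by move=> x _; exact: coord_continuous.
split=> [x _|i]; first exact: differentiable_coord.
have -> : 'D_(basis_vec R i) (fun x : 'rV[R]_d => x 0 j) = fun=> basis_vec R i 0 j.
  by rewrite funeqE => x; rewrite derive_coord.
exact: Ck_cst.
Qed.

Lemma Ck_add k d (W : set 'rV[R]_d) f g : open W ->
  Ck k W f -> Ck k W g -> Ck k W (fun x => f x + g x).
Proof.
move=> oW; elim: k f g => [|k IH] f g.
  by move=> Hf Hg x Wx; exact: continuousD (Hf x Wx) (Hg x Wx).
move=> [f1 f2] [g1 g2]; split=> [x Wx|i].
  by apply: differentiableD; [exact: f1|exact: g1].
apply: Ck_eq (IH _ _ (f2 i) (g2 i)) => // x Wx.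
by rewrite deriveD //; apply: diff_derivable; [exact: f1|exact: g1].
Qed.

Lemma Ck_mul k d (W : set 'rV[R]_d) f g : open W ->
  Ck k W f -> Ck k W g -> Ck k W (fun x => f x * g x).
Proof.
move=> oW; elim: k f g => [|k IH] f g.
  by move=> Hf Hg x Wx; exact: continuousM (Hf x Wx) (Hg x Wx).
move=> Cf Cg; have [f1 f2] := Cf; have [g1 g2] := Cg; split=> [x Wx|i].
  by apply: differentiableM; [exact: f1|exact: g1].
have H := Ck_add oW (IH _ _ (Ck_S Cf) (g2 i)) (IH _ _ (Ck_S Cg) (f2 i)).
apply: Ck_eq H => // x Wx.
by rewrite deriveM //; apply: diff_derivable; [exact: f1|exact: g1].
Qed.

Lemma Ck_sum k d (W : set 'rV[R]_d) (I : Type) (r : seq I) (f : I -> 'rV[R]_d -> R) :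
  open W -> (forall i, Ck k W (f i)) -> Ck k W (fun x => \sum_(i <- r) f i x).
Proof.
move=> oW H; elim: r => [|i r IH].
  by apply: Ck_eq (Ck_cst _ _ 0) => // x _; rewrite big_nil.
apply: Ck_eq (Ck_add oW (H i) IH) => // x _; by rewrite big_cons.
Qed.

Lemma derive_comp_coord d d' (f : 'rV[R]_d' -> R) (g : 'rV[R]_d -> 'rV[R]_d') x v :
  differentiable f (g x) -> differentiable g x ->
  'D_v (f \o g) x = \sum_j 'D_(basis_vec R j) f (g x) * 'D_v (fun y => g y 0 j) x.
Proof.
move=> df dg; rewrite deriveE; last exact: differentiable_comp.
rewrite diff_comp //= -(deriveE v dg) derive_mx; last exact: diff_derivable.
rewrite {1}[\matrix_(_, _) _]row_sum_delta linear_sum; apply: eq_bigr => j _.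
by rewrite linearZ mxE (deriveE _ df) mulrC.
Qed.

(** The inner map is given one spare degree of regularity, so that it stays differentiable down to
    the case k = 0 and a single argument yields both its continuity and the chain rule. The lemma is
    applied to smooth inner maps. *)
Lemma Ck_comp k d d' (W : set 'rV[R]_d) (W' : set 'rV[R]_d') f
    (g : 'rV[R]_d -> 'rV[R]_d') : open W -> (forall x, W x -> W' (g x)) ->
  (forall j, Ck k.+1 W (fun x => g x 0 j)) -> Ck k W' f -> Ck k W (f \o g).
Proof.
move=> oW WW; have dg : (forall j, Ck 1 W (fun x => g x 0 j)) ->
    forall x, W x -> differentiable g x.
  by move=> H x Wx; apply: differentiable_rV => j; have [+ _] := H j; apply.
have Ck1 j h : Ck j.+1 W h -> Ck 1 W h by elim: j => // j IH /Ck_S.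
elim: k f => [|k IH] f gs fs.
  move=> x Wx; apply: continuous_comp; last exact/fs/WW.
  exact/differentiable_continuous/dg.
have gs1 j : Ck 1 W (fun x => g x 0 j) by exact: Ck1 (gs j).
have [f1 f2] := fs; split=> [x Wx|i].
  by apply: differentiable_comp; [exact: dg|exact/f1/WW].
have H : Ck k W (fun x => \sum_j 'D_(basis_vec R j) f (g x) *
    'D_(basis_vec R i) (fun y => g y 0 j) x).
  apply: Ck_sum => // j; apply: Ck_mul => //.
    by apply: (IH _ _ (f2 j)) => l; exact: Ck_S.
  by have [_ /(_ i)/Ck_S] := gs j.
apply: Ck_eq H => // x Wx; rewrite derive_comp_coord //; last exact: dg.
exact/f1/WW.
Qed.

Lemma near_all d (u : 'rV[R]_d) (P : 'rV[R]_d -> Prop) :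
  (forall w, P w) -> \forall w \near u, P w.
Proof. by move=> H; exact: (@nearW _ (nbhs u)). Qed.

Section SmoothAt.
Variable d d' : nat.
Implicit Types g h : 'rV[R]_d -> 'rV[R]_d'.

Lemma smooth_at_near_eq g h u :
  (\forall w \near u, g w = h w) -> smooth_at g u -> smooth_at h u.
Proof.
move=> gh; have : nbhs u [set w | g w = h w] by exact: gh.
rewrite nbhsE => -[V [oV Vu] VE] [W [oW Wu gW]].
exists (W `&` V); split; [exact: openI|by []|].
move=> j k; apply: Ck_eq (openI oW oV) _ (Ck_sub (@subIsetl _ W V) (gW j k)).
by move=> x [_ /VE /= ->].
Qed.

Lemma smooth_at_differentiable g u : smooth_at g u -> differentiable g u.
Proof.
move=> [W [oW Wu gW]]; apply: differentiable_rV => j.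
by have [+ _] := gW j 1%N; apply.
Qed.

Lemma smooth_at_continuous g u : smooth_at g u -> {for u, continuous g}.
Proof. by move=> /smooth_at_differentiable /differentiable_continuous. Qed.

Lemma smooth_at_affine (b : 'rV[R]_d') (M : 'M[R]_(d, d')) u :
  smooth_at (fun x => b + x *m M) u.
Proof.
exists setT; split=> // [|j k]; first exact: openT.
have H : Ck k setT (fun x : 'rV[R]_d => b 0 j + \sum_i x 0 i * M i j).
  apply: Ck_add; [exact: openT|exact: Ck_cst|].
  apply: Ck_sum => [|i]; first exact: openT.
  by apply: Ck_mul; [exact: openT|exact: Ck_coord|exact: Ck_cst].
by apply: Ck_eq H => [|x _]; [exact: openT|rewrite !mxE].
Qed.

Lemma smooth_at_mulmx (M : 'M[R]_(d, d')) u : smooth_at (fun x => x *m M) u.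
Proof.
apply: smooth_at_near_eq (smooth_at_affine 0 M u).
by apply: near_all => w; rewrite add0r.
Qed.

Lemma smooth_at_add g h u : smooth_at g u -> smooth_at h u ->
  smooth_at (fun x => g x + h x) u.
Proof.
move=> [W [oW Wu gW]] [V [oV Vu hV]]; exists (W `&` V); split=> //.
  exact: openI.
move=> j k.
have H : Ck k (W `&` V) (fun x => g x 0 j + h x 0 j).
  apply: Ck_add; first exact: openI.
    by apply: Ck_sub (gW j k) => x [].
  by apply: Ck_sub (hV j k) => x [].
by apply: Ck_eq H => [|x _]; [exact: openI|rewrite mxE].
Qed.

End SmoothAt.

Lemma smooth_at_id d (u : 'rV[R]_d) : smooth_at id u.
Proof.
apply: smooth_at_near_eq (smooth_at_mulmx 1%:M u).
by apply: near_all => w; rewrite mulmx1.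
Qed.

Lemma smooth_at_comp d d' d'' (g : 'rV[R]_d -> 'rV[R]_d')
    (h : 'rV[R]_d' -> 'rV[R]_d'') u :
  smooth_at g u -> smooth_at h (g u) -> smooth_at (h \o g) u.
Proof.
move=> [W [oW Wu gW]] [V [oV Vu hV]]; exists (W `&` g @^-1` V); split=> //.
  rewrite openE => x [Wx Vgx]; apply: filterI; first exact: open_nbhs_nbhs.
  have /smooth_at_continuous gx : smooth_at g x by exists W.
  by apply: gx; exact: open_nbhs_nbhs.
move=> j k; apply: (@Ck_comp k _ _ _ V (fun y => h y 0 j)).
- rewrite openE => x [Wx Vgx]; apply: filterI; first exact: open_nbhs_nbhs.
  have /smooth_at_continuous gx : smooth_at g x by exists W.
  by apply: gx; exact: open_nbhs_nbhs.
- by move=> x [].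
- by move=> i; apply: Ck_sub (gW i k.+1) => x [].
- exact: hV.
Qed.

Lemma jacobian_comp d d' d'' (g : 'rV[R]_d -> 'rV[R]_d')
    (h : 'rV[R]_d' -> 'rV[R]_d'') u :
  smooth_at g u -> smooth_at h (g u) -> 'J (h \o g) u = 'J g u *m 'J h (g u).
Proof.
move=> /smooth_at_differentiable dg /smooth_at_differentiable dh.
have dgh : differentiable (h \o g) u by exact: differentiable_comp.
apply/row_matrixP => i; rewrite !rowE mulmxA.
rewrite -(deriveEjacobian _ dg) -(deriveEjacobian _ dgh) -(deriveEjacobian _ dh).
by rewrite (deriveE _ dgh) (deriveE _ dh) (deriveE _ dg) diff_comp.
Qed.

Lemma row_jacobian d d' (g : 'rV[R]_d -> 'rV[R]_d') u i : differentiable g u ->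
  row i ('J g u) = 'D_(basis_vec R i) g u.
Proof. by move=> dg; rewrite rowE; exact: esym (deriveEjacobian _ dg). Qed.

Lemma jacobian_near_eq d d' (g h : 'rV[R]_d -> 'rV[R]_d') u :
  smooth_at g u -> (\forall w \near u, g w = h w) -> 'J g u = 'J h u.
Proof.
move=> sg gh; have dg := smooth_at_differentiable sg.
have dh := smooth_at_differentiable (smooth_at_near_eq gh sg).
apply/row_matrixP => i; apply: etrans (row_jacobian i dg) _.
by apply: etrans (esym (row_jacobian i dh)); exact: near_eq_derive.
Qed.

Lemma jacobianE d d' (g : 'rV[R]_d -> 'rV[R]_d') u i j : smooth_at g u ->
  'J g u i j = 'D_(basis_vec R i) (fun x => g x 0 j) u.
Proof.
move=> /smooth_at_differentiable dg.
transitivity (('D_(basis_vec R i) g u) 0 j).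
  by rewrite -(row_jacobian i dg) [RHS]mxE.
by rewrite derive_mx ?mxE //; exact: diff_derivable.
Qed.

Lemma derive_mulmx d d' (M : 'M[R]_(d, d')) u v :
  'D_v (fun x : 'rV[R]_d => x *m M) u = v *m M.
Proof.
have dM := smooth_at_differentiable (smooth_at_mulmx M u).
have E : (fun x : 'rV[R]_d => x *m M) = mulmxr M by [].
rewrite deriveE // E diff_lin //= => x.
by apply: smooth_at_continuous; exact: smooth_at_mulmx.
Qed.

Lemma jacobian_affine d d' (b : 'rV[R]_d') (M : 'M[R]_(d, d')) u :
  'J (fun x : 'rV[R]_d => b + x *m M) u = M.
Proof.
apply/row_matrixP => i; rewrite !rowE -!deriveEjacobian //; last first.
  exact/smooth_at_differentiable/smooth_at_affine.
rewrite deriveD; last 2 first.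
- exact: derivable_cst.
- exact/diff_derivable/smooth_at_differentiable/smooth_at_mulmx.
by rewrite derive_cst add0r derive_mulmx.
Qed.

Lemma jacobian_mulmx d d' (M : 'M[R]_(d, d')) u :
  'J (fun x : 'rV[R]_d => x *m M) u = M.
Proof.
rewrite -[RHS](jacobian_affine 0 M u); apply: jacobian_near_eq.
  exact: smooth_at_mulmx.
by apply: near_all => w; rewrite add0r.
Qed.

Lemma jacobian_id d (u : 'rV[R]_d) : 'J id u = 1%:M.
Proof.
rewrite -[RHS](jacobian_mulmx 1%:M u); apply: jacobian_near_eq.
  exact: smooth_at_id.
by apply: near_all => w; rewrite mulmx1.
Qed.

(** Derivatives are taken in the full space, so [Ck] is a condition at each point of [W] separately
    and may be checked on singletons. *)
Lemma smooth_on_local d (W : set 'rV[R]_d) f :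
  (forall u, W u -> exists2 V, V u & smooth_on V f) -> smooth_on W f.
Proof.
move=> H k; suff Hp : forall u, W u -> Ck k [set u] f.
  elim: k f Hp {H} => [|k IH] f Hp.
    by move=> x Wx; exact: (Hp x Wx).
  split=> [x Wx|i]; first by have [+ _] := Hp x Wx; apply.
  by apply: IH => u /Hp [_ /(_ i)].
by move=> u /H [V Vu fV]; apply: Ck_sub (fV k) => _ ->.
Qed.

(** * Symmetry of mixed second derivatives *)

Lemma is_derive_line d (F : 'rV[R]_d -> R) (x v : 'rV[R]_d) (t : R) :
  differentiable F (x + t *: v) ->
  is_derive t 1 (fun t => F (x + t *: v)) ('D_v F (x + t *: v)).
Proof.
move=> /(@diff_derivable _ _ _ F _ v) dF.
have E : (fun h : R => h^-1 *: (((fun t => F (x + t *: v)) \o shift t) (h *: 1)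
      - F (x + t *: v))) =
    (fun h => h^-1 *: ((F \o shift (x + t *: v)) (h *: v) - F (x + t *: v))).
  by rewrite funeqE => h /=; rewrite [h *: 1]mulr1 scalerDl addrCA.
by split; rewrite ?/derivable ?/derive E.
Qed.

(** The mean value theorem is used twice: along [v] for the increment of [f] in the direction [w],
    then along [w] for the derivative ['D_v f]. *)
Lemma second_difference d (f : 'rV[R]_d -> R) (u v w : 'rV[R]_d) (h : R) : 0 < h ->
  (forall s t : R, 0 <= s <= h -> 0 <= t <= h -> differentiable f (u + s *: v + t *: w) /\
     differentiable ('D_v f) (u + s *: v + t *: w)) ->
  exists s t, [/\ 0 <= s <= h, 0 <= t <= h &
    f (u + h *: v + h *: w) - f (u + h *: v) - f (u + h *: w) + f u =
    'D_w ('D_v f) (u + s *: v + t *: w) * h ^+ 2].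
Proof.
move=> h0 H; have h00 : 0 <= (0 : R) <= h by rewrite lexx ltW.
have hh : 0 <= h <= h by rewrite lexx ltW.
pose p s := f (u + h *: w + s *: v) - f (u + s *: v).
have dp s : 0 <= s <= h ->
    is_derive s 1 p ('D_v f (u + s *: v + h *: w) - 'D_v f (u + s *: v)).
  move=> sh; rewrite [u + s *: v + _]addrAC; apply: is_deriveB.
    by apply: is_derive_line; rewrite addrAC; have [] := H s h sh hh.
  by apply: is_derive_line; have [] := H s 0 sh h00; rewrite scale0r addr0.
have itv x : x \in `]0, h[%R -> 0 <= x <= h.
  by rewrite in_itv /= => /andP[/ltW -> /ltW ->].
have pc : {within `[0, h], continuous p}.
  by apply: derivable_within_continuous => s; rewrite in_itv /= => /dp [].
have [s] := MVT_segment (ltW h0) (fun s sh => dp s (itv s sh)) pc.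
rewrite in_itv /= => sh Es.
have dq t : 0 <= t <= h -> is_derive t 1 (fun t => 'D_v f (u + s *: v + t *: w))
    ('D_w ('D_v f) (u + s *: v + t *: w)).
  by move=> th; apply: is_derive_line; have [] := H s t sh th.
have qc : {within `[0, h], continuous (fun t => 'D_v f (u + s *: v + t *: w))}.
  by apply: derivable_within_continuous => t; rewrite in_itv /= => /dq [].
have [t] := MVT_segment (ltW h0) (fun t th => dq t (itv t th)) qc.
rewrite in_itv /= scale0r addr0 => th Et; exists s, t; split=> //.
move: Es; rewrite /p Et !subr0 scale0r !addr0 => Es.
rewrite expr2 mulrA -Es [u + h *: v + _]addrAC; ring.
Qed.

(** Both mixed derivatives, at two possibly different points near [u], equal the same second
    difference divided by h^2. Continuity at [u] then puts their values at [u] within any [e] of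
    each other. *)
Lemma derive_sym d (W : set 'rV[R]_d) f u i j : open W -> smooth_on W f -> W u ->
  'D_(basis_vec R i) ('D_(basis_vec R j) f) u =
  'D_(basis_vec R j) ('D_(basis_vec R i) f) u.
Proof.
move=> oW sf Wu; set v := basis_vec R j; set w := basis_vec R i.
have [f1 f2] := sf 3.
have cont k l : {for u, continuous ('D_(basis_vec R k) ('D_(basis_vec R l) f))}.
  by have [_ /(_ k)[+ _]] := f2 l => /(_ u Wu) /differentiable_continuous.
apply/eqP; rewrite -subr_eq0 -normr_le0; apply/ler_addgt0Pr => e e0; rewrite add0r.
have e2 : 0 < e / 2 by rewrite divr_gt0.
have nW : \forall p \near u, [/\ W p,
    `|'D_w ('D_v f) u - 'D_w ('D_v f) p| < e / 2 &
    `|'D_v ('D_w f) u - 'D_v ('D_w f) p| < e / 2].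
  have H1 := open_nbhs_nbhs (conj oW Wu).
  have H2 : nbhs u [set p | `|'D_w ('D_v f) u - 'D_w ('D_v f) p| < e / 2].
    exact: ((cvgrPdist_lt _ _).1 (cont i j) _ e2).
  have H3 : nbhs u [set p | `|'D_v ('D_w f) u - 'D_v ('D_w f) p| < e / 2].
    exact: ((cvgrPdist_lt _ _).1 (cont j i) _ e2).
  apply: filterS (filterI H1 (filterI H2 H3)).
  move=> p [h1 [h2 h3]]; exact: And3 h1 h2 h3.
have [r /= r0 Br] := (nbhs_ballP _ _).1 nW.
have vw0 : 0 < `|v| + `|w| + 1 by rewrite ltr_wpDl // addr_ge0.
(* With this [h] every point u + s v + t w with 0 <= s, t <= h stays in the ball of radius [r]; the
   summand 1 keeps the denominator positive without computing the norms. *)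
pose h := r / (`|v| + `|w| + 1) / 2.
have h0 : 0 < h by rewrite !divr_gt0.
have inB s t : 0 <= s <= h -> 0 <= t <= h -> ball u r (u + s *: v + t *: w).
  move=> /andP[s0 sh] /andP[t0 th]; rewrite -ball_normE /ball_ /=.
  rewrite -addrA opprD addNKr normrN.
  apply: le_lt_trans (ler_normD _ _) _; rewrite !normrZ !ger0_norm //.
  have : s * `|v| + t * `|w| <= h * (`|v| + `|w|).
    by rewrite mulrDr lerD // ler_wpM2r.
  move=> /le_lt_trans -> //.
  have : h * (`|v| + `|w|) < h * (`|v| + `|w| + 1) * 2.
    rewrite -mulrA ltr_pM2l // mulr_natr mulr2n.
    have := normr_ge0 v; have := normr_ge0 w; lra.
  suff -> : h * (`|v| + `|w| + 1) * 2 = r by [].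
  by rewrite /h; field; rewrite gt_eqF.
have Dv k p : W p -> differentiable ('D_(basis_vec R k) f) p.
  by have [+ _] := f2 k; apply.
have [s [t [sh th E1]]] : exists s t, [/\ 0 <= s <= h, 0 <= t <= h &
    f (u + h *: v + h *: w) - f (u + h *: v) - f (u + h *: w) + f u =
    'D_w ('D_v f) (u + s *: v + t *: w) * h ^+ 2].
  apply: second_difference => // s t sh th; have [? _ _] := Br _ (inB s t sh th).
  by split; [exact: f1|exact: Dv].
have [t' [s' [th' sh' E2]]] : exists s t, [/\ 0 <= s <= h, 0 <= t <= h &
    f (u + h *: w + h *: v) - f (u + h *: w) - f (u + h *: v) + f u =
    'D_v ('D_w f) (u + s *: w + t *: v) * h ^+ 2].
  apply: second_difference => // t' s' sh' th'.
  rewrite addrAC; have [? _ _] := Br _ (inB s' t' th' sh').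
  by split; [exact: f1|exact: Dv].
have E : 'D_w ('D_v f) (u + s *: v + t *: w) = 'D_v ('D_w f) (u + t' *: w + s' *: v).
  apply: (@mulIf _ (h ^+ 2)); first by rewrite expf_neq0 // gt_eqF.
  apply: etrans (esym E1) (etrans _ E2).
  have -> : u + h *: v + h *: w = u + h *: w + h *: v by exact: addrAC.
  by congr (_ + _); exact: addrAC.
have [_ A1 _] := Br _ (inB s t sh th).
have [_ _ A2] := Br _ (inB s' t' sh' th').
rewrite E in A1; rewrite addrAC in A2.
have fin (a b c : R) : `|a - c| < e / 2 -> `|b - c| < e / 2 -> `|a - b| <= e.
  move=> /ltW ac /ltW bc; have -> : a - b = (a - c) - (b - c) by ring.
  by apply: le_trans (ler_normB _ _) _; rewrite [leRHS]splitr lerD.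
exact: fin A1 A2.
Qed.

End SmoothCalculus.

(** * Quotients of coordinate spaces *)

Section ManifoldMaps.
Variable R : realType.

(** The part of [is_manifold] that suffices to move between points and charts; it is available
    before transition maps and separation are known. *)
Definition atlas d T (X : mfd R d T) : Prop :=
  [/\ (forall c, charts X c -> open c.1),
      (forall c u v, charts X c -> c.1 u -> c.1 v -> c.2 u = c.2 v -> u = v),
      (forall c u, charts X c -> c.1 u -> pts X (c.2 u))
    & (forall x, pts X x -> exists c u, [/\ charts X c, c.1 u & c.2 u = x])].

Lemma near_comp d d' (g : 'rV[R]_d -> 'rV[R]_d') u (P : 'rV[R]_d' -> Prop) :
  smooth_at g u -> (\forall w \near g u, P w) -> \forall w \near u, P (g w).
Proof. by move=> /smooth_at_continuous gc H; exact: (gc _ H). Qed.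

Lemma near_open d (W : set 'rV[R]_d) u : open W -> W u -> \forall w \near u, W w.
Proof. by move=> oW Wu; exact: open_nbhs_nbhs. Qed.

Lemma local_rep_comp d d' d'' T T' T'' (f : T -> T') (h : T' -> T'')
    (c : chart R d T) (c' : chart R d' T') (c'' : chart R d'' T'') u g g' :
  local_rep f c c' u g -> local_rep h c' c'' (g u) g' ->
  local_rep (h \o f) c c'' u (g' \o g).
Proof.
move=> [sg c'g Hg] [sg' c''g Hg']; split=> //; first exact: smooth_at_comp.
by apply: filterS2 Hg (near_comp sg Hg') => w /= ->.
Qed.

Lemma smooth_map_comp d d' d'' T T' T'' (X : mfd R d T) (Y : mfd R d' T')
    (Z : mfd R d'' T'') (f : T -> T') (h : T' -> T'') :
  atlas X -> atlas Y -> smooth_map X Y f -> smooth_map Y Z h ->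
  smooth_map X Z (h \o f).
Proof.
move=> [_ _ Xs _] [_ _ _ Yc] [fXY fs] [hYZ hs]; split=> [x /fXY /hYZ //|].
move=> c c'' u v Xc Zc cu cv /= E.
have [c' [z [Yc' c'z zE]]] := Yc _ (fXY _ (Xs _ _ Xc cu)).
have [g Hg] := fs c c' u z Xc Yc' cu c'z (esym zE).
have [_ c'g /nbhs_singleton gE] := Hg.
have [g' Hg'] := hs c' c'' (g u) v Yc' Zc c'g cv (etrans (congr1 h (esym gE)) E).
by exists (g' \o g); exact: local_rep_comp Hg Hg'.
Qed.

Lemma submersion_smooth d d' T T' (X : mfd R d T) (Y : mfd R d' T') q :
  submersion X Y q -> smooth_map X Y q.
Proof.
by move=> [qXY qs]; split=> // c c' u v Xc Yc cu cv E; have [] := qs _ Yc c u v.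
Qed.

(** Surjectivity provides a preimage of the chart point and submersivity a section through it. This
    is the only access to the charts of a quotient. *)
Lemma lift_section d d' T T' (X : mfd R d T) (Y : mfd R d' T') q c' v :
  atlas X -> atlas Y -> submersion X Y q -> q @` pts X = pts Y ->
  charts Y c' -> c'.1 v ->
  exists c u s, [/\ charts X c, c.1 u, smooth_at s v, s v = u &
    \forall w \near v, q (c.2 (s w)) = c'.2 w].
Proof.
move=> [_ _ _ Xc] [_ _ Ys _] [_ qs] qX Yc' c'v.
have : (q @` pts X) (c'.2 v) by rewrite qX; exact: Ys.
case=> x /Xc [c [u [Xc' cu <-]]] E.
have [_ [s [ss su Hs]]] := qs _ Yc' c u v Xc' cu c'v E.
by exists c, u, s.
Qed.

(** Near a chart point [h] is [h \o q] composed with a local section of [q], so smoothness may be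
    tested upstairs. *)
Lemma smooth_map_descend d d' d'' T T' T'' (X : mfd R d T) (Y : mfd R d' T')
    (Z : mfd R d'' T'') (q : T -> T') (h : T' -> T'') :
  atlas X -> atlas Y -> submersion X Y q -> q @` pts X = pts Y ->
  smooth_map X Z (h \o q) -> smooth_map Y Z h.
Proof.
move=> aX aY sq qX [hXZ hs]; split=> [y|]; first by rewrite -qX => -[x /hXZ ? <-].
move=> c c'' u v Yc Zc cu cv E.
have [b [w [s [Xb bw ss sw Hs]]]] := lift_section aX aY sq qX Yc cu.
have Es := nbhs_singleton Hs; rewrite /= in Es.
have E' : h (q (b.2 w)) = c''.2 v by rewrite -sw Es.
have [g [sg c''g Hg]] := hs b c'' w v Xb Zc bw cv E'.
exists (g \o s); split=> /=; rewrite -?sw in sg c''g Hg *.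
- exact: smooth_at_comp.
- by [].
- by apply: filterS2 Hs (near_comp ss Hg) => z /= <-.
Qed.

Lemma submersive_comp d d' d'' T T' T'' (X : mfd R d T) (Y : mfd R d' T')
    (p : T -> T') (h : T' -> T'') (c'' : chart R d'' T'') :
  atlas X -> atlas Y -> submersion X Y p ->
  submersive_over Y h c'' -> submersive_over X (h \o p) c''.
Proof.
move=> [_ _ Xs _] [_ Yi Ys Yc] [pXY ps] sh b w v Xb bw c''v /= E.
have [c [u [Yc' cu cuE]]] := Yc _ (pXY _ (Xs _ _ Xb bw)).
have [[gp Hp] [sp [ssp spu Hsp]]] := ps c Yc' b w u Xb bw cu (esym cuE).
have [sgp cgp /nbhs_singleton gpE] := Hp.
have gpu : gp w = u by apply: (Yi c) => //; rewrite -gpE.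
have E' : h (c.2 u) = c''.2 v by rewrite cuE.
have [[g Hg] [s [ss su Hs]]] := sh c u v Yc' cu c''v E'.
split; first by exists (g \o gp); apply: local_rep_comp Hp _; rewrite gpu.
exists (sp \o s); rewrite /= su spu; split=> //.
  by apply: smooth_at_comp => //; rewrite su.
rewrite -su in Hsp.
by apply: filterS2 Hs (near_comp ss Hsp) => z <- /= <-.
Qed.

(** Cancellation, converse to [submersive_comp]: a section [t] of [p] turns a local expression of
    [h \o p] into one of [h], and a section of [h \o p] followed by the local expression of [p] is a
    section of [h]. *)
Lemma submersive_factor d d' d'' T T' T'' (X : mfd R d T) (Y : mfd R d' T')
    (p : T -> T') (h : T' -> T'') (c'' : chart R d'' T'') :
  atlas X -> atlas Y -> submersion X Y p -> p @` pts X = pts Y ->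
  submersive_over X (h \o p) c'' -> submersive_over Y h c''.
Proof.
move=> aX aY sp pX sh c u v Yc cu c''v E; have [Xo _ Xs Xc] := aX.
have [_ Yi _ _] := aY.
have [b [w [t [Xb bw st tw Ht]]]] := lift_section aX aY sp pX Yc cu.
have Et : p (b.2 w) = c.2 u by rewrite -tw; exact: (nbhs_singleton Ht).
have E' : (h \o p) (b.2 w) = c''.2 v by rewrite /= Et.
have [[g [sg cg Hg]] [s [ss sw Hs]]] := sh b w v Xb bw c''v E'.
have [[gp [sgp cgp Hgp]] _] := sp.2 c Yc b w u Xb bw cu Et.
have gpu : gp w = u.
  by apply: (Yi c) => //; rewrite -Et; exact: esym (nbhs_singleton Hgp).
split.
  exists (g \o t); rewrite -tw in sg cg Hg; split=> //=.
    exact: smooth_at_comp.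
  by apply: filterS2 Ht (near_comp st Hg) => z <- /= <-.
exists (gp \o s); split=> /=; rewrite ?sw //.
  by apply: smooth_at_comp => //; rewrite sw.
rewrite -sw in Hgp.
by apply: filterS2 Hs (near_comp ss Hgp) => z /= <- <-.
Qed.

Lemma mfd_eq d T (X Y : mfd R d T) : pts X = pts Y ->
  (forall c, charts X c <-> charts Y c) -> X = Y.
Proof.
case: X => pX cX; case: Y => pY cY /= -> H; congr Mfd.
by apply/seteqP; split=> c /H.
Qed.

(** The quotient atlas is defined by submersivity alone, so composition and cancellation make the
    two structures equal, not merely diffeomorphic. *)
Lemma quotient_mfd_comp d d' d'' T T' T'' (X : mfd R d T) (Y : mfd R d' T')
    (p : T -> T') (h : T' -> T'') :
  atlas X -> atlas Y -> submersion X Y p -> p @` pts X = pts Y ->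
  quotient_mfd d'' Y h = quotient_mfd d'' X (h \o p).
Proof.
move=> aX aY sp pX; apply: mfd_eq => /= [|c].
  by rewrite -pX image_comp.
rewrite -pX image_comp.
by split=> -[? ? ? H]; split=> //; [exact: submersive_comp H|exact: submersive_factor H].
Qed.

Lemma quotient_submersion d d' T T' (X : mfd R d T) (q : T -> T') :
  submersion X (quotient_mfd d' X q) q.
Proof. by split=> [x Xx|c' []//]; exists x. Qed.

Lemma submersive_euclid d d' T' (f : 'rV[R]_d -> T') (c' : chart R d' T') :
  submersive_over (euclid R d) f c' <->
  forall u v, c'.1 v -> f u = c'.2 v ->
    (exists g, [/\ smooth_at g u, c'.1 (g u) & \forall w \near u, f w = c'.2 (g w)]) /\
    exists s, [/\ smooth_at s v, s v = u & \forall w \near v, f (s w) = c'.2 w].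
Proof.
by split=> [H u v c'v E|H c u v -> _]; [exact: (H (euclid_chart R d) u v erefl I)|exact: H].
Qed.

Lemma euclid_atlas d : atlas (euclid R d).
Proof.
split=> [c ->|c u v ->|c u ->|x _] //=; first exact: openT.
by exists (euclid_chart R d), x.
Qed.

Lemma mopen_euclid d (W : set 'rV[R]_d) : mopen (euclid R d) W <-> open W.
Proof.
split=> [[_ /(_ (euclid_chart R d) erefl)]|oW] /=.
  by rewrite setTI preimage_id.
by split=> // c -> /=; rewrite setTI preimage_id.
Qed.

Lemma mopen_quotient d d' T (Y : mfd R d' T) (f : 'rV[R]_d -> T) (W : set T) :
  atlas Y -> submersion (euclid R d) Y f -> range f = pts Y ->
  mopen Y W <-> W `<=` pts Y /\ open (f @^-1` W).
Proof.
move=> aY sf fY; have [_ _ _ Yc] := aY; split=> -[WY oW]; split=> //.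
  rewrite openE => x Wfx; have [c [v [Yc' cv cvE]]] := Yc _ (WY _ Wfx).
  have [[g [sg cg Hg]] _] := (submersive_euclid f c).1 (sf.2 c Yc') x v cv (esym cvE).
  have cW : (c.1 `&` c.2 @^-1` W) (g x).
    by split=> //=; rewrite -(nbhs_singleton Hg).
  have := near_comp sg (near_open (oW c Yc') cW).
  by apply: filterS2 Hg => w /= -> [].
move=> c Yc'; rewrite openE => u [cu Wcu].
have [_ [x [s [-> _ ss su /= Hs]]]] := lift_section (@euclid_atlas d) aY sf fY Yc' cu.
have co : open c.1 by case: aY => + _ _ _; apply.
apply: filterI; first exact: near_open.
have Wsu : (f @^-1` W) (s u) by rewrite /= (nbhs_singleton Hs).
by apply: filterS2 Hs (near_comp ss (near_open oW Wsu)) => w /= <-.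
Qed.

Lemma rV_countable_basis d : exists B : set (set 'rV[R]_d),
  [/\ countable B, (forall b, B b -> open b) &
      forall W x, open W -> W x -> exists b, [/\ B b, b x & b `<=` W]].
Proof.
pose bl (q : 'rV[rat]_d * nat) : set 'rV[R]_d :=
  ball (map_mx ratr q.1 : 'rV[R]_d) (q.2.+1%:R^-1).
exists (bl @` setT); split.
- by apply: card_le_trans (card_image_le _ _) _; exact: countableP.
- by move=> _ [q _ <-]; exact: ball_open.
move=> W x oW Wx; have [e /= e0 Be] := (nbhs_ballP _ _).1 (open_nbhs_nbhs (conj oW Wx)).
(* A radius below e/2 is needed because the rational centre is only within that radius of [x]. *)
have [k /= ke] : exists k, k.+1%:R^-1 < e / 2.
  have e2 : 0 < e / 2 by rewrite divr_gt0.
  have [k _ H] := near_infty_natSinv_lt (PosNum e2).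
  by exists k; exact: H (leqnn k).
have k0 : 0 < k.+1%:R^-1 :> R by rewrite invr_gt0.
have qx i : {q : rat | `|x 0 i - ratr q| < k.+1%:R^-1}.
  have lt_itv : x 0 i - k.+1%:R^-1 < x 0 i + k.+1%:R^-1.
    by rewrite ltrBlDr -addrA ltrDl addr_gt0.
  apply/cid; have [q] := rat_in_itvoo lt_itv.
  by rewrite in_itv /= => qi; exists q; rewrite distrC ltr_distl.
pose q := \row_i sval (qx i).
have xq : ball (map_mx ratr q : 'rV[R]_d) k.+1%:R^-1 x.
  split=> // i j; rewrite !mxE ord1 -ball_normE /ball_ /= distrC.
  exact: svalP (qx j).
exists (bl (q, k)); split=> //; first by exists (q, k).
move=> y qy; apply: Be; have := ball_triangle (ball_sym xq) qy.
by apply: le_ball; rewrite [leRHS]splitr lerD // ltW.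
Qed.

(* [D] is a set of deck transformations, transitive on the fibres of [f]. *)
Definition covering d T (D : set ('rV[R]_d -> 'rV[R]_d)) (f : 'rV[R]_d -> T) : Prop :=
  [/\ (forall a, D a -> (forall w, smooth_at a w) /\ forall w, f (a w) = f w),
      (forall x y, f x = f y -> exists2 a, D a & a x = y),
      (forall x, exists U, [/\ open U, U x &
         forall y z, U y -> U z -> f y = f z -> y = z])
    & (forall x y, f x <> f y -> exists U V, [/\ open U, open V, U x, V y &
         forall u v, U u -> V v -> f u <> f v])].

(** * Quotients by deck transformations are manifolds *)

Section Covering.
Variables (d : nat) (T : Type) (D : set ('rV[R]_d -> 'rV[R]_d)).
Variable f : 'rV[R]_d -> T.
Hypothesis cf : covering D f.
Local Notation Q := (quotient_mfd d (euclid R d) f).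

(** A deck transformation moves any point of a fibre to the one lying in [U]; it serves as the local
    expression of [f], and the one in the opposite direction as the local section. *)
Lemma covering_chart U : open U ->
  (forall y z, U y -> U z -> f y = f z -> y = z) -> charts Q (U, f).
Proof.
move=> oU Ui; have [Ds Dt _ _] := cf; split=> //=.
- by move=> y z; rewrite !inE; exact: Ui.
- by move=> _ [x _ <-]; exists x.
apply/submersive_euclid => u v /= Uv fuv; split.
  have [a /Ds [sa fa] av] := Dt _ _ fuv; exists a; split=> //; first by rewrite av.
  by apply: near_all => w; rewrite fa.
have [a /Ds [sa fa] av] := Dt _ _ (esym fuv); exists a; split=> //.
by apply: near_all => w; rewrite fa.
Qed.

Lemma covering_atlas : atlas Q.
Proof.
split=> [c []//|c u v [_ ci _ _] cu cv|c u [_ _ cs _] cu|_ [x _ <-]].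
- by apply: ci; rewrite inE.
- by apply: cs; exists u.
have [_ _ /(_ x) [U [oU Ux Ui]] _] := cf.
by exists (U, f), x; split=> //; exact: covering_chart.
Qed.

Lemma covering_submersion : submersion (euclid R d) Q f.
Proof. exact: quotient_submersion. Qed.

Lemma mopen_covering W : mopen Q W <-> W `<=` range f /\ open (f @^-1` W).
Proof. exact: mopen_quotient covering_atlas covering_submersion _. Qed.

(** The preimage of the image is the union of the preimages of [U] under deck transformations, which
    are continuous. *)
Lemma covering_open U : open U -> mopen Q (f @` U).
Proof.
move=> oU; apply/mopen_covering; split; first by move=> _ [x _ <-]; exists x.
have [Ds Dt _ _] := cf.
rewrite openE => x [u Uu fux]; have [a /Ds [sa fa] ax] := Dt _ _ (esym fux).
rewrite -ax in Uu; apply: filterS (near_comp (sa x) (near_open oU Uu)) => w Uw.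
by exists (a w).
Qed.

Lemma covering_manifold : is_manifold Q.
Proof.
have [Ds Dt Dl Dh] := cf; have aQ := covering_atlas; have sQ := covering_submersion.
split.
- by move=> c [? ? ? ?]; split.
- case: aQ => _ _ _ H x /H [c [u [Qc cu <-]]]; exists c => //; by exists u.
(* Transition maps are smooth because [id] on the quotient descends from the smooth map [f]. *)
- apply: (smooth_map_descend (euclid_atlas d) aQ sQ erefl).
  exact: (submersion_smooth sQ).
- move=> _ _ [x _ <-] [y _ <-] /Dh [U [V [oU oV Ux Vy UV]]].
  exists (f @` U), (f @` V); split; try exact: covering_open; first by exists x.
    by exists y.
  by rewrite -subset0 => _ [[u Uu <-] [v Vv]] /esym; exact: UV.
have [B [cB oB Bb]] := rV_countable_basis d.
exists [set f @` b | b in B]; split.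
- exact: card_le_trans (card_image_le _ _) cB.
- by move=> _ [b /oB ob <-]; exact: covering_open.
move=> W _ /mopen_covering [WQ oW] /[dup] /WQ [x _ <-] Wx.
have [b [Bbb bx bW]] := Bb _ _ oW Wx.
by exists (f @` b); split=> [|| _ [y /bW Wy <-]//]; [exists b|exists x].
Qed.

End Covering.

(** The case of a trivial deck group; it brings the linear parametrizations of [H], [Hp] and [K]
    under the same lemmas as the projections to M, N and Rm. *)
Lemma injective_covering d T (f : 'rV[R]_d -> T) : injective f -> covering [set id] f.
Proof.
move=> fi; split.
- by move=> _ ->; split=> // w; exact: smooth_at_id.
- by move=> x y /fi ->; exists id.
- by move=> x; exists setT; split=> // [|y z _ _ /fi]; first exact: openT.
move=> x y fxy; have xy : x != y by apply/eqP => xy; apply: fxy; rewrite xy.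
have := @norm_hausdorff R 'rV[R]_d; rewrite open_hausdorff => /(_ x y xy).
case=> -[U V] /= [Ux Vy] [oU oV /eqP/seteqP[UV _]]; exists U, V.
rewrite !inE in Ux Vy; split=> // u v Uu Vv /fi uv.
by apply: (UV u); split=> //; rewrite uv.
Qed.

Lemma covering_diffeo d T (f : 'rV[R]_d -> T) : injective f ->
  diffeo (euclid R d) (quotient_mfd d (euclid R d) f) f.
Proof.
move=> fi; have cf := injective_covering fi; have sQ := covering_submersion f.
split; first exact: submersion_smooth.
pose f' y := xget 0 (f @^-1` [set y]).
have f'K x : f' (f x) = x.
  by apply: fi; rewrite /f'; case: xgetP => // /(_ x); case.
exists f'; split=> // [|_ [x _ <-]]; last by rewrite f'K.
apply: smooth_map_descend (euclid_atlas d) (covering_atlas cf) sQ _ _ => //.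
split=> // c c' u v -> -> _ _ _; exists id; split=> //=; first exact: smooth_at_id.
by apply: near_all => w /=; rewrite f'K.
Qed.

(** * Discrete subgroups acting by left translations *)

Section GroupCovering.
Variables (d : nat) (T : Type).
Local Notation V := 'rV[R]_d.
Variables (mul : V -> V -> V) (inv : V -> V) (e : V) (Gam : set V) (f : V -> T).
Hypothesis mulA : forall x y z, mul x (mul y z) = mul (mul x y) z.
Hypothesis mul1 : forall x, mul e x = x.
Hypothesis mulV : forall x, mul (inv x) x = e.

Lemma group_mulVr x : mul x (inv x) = e.
Proof.
rewrite -[LHS]mul1 -[in LHS](mulV (inv x)) -mulA [mul (inv x) (mul _ _)]mulA mulV.
by rewrite mul1 mulV.
Qed.

Lemma group_mul1r x : mul x e = x.
Proof. by rewrite -(mulV x) mulA group_mulVr mul1. Qed.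

Lemma group_inv_uniq x y : mul y x = e -> y = inv x.
Proof. by move=> yx; rewrite -[inv x]mul1 -yx -mulA group_mulVr group_mul1r. Qed.

Lemma group_divK x y : mul (mul x (inv y)) y = x.
Proof. by rewrite -mulA mulV group_mul1r. Qed.

Lemma group_mulK x y : mul (mul x y) (inv y) = x.
Proof. by rewrite -mulA group_mulVr group_mul1r. Qed.

Lemma subgroup_inv x : subgroup mul e Gam -> Gam x -> Gam (inv x).
Proof. by case=> _ _ H /H [y Gy /group_inv_uniq <-]. Qed.

Lemma coset_mulP x y : subgroup mul e Gam ->
  coset mul Gam x = coset mul Gam y <-> exists2 g, Gam g & y = mul g x.
Proof.
move=> sG; have [G1 GM _] := sG; split=> [E|[g Gg ->]].
  have : coset mul Gam y y by exists e => //; rewrite mul1.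
  by rewrite -E => -[g Gg gx]; exists g.
apply/seteqP; split=> _ [h Gh <-].
  exists (mul h (inv g)); first by apply: GM => //; exact: subgroup_inv.
  by rewrite mulA group_divK.
by exists (mul h g); [exact: GM|rewrite mulA].
Qed.

Hypothesis smooth_mul : forall g w, smooth_at (mul g) w.
Hypothesis div_continuous : forall x y A, open A -> A (mul x (inv y)) ->
  exists U W, [/\ open U, open W, U x, W y &
    forall u w, U u -> W w -> A (mul u (inv w))].
Hypothesis sG : subgroup mul e Gam.
Hypothesis dG : exists A, [/\ open A, A e & forall g, Gam g -> A g -> g = e].
Hypothesis fP : forall x y, f x = f y <-> exists2 g, Gam g & y = mul g x.

(** Close to [g], two elements k and h of [Gam] have k h^-1 in the open set that contains no element
    of [Gam] but [e], so they coincide. A small neighbourhood of [g] thus meets [Gam] in at most one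
    point, which is then removed. *)
Lemma discrete_subgroup_closed g : ~ Gam g ->
  exists N, [/\ open N, N g & forall h, Gam h -> ~ N h].
Proof.
move=> nGg; have [A [oO Oe GO]] := dG; have [_ GM _] := sG.
have := @div_continuous g g A oO; rewrite group_mulVr => /(_ Oe).
move=> [U [W [oU oW Ug Wg UW]]].
have [[h [Gh [Uh Wh]]]|none] := pselect (exists h, Gam h /\ (U `&` W) h); last first.
  by exists (U `&` W); split=> //; [exact: openI|move=> h Gh Nh; apply: none; exists h].
exists ((U `&` W) `&` ~` [set h]); split.
- apply: openI; first exact: openI.
  rewrite openC; apply: accessible_closed_set1; apply: hausdorff_accessible.
  exact: norm_hausdorff.
- by split=> // gh; apply: nGg; rewrite gh.
- move=> k Gk [[Uk Wk] /= nkh]; apply: nkh.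
  have Gkh : Gam (mul k (inv h)) by apply: GM => //; exact: subgroup_inv.
  by rewrite -[k](group_divK k h) (GO _ Gkh (UW _ _ Uk Wh)) mul1.
Qed.

(** Local injectivity is discreteness at [e]. Separation of two cosets is closedness of [Gam],
    applied at y x^-1, together with continuity of the division. *)
Lemma group_covering : covering [set mul g | g in Gam] f.
Proof.
have [A [oO Oe GO]] := dG; have [_ GM _] := sG; split.
- move=> _ [g Gg <-]; split=> [w|w]; first exact: smooth_mul.
  by apply/esym/fP; exists g.
- by move=> x y /fP [g Gg ->]; exists (mul g) => //; exists g.
- move=> x; have := @div_continuous x x A oO; rewrite group_mulVr => /(_ Oe).
  move=> [U [W [oU oW Ux Wx UW]]]; exists (U `&` W); split=> //; first exact: openI.
  move=> y z [Uy Wy] [Uz Wz] /fP [g Gg zE].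
  have gE : mul z (inv y) = g by rewrite zE group_mulK.
  by rewrite zE (GO g) ?mul1 // -gE; exact: UW.
move=> x y nfxy.
have [|N [oN Ng GN]] := @discrete_subgroup_closed (mul y (inv x)).
  by move=> Gg; apply: nfxy; apply/fP; exists (mul y (inv x)) => //; rewrite group_divK.
have [W [U [oW oU Wy Ux WU]]] := div_continuous oN Ng.
exists U, W; split=> // u w Uu Ww /fP [g Gg wE].
by apply: (GN g Gg); rewrite -[g](group_mulK g u) -wE; exact: WU.
Qed.

End GroupCovering.

Lemma smooth_map_euclid d d' (g : 'rV[R]_d -> 'rV[R]_d') : (forall u, smooth_at g u) ->
  smooth_map (euclid R d) (euclid R d') g.
Proof.
move=> sg; split=> // c c' u v -> -> _ _ _; exists g; split=> //.
by apply: near_all.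
Qed.

(** * Vector groups and their lattices *)

Section VectorGroup.
Variables (d : nat) (T : Type) (mul : T -> T -> T) (th : 'rV[R]_d -> T).
Hypothesis th_inj : injective th.
Hypothesis thD : forall x y, th (x + y) = mul (th x) (th y).
Local Notation X := (quotient_mfd d (euclid R d) th).

Lemma vector_group_lie : lie_group X mul (th 0).
Proof.
have cX := injective_covering th_inj; have aX := covering_atlas cX.
have sX := covering_submersion th.
have Xth x : pts X (th x) by exists x.
pose inv y := th (- xget 0 (th @^-1` [set y])).
have invE x : inv (th x) = th (- x).
  by rewrite /inv; case: xgetP => [y _ /th_inj <- //|/(_ x)]; case.
split=> //.
- exact: covering_manifold cX.
- split=> [_ _ _ [x _ <-] [y _ <-] [z _ <-]|_ [x _ <-]]; first by rewrite -!thD addrA.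
  by rewrite -thD add0r.
- split=> [[y z] [/= [x _ <-] [x' _ <-]]|]; first by exists (x + x').
  move=> _ c u v [c1 [c2 [X1 X2 ->]]] Xc [/= cu1 cu2] cv E.
  have [_ [x1 [s1 [-> _ ss1 _ /= H1]]]] := lift_section (@euclid_atlas d) aX sX erefl X1 cu1.
  have [_ [x2 [s2 [-> _ ss2 _ /= H2]]]] := lift_section (@euclid_atlas d) aX sX erefl X2 cu2.
  (* A lift of the multiplication: after local sections over the two factors it is the addition of
     vectors. *)
  pose s (w : 'rV[R]_(d + d)) := s1 (lsubmx w) + s2 (rsubmx w).
  have sl : smooth_at (lsubmx : 'rV[R]_(d + d) -> 'rV[R]_d) u.
    apply: smooth_at_near_eq (smooth_at_mulmx (lsubmx 1%:M) u).
    by apply: near_all => w; rewrite mulmx_lsub mulmx1.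
  have sr : smooth_at (rsubmx : 'rV[R]_(d + d) -> 'rV[R]_d) u.
    apply: smooth_at_near_eq (smooth_at_mulmx (rsubmx 1%:M) u).
    by apply: near_all => w; rewrite mulmx_rsub mulmx1.
  have ss : smooth_at s u.
    apply: smooth_at_add; first exact: (@smooth_at_comp _ _ _ _ lsubmx s1).
    exact: (@smooth_at_comp _ _ _ _ rsubmx s2).
  have E' : th (s u) = c.2 v.
    by rewrite -E thD (nbhs_singleton H1) (nbhs_singleton H2).
  have [[g [sg cg Hg]] _] := (submersive_euclid th c).1 (sX.2 c Xc) _ v cv E'.
  exists (g \o s); split=> //; first exact: smooth_at_comp.
  have A1 := near_comp sl H1; have A2 := near_comp sr H2; have A3 := near_comp ss Hg.
  by apply: filterS3 A1 A2 A3 => w /= <- <-; rewrite -thD.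
exists inv; last by move=> _ [x _ <-]; rewrite invE -thD addNr.
apply: (smooth_map_descend (@euclid_atlas d) aX sX erefl).
have -> : inv \o th = th \o -%R by rewrite funeqE => x; exact: invE.
apply: smooth_map_comp (@euclid_atlas d) (@euclid_atlas d) _ (submersion_smooth sX).
apply: smooth_map_euclid => u; apply: smooth_at_near_eq (smooth_at_mulmx (- 1%:M) u).
by apply: near_all => w; rewrite mulmxN mulmx1.
Qed.

(** The closed ball of radius [r] is compact and meets every orbit of [Lam], so finitely many
    members of a cover that handle the ball handle the quotient. *)
Lemma vector_group_lattice (Lam : set 'rV[R]_d) :
  Lam 0 -> (forall x y, Lam x -> Lam y -> Lam (x + y)) ->
  (forall x, Lam x -> Lam (- x)) ->
  (exists A : set 'rV[R]_d, [/\ open A, A 0 & forall x, Lam x -> A x -> x = 0]) ->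
  (exists r : R, forall x, exists2 l, Lam l & `|l + x| <= r) ->
  lattice X mul (th 0) (th @` Lam).
Proof.
move=> L0 LD LN [A [oO O0 LO]] [r Lr].
have cX := injective_covering th_inj; split.
- split=> [|_ _ [x Lx <-] [y Ly <-]|_ [x Lx <-]]; first by exists 0.
    by exists (x + y); [exact: LD|rewrite thD].
  by exists (th (- x)); [exists (- x) => //; exact: LN|rewrite -thD addNr].
- by move=> _ [x _ <-]; exists x.
- move=> _ [x Lx <-]; exists (th @` ((fun y => - x + y *m 1%:M) @^-1` A)).
    apply: (covering_open cX); apply: open_comp => // y _.
    exact: smooth_at_continuous (smooth_at_affine _ _ _).
  apply/seteqP; split=> [_ [[y /= Oy <-] [z Lz /th_inj zy]]|_ ->].
    rewrite zy in Lz *; congr th; apply/eqP; rewrite -subr_eq0 addrC.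
    by apply/eqP/LO; [exact: LD (LN _ Lx) Lz|rewrite mulmx1 in Oy].
  by split; exists x => //=; rewrite mulmx1 addNr.
move=> F Fop cov.
pose q := coset mul (th @` Lam).
(* Choosing one member of the cover at each point turns it into an indexed open cover of the vector
   space, the form in which compactness of the ball is applied. *)
have cF x : exists W, F W /\ W (q (th x)).
  by have [W FW Wx] := cov (q (th x)) (ex_intro2 _ _ (th x) (ex_intro2 _ _ x I erefl) erefl); exists W.
pose Wx x := projT1 (cid (cF x)).
have WxP x : F (Wx x) /\ Wx x (q (th x)) by exact: (projT2 (cid (cF x))).
have qL l x : Lam l -> q (th (l + x)) = q (th x).
  move=> Ll; rewrite /q /coset; apply/seteqP; split=> _ [_ [k Lk <-] <-].
    by exists (th (k + l)); [exists (k + l) => //; exact: LD|rewrite -!thD addrA].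
  exists (th (k - l)); first by exists (k - l) => //; exact/LD/LN.
  by rewrite -!thD addrA subrK.
have cC : compact [set x : 'rV[R]_d | `|x| <= r].
  apply: bounded_closed_compact.
    exists r; split; first exact: num_real.
    by move=> M rM x /= /le_trans; apply; exact: ltW.
  apply: (@closed_comp _ _ (fun x : 'rV[R]_d => `|x|) [set y | y <= r]); last exact: closed_le.
  by move=> x _; exact: norm_continuous.
rewrite compact_cover in cC.
have [||E _ HE] := cC 'rV[R]_d setT (fun x => th @^-1` (q @^-1` (Wx x))).
- move=> x _; have [/Fop [_ ]] := WxP x; move=> /(mopen_covering cX) [_ oW] _.
  suff <- : th @^-1` (pts X `&` q @^-1` Wx x) = th @^-1` (q @^-1` Wx x) by [].
  by apply/seteqP; split=> [y [_]//|y Hy]; split=> //; exists y.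
- by move=> x _; exists x => //; have [] := WxP x.
exists (Wx @` [set` E]); split; first exact/finite_image/finite_fset.
  by move=> _ [x _ <-]; have [] := WxP x.
move=> _ [_ [x _ <-] <-]; have [l Ll lr] := Lr x.
have [y Ey] := HE _ lr; rewrite /= qL // => Wy.
by exists (Wx y) => //; exists y.
Qed.

End VectorGroup.

(** Composition with [P] and with [P'] exchanges the ambient inverses of submanifold charts with
    local expressions of u |-> u P, and smoothness of these charts with local sections; hence the
    two atlases are equal. *)
Lemma submfd_linear d N (P : 'M[R]_(d, N)) (P' : 'M[R]_(N, d)) (S : set 'rV[R]_N) :
  P *m P' = 1%:M -> S = range (fun u => u *m P) ->
  submfd d S = quotient_mfd d (euclid R d) (fun u => u *m P).
Proof.
move=> PP SE; apply: mfd_eq => //= c; rewrite -SE.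
have PK u : u *m P *m P' = u by rewrite -mulmxA PP mulmx1.
have P'K x : S x -> x *m P' *m P = x by rewrite SE => -[u _ <-]; rewrite PK.
split=> -[oc ci cS H]; split=> //.
  apply/submersive_euclid => u v cv uE; have [sv [r [sr rv Hr]]] := H v cv.
  have sPu := smooth_at_mulmx P u.
  split.
    exists (r \o fun w => w *m P); rewrite /= uE rv; split=> //.
      by apply: smooth_at_comp => //; rewrite uE.
    rewrite -uE in Hr; apply: filterS (near_comp sPu Hr) => w /= ->//.
    by rewrite SE; exists w.
  exists ((fun x => x *m P') \o c.2); split=> /=.
  - exact: smooth_at_comp sv (smooth_at_mulmx P' _).
  - by rewrite -uE PK.
  - by apply: filterS (near_open oc cv) => w cw /=; rewrite P'K //; apply: cS; exists w.
move=> v cv; have [u _ uE] : range (fun u => u *m P) (c.2 v).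
  by rewrite -SE; apply: cS; exists v.
have [[g [sg cg Hg]] [s [ss su Hs]]] := (submersive_euclid _ c).1 H u v cv uE.
split.
  apply: smooth_at_near_eq Hs _.
  exact: smooth_at_comp ss (smooth_at_mulmx P _).
have sP' := smooth_at_mulmx P' (c.2 v).
have P'v : c.2 v *m P' = u by rewrite -uE PK.
exists (g \o fun x => x *m P'); split=> /=.
- by apply: smooth_at_comp => //; rewrite P'v.
- rewrite P'v; apply: ci; rewrite ?inE // -uE; exact: esym (nbhs_singleton Hg).
rewrite -P'v in Hg.
by apply: filterS (near_comp sP' Hg) => x /= <- Sx; rewrite P'K.
Qed.

End ManifoldMaps.

(** * Differential forms on quotients *)

Section Forms.
Variable R : realType.
Local Notation eu d := (euclid_chart R d).
Local Notation Quot d' d f := (quotient_mfd d' (euclid R d) f).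

(** The chart is injective, so the local expression of [f] composed with the section is the identity
    near [u]. The Jacobians are one-sided inverses even when the dimensions differ. *)
Lemma quotient_section_rep d d' T (f : 'rV[R]_d -> T) c u (s : 'rV[R]_d' -> 'rV[R]_d) :
  charts (Quot d' d f) c -> c.1 u -> smooth_at s u ->
  (\forall w \near u, f (s w) = c.2 w) ->
  exists g, [/\ local_rep f (eu d) c (s u) g, g (s u) = u &
    'J s u *m 'J g (s u) = 1%:M].
Proof.
move=> [oc ci _ /submersive_euclid sub] cu ss Hs.
have [[g [sg cg Hg]] _] := sub _ u cu (nbhs_singleton Hs).
have gs : \forall w \near u, id w = (g \o s) w.
  have cgs : \forall w \near u, c.1 (g (s w)).
    exact: near_comp (smooth_at_comp ss sg) (near_open oc cg).
  have Hgs := near_comp ss Hg.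
  apply: filterS2 (filterI (near_open oc cu) cgs) (filterI Hs Hgs).
  by move=> w [cw cgw] [E1 E2] /=; apply: ci; rewrite ?inE // -E1.
exists g; split=> //; first exact: esym (nbhs_singleton gs).
by rewrite -(jacobian_comp ss sg) -(jacobian_near_eq (smooth_at_id u) gs) jacobian_id.
Qed.

(** [is_pullback] expresses the form upstairs through the one downstairs; the Jacobian of a section
    reverses this. *)
Lemma pullback_section d d' T (f : 'rV[R]_d -> T) (Om : form2 R d' T) be c u
    (s : 'rV[R]_d' -> 'rV[R]_d) :
  is_pullback (euclid R d) (Quot d' d f) f Om be ->
  charts (Quot d' d f) c -> c.1 u -> smooth_at s u ->
  (\forall w \near u, f (s w) = c.2 w) ->
  Om c u = 'J s u *m be (eu d) (s u) *m ('J s u)^T.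
Proof.
move=> [_ pb] Qc cu ss Hs.
have [g [rg gu Jsg]] := quotient_section_rep Qc cu ss Hs.
rewrite (pb _ _ _ _ erefl Qc I rg) gu !mulmxA Jsg mul1mx -mulmxA -trmx_mul Jsg.
by rewrite trmx1 mulmx1.
Qed.

(** A pullback identity quantifies over all local expressions of [F], so an arbitrary [g] must be
    matched with the one built from the lift [Phi]. They agree near [u] because the target chart is
    injective. *)
Lemma local_rep_lift d1 d2 k1 k2 T1 T2 (f1 : 'rV[R]_d1 -> T1) (f2 : 'rV[R]_d2 -> T2)
    (F : T1 -> T2) (Phi : 'rV[R]_d1 -> 'rV[R]_d2) c c' u g :
  atlas (Quot k1 d1 f1) ->
  (forall x, smooth_at Phi x) -> (forall x, F (f1 x) = f2 (Phi x)) ->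
  charts (Quot k1 d1 f1) c -> charts (Quot k2 d2 f2) c' -> c.1 u ->
  local_rep F c c' u g ->
  exists s G, [/\ smooth_at s u, (\forall w \near u, f1 (s w) = c.2 w),
    local_rep f2 (eu d2) c' (Phi (s u)) G, g u = G (Phi (s u)) &
    'J g u = 'J s u *m 'J Phi (s u) *m 'J G (Phi (s u))].
Proof.
move=> a1 sPhi FE Qc Qc' cu [sg cg Hg].
have [_ [x [s [-> _ ss _ /= Hs]]]] :=
  lift_section (@euclid_atlas R d1) a1 (quotient_submersion _ _ _) erefl Qc cu.
have E : f2 (Phi (s u)) = c'.2 (g u).
  by rewrite -FE (nbhs_singleton Hs) (nbhs_singleton Hg).
have [oc' ci' _ /submersive_euclid sub] := Qc'.
have [[G [sG cG HG]] _] := sub _ _ cg E.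
have sPs : smooth_at (Phi \o s) u by exact: smooth_at_comp.
have gE : \forall w \near u, g w = (G \o (Phi \o s)) w.
  have c1 := near_comp sg (near_open oc' cg).
  have c2 := near_comp (smooth_at_comp sPs sG) (near_open oc' cG).
  have H2 := near_comp sPs HG.
  apply: filterS2 (filterI c1 c2) (filterI Hs (filterI Hg H2)).
  move=> w [cw cgw] [E1 [E2 E3]] /=; apply: ci'; rewrite ?inE //.
  by rewrite -E2 -E1 FE -E3.
exists s, G; split=> //; first exact: (nbhs_singleton gE).
by rewrite (jacobian_near_eq sg gE) (jacobian_comp sPs sG) (jacobian_comp ss).
Qed.

Lemma lift_smooth_map d1 d2 k1 k2 T1 T2 (f1 : 'rV[R]_d1 -> T1) (f2 : 'rV[R]_d2 -> T2)
    (F : T1 -> T2) (Phi : 'rV[R]_d1 -> 'rV[R]_d2) :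
  atlas (Quot k1 d1 f1) ->
  (forall x, smooth_at Phi x) -> (forall x, F (f1 x) = f2 (Phi x)) ->
  smooth_map (Quot k1 d1 f1) (Quot k2 d2 f2) F.
Proof.
move=> a1 sPhi FE.
apply: (smooth_map_descend (@euclid_atlas R d1) a1 (quotient_submersion _ _ _) erefl).
have -> : F \o f1 = f2 \o Phi by rewrite funeqE.
apply: (smooth_map_comp (@euclid_atlas R d1) (@euclid_atlas R d2)).
  exact: smooth_map_euclid.
exact/submersion_smooth/quotient_submersion.
Qed.

Lemma pullback_descend d1 d2 k1 k2 T1 T2 (f1 : 'rV[R]_d1 -> T1) (f2 : 'rV[R]_d2 -> T2)
    (F : T1 -> T2) (Phi : 'rV[R]_d1 -> 'rV[R]_d2) Om1 Om2 be1 be2 :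
  atlas (Quot k1 d1 f1) ->
  (forall x, smooth_at Phi x) -> (forall x, F (f1 x) = f2 (Phi x)) ->
  (forall x, be1 (eu d1) x = 'J Phi x *m be2 (eu d2) (Phi x) *m ('J Phi x)^T) ->
  is_pullback (euclid R d1) (Quot k1 d1 f1) f1 Om1 be1 ->
  is_pullback (euclid R d2) (Quot k2 d2 f2) f2 Om2 be2 ->
  is_pullback (Quot k1 d1 f1) (Quot k2 d2 f2) F Om2 Om1.
Proof.
move=> a1 sPhi FE beE pb1 pb2; split; first exact: lift_smooth_map sPhi FE.
move=> c c' u g Qc Qc' cu rg.
have [s [G [ss Hs rG gG JE]]] := local_rep_lift a1 sPhi FE Qc Qc' cu rg.
rewrite (pullback_section pb1 Qc cu ss Hs) beE (pb2.2 _ _ _ _ erefl Qc' I rG).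
by rewrite -gG JE !trmx_mul !mulmxA.
Qed.

Lemma smooth_on_Ck_derive d (W : set 'rV[R]_d) f i : smooth_on W f ->
  smooth_on W (fun x => 'D_(basis_vec R i) f x).
Proof. by move=> H k; have [_] := H k.+1; exact. Qed.

(** The formula is stated on a neighbourhood of [u] because the entries are going to be
    differentiated. *)
Lemma section_form_entry d d' T (f : 'rV[R]_d -> T) (Om : form2 R d' T) be c u :
  is_pullback (euclid R d) (Quot d' d f) f Om be ->
  atlas (Quot d' d f) -> charts (Quot d' d f) c -> c.1 u ->
  exists (s : 'rV[R]_d' -> 'rV[R]_d) V, [/\ open V, V u,
    forall a, smooth_on V (fun w => s w 0 a) &
    forall w j k, V w -> Om c w j k = \sum_b (\sum_a
      'D_(basis_vec R j) (fun x => s x 0 a) w * be (eu d) (s w) a b) *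
      'D_(basis_vec R k) (fun x => s x 0 b) w].
Proof.
move=> pb aQ Qc cu; have [oc _ _ _] := Qc.
have [_ [x [s [-> _ [W [oW Wu sW]] _ /= Hs]]]] :=
  lift_section (@euclid_atlas R d) aQ (quotient_submersion _ _ _) erefl Qc cu.
have : nbhs u [set w | f (s w) = c.2 w] by exact: Hs.
rewrite nbhsE => -[U [oU Uu] UE].
exists s, (W `&` (U `&` c.1)); split=> //.
- by apply: openI => //; exact: openI.
- by move=> a k; apply: Ck_sub (sW a k) => w [].
move=> w j k [Ww [Uw cw]].
have ss : smooth_at s w by exists W.
have Hw : \forall z \near w, f (s z) = c.2 z.
  by apply: filterS UE (near_open oU Uw).
rewrite (pullback_section pb Qc cw ss Hw) mxE; apply: eq_bigr => b _.
rewrite [X in X * _]mxE [X in _ * X]mxE (jacobianE k b ss); congr (_ * _).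
by apply: eq_bigr => a _; rewrite (jacobianE _ _ ss).
Qed.

Lemma pullback_form2 d d' T (f : 'rV[R]_d -> T) (Om : form2 R d' T) be :
  is_pullback (euclid R d) (Quot d' d f) f Om be ->
  atlas (Quot d' d f) -> is_form2 (euclid R d) be -> is_form2 (Quot d' d f) Om.
Proof.
move=> pb aQ [asym sbe _]; split.
- move=> c u Qc cu.
  have [_ [x [s [-> _ ss _ /= Hs]]]] :=
    lift_section (@euclid_atlas R d) aQ (quotient_submersion _ _ _) erefl Qc cu.
  rewrite (pullback_section pb Qc cu ss Hs) !trmx_mul trmxK asym //.
  by rewrite mulNmx mulmxN mulmxA.
- move=> c i j Qc; apply: smooth_on_local => u cu.
  have [s [V [oV Vu sV OmE]]] := section_form_entry pb aQ Qc cu.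
  exists V => // k.
  have H : Ck k V (fun w => \sum_b (\sum_a
      'D_(basis_vec R i) (fun x => s x 0 a) w * be (eu d) (s w) a b) *
      'D_(basis_vec R j) (fun x => s x 0 b) w).
    apply: Ck_sum => // b; apply: Ck_mul => //; last exact: smooth_on_Ck_derive.
    apply: Ck_sum => // a; apply: Ck_mul => //; first exact: smooth_on_Ck_derive.
    apply: (@Ck_comp _ _ _ _ _ setT (fun y => be (eu d) y a b)) => //.
      by move=> l; exact: sV.
    exact: (sbe (eu d) a b erefl).
  by apply: Ck_eq H => // w Vw; rewrite OmE.
apply: (pullback_descend (Phi := id) aQ _ _ _ pb pb) => //.
  exact: smooth_at_id.
by move=> x; rewrite jacobian_id trmx1 mulmx1 mul1mx.
Qed.

Lemma is_derive_bigsum d n (h : 'I_n -> 'rV[R]_d -> R) x v (dh : 'I_n -> R) :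
  (forall i, is_derive x v (h i) (dh i)) ->
  is_derive x v (fun w => \sum_i h i w) (\sum_i dh i).
Proof.
move=> H; have -> : (fun w => \sum_i h i w) = \sum_i h i.
  by rewrite funeqE => w; rewrite fct_sumE.
exact: is_derive_sum.
Qed.

Lemma is_derive_mulfun d (g h : 'rV[R]_d -> R) x v dg dh :
  is_derive x v g dg -> is_derive x v h dh ->
  is_derive x v (fun w => g w * h w) (g x * dh + h x * dg).
Proof. exact: is_deriveM. Qed.

Lemma sum_rotate n (F : 'I_n -> 'I_n -> 'I_n -> R) :
  \sum_a \sum_b \sum_c F a b c = \sum_c \sum_a \sum_b F a b c.
Proof.
by rewrite [RHS]exchange_big /=; apply: eq_bigr => a _; exact: exchange_big.
Qed.

(** Exterior derivative commutes with pullback by a section: the terms with derivatives of [be]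
    cancel since [be] is closed, those with second derivatives of the section since these are
    symmetric while [be] is antisymmetric. *)
Lemma pullback_closed d d' T (f : 'rV[R]_d -> T) (Om : form2 R d' T) be :
  is_pullback (euclid R d) (Quot d' d f) f Om be ->
  atlas (Quot d' d f) -> is_form2 (euclid R d) be ->
  closed_form (euclid R d) be -> closed_form (Quot d' d f) Om.
Proof.
move=> pb aQ [asym sbe _] cbe c u i j k Qc cu.
have [s [V [oV Vu sV OmE]]] := section_form_entry pb aQ Qc cu.
pose p i a := 'D_(basis_vec R i) (fun x => s x 0 a) u.
pose P i j a := 'D_(basis_vec R i) ('D_(basis_vec R j) (fun x => s x 0 a)) u.
pose B a b := be (eu d) (s u) a b.
pose db c a b := 'D_(basis_vec R c) (fun y => be (eu d) y a b) (s u).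
have Psym i1 i2 a : P i1 i2 a = P i2 i1 a by exact: derive_sym oV (sV a) Vu.
have Basym a b : B a b = - B b a.
  have /matrixP /(_ b a) := asym _ (s u) (erefl (eu d)) I.
  by rewrite !mxE.
have ds : differentiable s u.
  by apply: smooth_at_differentiable; exists V.
have dD i1 i2 a : is_derive u (basis_vec R i1)
    (fun w => 'D_(basis_vec R i2) (fun x => s x 0 a) w) (P i1 i2 a).
  have [_ /(_ i2) [D _]] := sV a 2.
  by apply: DeriveDef => //; apply: diff_derivable; exact: D.
have dB i1 a b : is_derive u (basis_vec R i1) (fun w => be (eu d) (s w) a b)
    (\sum_c db c a b * p i1 c).
  have dbe : differentiable (fun y => be (eu d) y a b) (s u).
    by have [+ _] := sbe (eu d) a b erefl 1; apply.
  apply: DeriveDef.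
    by apply: diff_derivable; exact: (differentiable_comp ds dbe).
  exact: (derive_comp_coord _ dbe ds).
have dOm i1 i2 i3 : 'D_(basis_vec R i1) (fun w => Om c w i2 i3) u =
    \sum_b ((\sum_a p i2 a * B a b) * P i1 i3 b +
      p i3 b * \sum_a (p i2 a * (\sum_c db c a b * p i1 c) + B a b * P i1 i2 a)).
  rewrite (@near_eq_derive _ _ _ _ (fun w => \sum_b (\sum_a
      'D_(basis_vec R i2) (fun x => s x 0 a) w * be (eu d) (s w) a b) *
      'D_(basis_vec R i3) (fun x => s x 0 b) w)); last first.
    by apply: filterS (near_open oV Vu) => w /OmE.
  have dsum := is_derive_bigsum (fun b => is_derive_mulfun
    (is_derive_bigsum (fun a => is_derive_mulfun (dD i1 i2 a) (dB i1 a b))) (dD i1 i3 b)).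
  exact: (@derive_val _ _ _ _ _ _ _ dsum).
have dbc l a b : db l a b + db a b l + db b l a = 0 := cbe (eu d) (s u) l a b erefl I.
clearbody p P B db.
(* [X] collects the terms in which a coefficient of [be] is differentiated, [Y] those in which the
   section is. Antisymmetry of [be] gives the second [Y] in [dOmE] its minus sign. *)
pose X i1 i2 i3 := \sum_a \sum_b \sum_c db c a b * p i1 c * p i2 a * p i3 b.
pose Y i1 i2 i3 := \sum_a \sum_b P i1 i2 a * B a b * p i3 b.
have dOmE i1 i2 i3 : 'D_(basis_vec R i1) (fun w => Om c w i2 i3) u =
    X i1 i2 i3 + (Y i1 i2 i3 - Y i1 i3 i2).
  have -> : X i1 i2 i3 + (Y i1 i2 i3 - Y i1 i3 i2) = \sum_b \sum_a
      (\sum_c db c a b * p i1 c * p i2 a * p i3 b + (P i1 i2 a * B a b * p i3 b +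
       P i1 i3 b * B a b * p i2 a)).
    rewrite /X /Y exchange_big [\sum_a \sum_b P i1 i2 a * _ * _]exchange_big /=.
    rewrite -sumrN -!big_split; apply: eq_bigr => b _ /=.
    rewrite -sumrN -!big_split; apply: eq_bigr => a _ /=.
    by rewrite [B b a]Basym mulrN mulNr opprK.
  rewrite dOm; apply: eq_bigr => b _; rewrite mulr_suml mulr_sumr -big_split.
  apply: eq_bigr => a _ /=.
  have -> : \sum_c db c a b * p i1 c * p i2 a * p i3 b =
      p i3 b * (p i2 a * \sum_c db c a b * p i1 c).
    rewrite !mulr_sumr; apply: eq_bigr => l _; ring.
  ring.
have Ysym i1 i2 i3 : Y i1 i2 i3 = Y i2 i1 i3.
  by apply: eq_bigr => a _; apply: eq_bigr => b _; rewrite Psym.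
(* Renaming summation indices brings the three [X] to common monomials, whose coefficients are
   exactly the closedness identity of [be]. *)
have X2 : X j k i = \sum_a \sum_b \sum_c db a b c * p i c * p j a * p k b.
  rewrite /X sum_rotate; do 3![apply: eq_bigr => ? _]; ring.
have X3 : X k i j = \sum_a \sum_b \sum_c db b c a * p i c * p j a * p k b.
  rewrite /X 2!sum_rotate; do 3![apply: eq_bigr => ? _]; ring.
have X0 : X i j k + X j k i + X k i j = 0.
  rewrite X2 X3 /X -!big_split big1 // => a _ /=.
  rewrite -!big_split big1 // => b _ /=; rewrite -!big_split big1 // => l _ /=.
  by rewrite -!mulrDl dbc !mul0r.
rewrite !dOmE (Ysym j i k) (Ysym k i j) (Ysym k j i) -[RHS]X0.
move: (X i j k) (X j k i) (X k i j) (Y i j k) (Y i k j) (Y j k i) => *; ring.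
Qed.

Lemma pullback_unitmx d T (f : 'rV[R]_d -> T) (Om : form2 R d T) be :
  is_pullback (euclid R d) (Quot d d f) f Om be -> atlas (Quot d d f) ->
  (forall x, be (eu d) x \in unitmx) ->
  forall c u, charts (Quot d d f) c -> c.1 u -> Om c u \in unitmx.
Proof.
move=> pb aQ ube c u Qc cu.
have [_ [x [s [-> _ ss _ /= Hs]]]] :=
  lift_section (@euclid_atlas R d) aQ (quotient_submersion _ _ _) erefl Qc cu.
have [g [_ _ /mulmx1_unit [uJ _]]] := quotient_section_rep Qc cu ss Hs.
by rewrite (pullback_section pb Qc cu ss Hs) !unitmx_mul unitmx_tr uJ ube.
Qed.

(** The form is defined by one chosen section per chart and point. Invariance of [be] under deck
    transformations makes it compatible with every other lift. *)
Lemma covering_form_exists d T D (f : 'rV[R]_d -> T) (be : form2 R d 'rV[R]_d) :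
  covering D f ->
  (forall a w, D a -> be (eu d) w = 'J a w *m be (eu d) (a w) *m ('J a w)^T) ->
  exists Om, is_pullback (euclid R d) (Quot d d f) f Om be.
Proof.
move=> cf inv; have aQ := covering_atlas cf; have [Ds Dt Dl _] := cf.
pose sec (c : chart R d T) u := fun s : 'rV[R]_d -> 'rV[R]_d =>
  smooth_at s u /\ \forall w \near u, f (s w) = c.2 w.
have [sc Hsc] : exists sc, forall c u, charts (Quot d d f) c -> c.1 u -> sec c u (sc c u).
  have E c u : exists s, charts (Quot d d f) c -> c.1 u -> sec c u s.
    have [[Qc cu]|H] := pselect (charts (Quot d d f) c /\ c.1 u); last first.
      by exists id => Qc cu; case: H.
    have [_ [x [s [-> _ ss _ /= Hs]]]] :=
      lift_section (@euclid_atlas R d) aQ (quotient_submersion _ _ _) erefl Qc cu.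
    by exists s.
  by exists (fun c u => projT1 (cid (E c u))) => c u; exact: (projT2 (cid (E c u))).
exists (fun c u => 'J (sc c u) u *m be (eu d) (sc c u u) *m ('J (sc c u) u)^T).
split; first exact/submersion_smooth/quotient_submersion.
move=> _ c x g -> Qc _ [/= sg cg Hg].
have [] := Hsc c (g x) Qc cg; set s := sc c (g x) => ss Hs.
have Es : f x = f (s (g x)).
  by rewrite (nbhs_singleton Hs); exact: (nbhs_singleton Hg).
(* The points [x] and [s (g x)] lie in one fibre, so a deck transformation [a] relates them. Since
   [f] is locally injective, [a] and [s \o g] agree near [x], and invariance under [a] becomes the
   pullback identity. *)
have [a Da ax] := Dt _ _ Es; have [sa fa] := Ds a Da.
have [U [oU Uy Ui]] := Dl (s (g x)).
have ssg : smooth_at (s \o g) x by exact: smooth_at_comp.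
have as_near : \forall w \near x, a w = (s \o g) w.
  have n1 : \forall w \near x, U (a w) by apply: near_comp (sa x) (near_open oU _); rewrite ax.
  have n2 := near_comp ssg (near_open oU Uy).
  have n3 := near_comp sg Hs.
  apply: filterS2 (filterI n1 n2) (filterI Hg n3) => w [w1 w2] [w3 w4] /=.
  by apply: Ui => //; rewrite fa w3 w4.
rewrite (inv a x Da) ax (jacobian_near_eq (sa x) as_near) (jacobian_comp sg ss).
by rewrite trmx_mul !mulmxA.
Qed.

Lemma covering_symplectic d T D (f : 'rV[R]_d -> T) (be : form2 R d 'rV[R]_d) Om :
  covering D f -> symplectic (euclid R d) be ->
  is_pullback (euclid R d) (Quot d d f) f Om be -> symplectic (Quot d d f) Om.
Proof.
move=> cf [fbe cbe ube] pb; have aQ := covering_atlas cf; split.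
- exact: pullback_form2 pb aQ fbe.
- exact: pullback_closed pb aQ fbe cbe.
- by apply: pullback_unitmx pb aQ _ => x; exact: ube.
Qed.

Lemma const_form2 d (B : 'M[R]_d) : B^T = - B -> is_form2 (euclid R d) (fun _ _ => B).
Proof.
move=> BT; split=> //.
  by move=> c i j _ k; exact: Ck_cst.
split=> [|c c' u g -> -> _ [/= sg _ Hg]].
  by apply: smooth_map_euclid => u; exact: smooth_at_id.
by rewrite -(jacobian_near_eq (smooth_at_id u) Hg) jacobian_id trmx1 mulmx1 mul1mx.
Qed.

Lemma const_closed_form d (B : 'M[R]_d) : closed_form (euclid R d) (fun _ _ => B).
Proof. by move=> c u i j k _ _; rewrite !derive_cst !addr0. Qed.

End Forms.

(** * The filiform group and its lattices *)

Section FiliformGroup.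
Variables (R : realType) (n : nat).
Local Notation V := 'rV[R]_n.+1.
Local Notation A := (ad_e0 R n).
Local Notation en := (delta_mx 0 ord_max : V).
Local Notation e0 := (delta_mx 0%R 0%R : V).

Definition hyper : set V := [set x | x 0 0 = 0].

Lemma hyperZ t (x : V) : hyper x -> hyper (t *: x).
Proof. by rewrite /hyper /= mxE => ->; rewrite mulr0. Qed.

Lemma fmul_coord0 (x y : V) : (fmul x y) 0 0 = x 0 0 + y 0 0.
Proof. by rewrite /fmul mxE exp_ad_col0. Qed.

Lemma fmul_hyper (x y : V) : hyper x -> fmul x y = x + y.
Proof. by rewrite /hyper /= /fmul => ->; rewrite exp_ad0 mulmx1. Qed.

Lemma fginv_hyper (x : V) : hyper x -> fginv x = - x.
Proof. by rewrite /hyper /= /fginv => ->; rewrite oppr0 exp_ad0 mulmx1. Qed.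

Lemma fginv_coord0 (x : V) : (fginv x) 0 0 = - x 0 0.
Proof. by rewrite /fginv mxE exp_ad_col0. Qed.

Lemma fmulgV (x : V) : fmul x (fginv x) = 0.
Proof. exact: (group_mulVr (@fmulA R n) (@fmul0g R n) (@fmulVg R n)). Qed.

Lemma fmulg0 (x : V) : fmul x 0 = x.
Proof. by rewrite /fmul mul0mx addr0. Qed.

Lemma smooth_fmul (g w : V) : smooth_at (fmul g) w.
Proof. exact: smooth_at_affine. Qed.

Lemma jacobian_fmul (g w : V) : 'J (fmul g) w = exp_ad n (g 0 0).
Proof. exact: jacobian_affine. Qed.

Lemma ad_coord (x : V) (i j : 'I_n.+1) : (0 < i)%N -> j = i.+1 :> nat ->
  (x *m A) 0 j = x 0 i.
Proof.
move=> i0 ij; rewrite mxE (bigD1 i) //= mxE i0 ij eqxx mulr1 big1 ?addr0 // => l li.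
rewrite mxE ij eqSS andbC; case: eqP => [il|]; last by rewrite mulr0.
by case/eqP: li; apply: val_inj.
Qed.

Lemma ad_kernel (x : V) (i : 'I_n.+1) : x *m A = 0 -> (0 < i < n)%N -> x 0 i = 0.
Proof.
move=> xA /andP[i0 lt_in].
by rewrite -(@ad_coord x i (inord i.+1) i0) ?inordK // xA mxE.
Qed.

Lemma ad_coord0 (x : V) : (x *m A) 0 0 = 0.
Proof. by rewrite mxE big1 // => l _; rewrite mxE andbF mulr0. Qed.

Lemma en_ad : en *m A = 0.
Proof.
apply/rowP => j; rewrite -rowE !mxE; case: eqP => [jn|]; rewrite ?andbF //.
by have := ltn_ord j; rewrite jn /= ltnn.
Qed.

Lemma kernel_exp_ad (x : V) t : x *m A = 0 -> x *m exp_ad n t = x.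
Proof.
move=> xA; rewrite /exp_ad mulmx_sumr big_ord_recl big1 => [|k _] /=.
  by rewrite expr0 fact0 divr1 scale1r expr0 addr0 mulmx1.
rewrite -scalemxAr [X in _ *: X](_ : _ = 0) ?scaler0 // /bump /= add1n exprS.
  by apply: etrans (mulmxA x A _) _; rewrite xA mul0mx.
Qed.

(** The commuting factor [1 + A * W] is unipotent, so exp(tA) - 1 behaves like tA for kernels and
    top powers. *)
Lemma exp_ad_factor t : exists2 W, GRing.comm A W &
  exp_ad n t = 1 + t *: (A * (1 + A * W)).
Proof.
pose W := \sum_(k < n.+1) (t ^+ k.+1 / k.+2`!%:R) *: A ^+ k.
exists W.
  apply: commr_sum => k _; rewrite /GRing.comm -scalerAr -scalerAl.
  by congr (_ *: _); rewrite -exprS -exprSr.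
have A2 : A ^+ n.+2 = 0 by apply: ad_e0_nilpotent; lia.
(* Two vanishing terms are appended, so that removing the first two terms leaves as many as [W]
   has. *)
transitivity (\sum_(k < n.+3) (t ^+ k / k`!%:R) *: A ^+ k).
  rewrite big_ord_recr big_ord_recr /= A2 [A ^+ n.+1]ad_e0_nilpotent //.
  by rewrite !scaler0 !addr0.
rewrite big_ord_recl big_ord_recl /= expr0 fact0 divr1 scale1r expr0.
have b0 : bump 0 0 = 1%N by [].
rewrite b0 (factS 0) fact0 muln1 divr1 !expr1 mulrDr mulr1 scalerDr.
congr (_ + (_ + _)).
rewrite mulrA -expr2 /W mulr_sumr scaler_sumr; apply: eq_bigr => k _.
rewrite /bump /= !add1n -scalerAr scalerA mulrA -exprS; congr (_ *: _).
by rewrite -exprD.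
Qed.

(** A fixed vector satisfies xA = xA(-AW); iterating n + 1 times gives 0, as AW is nilpotent. *)
Lemma exp_ad_fix (x : V) t : t != 0 -> x *m exp_ad n t = x -> x *m A = 0.
Proof.
move=> t0 xE; have [W cAW EW] := exp_ad_factor t.
have yE : x *m A = x *m A *m (- (A * W)).
  have : t *: (x *m (A * (1 + A * W))) = 0.
    move: xE; rewrite EW mulmxDr mulmx1 -scalemxAr => /eqP.
    by rewrite -subr_eq0 addrAC subrr add0r => /eqP.
  move=> /eqP; rewrite scaler_eq0 (negPf t0) /= => /eqP.
  rewrite [A * _]mulrDr mulr1 mulmxDr => /eqP; rewrite addr_eq0 => /eqP {1}->.
  by rewrite mulmxN -mulmxA.
have yk k : x *m A = x *m A *m (- (A * W)) ^+ k.
  elim: k => [|k IH]; first by rewrite expr0 mulmx1.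
  by rewrite exprSr [in RHS]mulmxA -IH.
rewrite (yk n.+1) exprNn exprMn_comm // ad_e0_nilpotent // mul0r mulr0.
exact: mulmx0.
Qed.

Lemma delta_hyper (i : 'I_n.+1) : i != 0 -> hyper (delta_mx 0 i).
Proof. by move=> i0; rewrite /hyper /= mxE eq_sym (negPf i0). Qed.

Lemma fcenterE : (2 <= n)%N -> @fcenter R n = [set z | exists t, z = t *: en].
Proof.
move=> n2; apply/seteqP; split=> z; last first.
  move=> [t ->] g.
  have h : hyper (t *: en).
    by rewrite /hyper /= mxE delta_hyper ?mulr0 // -val_eqE /=; lia.
  rewrite fmul_hyper // /fmul -scalemxAl kernel_exp_ad ?en_ad //.
  exact: addrC.
move=> zc.
(* Commuting with e_1 forces z_0 = 0, because e_1 is not killed by ad e_0 when n >= 2. Commuting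
   with e_0 then forces zA = 0. *)
have z0 : z 0 0 = 0.
  apply/eqP; apply: contraT => nz.
  have := zc (delta_mx 0 (inord 1)); rewrite [RHS]fmul_hyper; last first.
    by apply: delta_hyper; rewrite -val_eqE /= inordK //; lia.
  rewrite /fmul [RHS]addrC => /addrI /(exp_ad_fix nz) /ad_kernel.
  move=> /(_ (inord 1)); rewrite inordK ?mxE ?eqxx; last by lia.
  by move=> /(_ n2) /eqP; rewrite oner_eq0.
have zA : z *m A = 0.
  apply: (@exp_ad_fix z 1); first exact: oner_neq0.
  have := zc (delta_mx 0 0); rewrite fmul_hyper // /fmul mxE eqxx /= => E.
  by apply: (@addrI _ (delta_mx 0 0)); rewrite -E addrC.
exists (z 0 ord_max); apply/rowP => i; rewrite !mxE eqxx /=.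
have [->|ni] := eqVneq i ord_max; first by rewrite mulr1.
have [i0|i0] := eqVneq i 0; first by rewrite i0 z0 mulr0.
rewrite mulr0; apply: ad_kernel => //; move: ni i0 (ltn_ord i).
rewrite -!val_eqE /=; lia.
Qed.

Lemma derivable_coord (c : R -> V) t i : derivable c t 1 -> derivable (fun t => c t 0 i) t 1.
Proof. by move/derivable_mxP; apply. Qed.

Lemma is_derive_scalel (x : V) (t : R) : is_derive t (1 : R) (fun t => t *: x) x.
Proof.
have D : is_diff t ( *:%R ^~ x) ( *:%R ^~ x) by exact: is_diff_scalel.
have d : differentiable (fun s : R => s *: x) t by case: D.
by apply: DeriveDef; [exact: diff_derivable|rewrite (deriveE _ d) diff_val scale1r].
Qed.

(** [hyper] is itself one of the intersected subgroups: along a one-parameter subgroup tangent to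
    it, x_0 is additive with derivative 0, hence zero. Conversely x is the value at time 1 of t |->
    t x. *)
Lemma conn_hyper : conn_subgroup hyper = hyper.
Proof.
apply/seteqP; split=> x.
  apply; split.
    split; first by rewrite /hyper /= mxE.
      by move=> y z hy hz; rewrite /hyper /= fmul_coord0 hy hz addr0.
    move=> y hy; exists (fginv y); last exact: fmulVg.
    by rewrite /hyper /= fginv_coord0 hy oppr0.
  move=> c [cD cd] c0 t; pose p t := c t 0 0.
  have pD s s' : p (s + s') = p s + p s' by rewrite /p cD fmul_coord0.
  have p0 : p 0 = 0 by apply: (@addrI _ (p 0)); rewrite -pD !addr0.
  have pd s : derivable p s 1 by exact: derivable_coord.
  have D0 : 'D_1 p 0 = 0.
    by rewrite -[RHS]c0 derive_mx // mxE.
  have Dp s : is_derive s (1 : R) p 0.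
    apply: DeriveDef => //; rewrite -[RHS]D0 /derive.
    have -> // : (fun h : R => h^-1 *: ((p \o shift s) (h *: 1) - p s)) =
        (fun h => h^-1 *: ((p \o shift 0) (h *: 1) - p 0)).
    by rewrite funeqE => h /=; rewrite !pD p0 !addrK.
  by rewrite /hyper /= -/(p t) (is_derive_0_is_cst t 0 Dp).
move=> hx S [sS cS].
have hs s : hyper (s *: x) by rewrite /hyper /= mxE hx mulr0.
have dc t := is_derive_scalel x t.
have := cS (fun t => t *: x) _ _ 1; rewrite scale1r; apply.
  split=> [s t|t]; last by case: (dc t).
  by rewrite fmul_hyper // scalerDl.
by have [_ ->] := dc 0.
Qed.

Lemma span_hyper : [set` <<[seq e_ R n i | i <- iota 1 n]>>%VS] = hyper.
Proof.
apply/seteqP; split=> x /=.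
  move=> /coord_span ->; rewrite /hyper /= summxE big1 // => i _.
  rewrite mxE (nth_map 0%N) ?size_iota // nth_iota // /e_ delta_hyper ?mulr0 //.
  by rewrite -val_eqE /= inordK //; have := ltn_ord i; lia.
move=> hx; rewrite [x]row_sum_delta; apply: rpred_sum => i _.
have [->|i0] := eqVneq i 0; first by rewrite hx scale0r mem0v.
apply: rpredZ; apply: memv_span; apply/mapP; exists (i : nat).
  by rewrite mem_iota; move: i0 (ltn_ord i); rewrite -val_eqE /=; lia.
by rewrite /e_ inord_val.
Qed.

Lemma HnE : @Hn R n = hyper.
Proof. by rewrite /Hn span_hyper conn_hyper. Qed.

Lemma lbrE (x y : V) : lbr x y = x 0 0 *: (y *m A) - y 0 0 *: (x *m A).
Proof.
rewrite !ad_e0E !scaler_sumr -sumrB; apply: eq_bigr => i _.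
by rewrite !scalerA -scalerBl [y 0 0 * _]mulrC.
Qed.

Lemma lbr_coord0 (x y : V) : (lbr x y) 0 0 = 0.
Proof.
rewrite lbrE [LHS]mxE [X in X + _]mxE [X in _ + X]mxE [X in _ - X]mxE.
by rewrite !ad_coord0 !mulr0 subr0.
Qed.

Lemma abelian_ideal_hyper (I : {vspace V}) : [set` I] = hyper -> abelian_ideal_codim1 I.
Proof.
move=> IE; have memI x : (x \in I) = (x 0 0 == 0).
  by apply/idP/eqP => [xI|x0]; [have : [set` I] x by []|have : hyper x by []]; rewrite ?IE // -IE.
split.
- by move=> x y _; rewrite memI lbr_coord0.
- by move=> x y; rewrite !memI lbrE => /eqP -> /eqP ->; rewrite !scale0r subr0.
have e0I : (I + <[e0]>)%VS = fullv.
  apply/eqP; rewrite eqEsubv subvf; apply/subvP => x _.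
  rewrite -(subrK (x 0 0 *: e0) x); apply: memv_add; last exact: memvZ (memv_line _).
  by rewrite memI !mxE eqxx mulr1 subrr.
have cap0 : (I :&: <[e0]>)%VS = 0%VS.
  apply/eqP; rewrite -subv0; apply/subvP => x; rewrite memv_cap memI => /andP[x0 /vlineP[t xt]].
  by move: x0; rewrite xt !mxE eqxx mulr1 => /eqP ->; rewrite scale0r mem0v.
have := dimv_disjoint_sum cap0; rewrite e0I dim_vline dimvf /dim /= mul1n.
have -> : e0 != 0.
  by apply/eqP => /rowP /(_ 0) /eqP; rewrite !mxE eqxx oner_eq0.
by rewrite addn1 => /esym.
Qed.

(** If [J] contained [x] with nonzero x_0, then the intersection of [J] with [I] would commute with
    [x] and so lie on the line of e_n; but its dimension is at least n - 1 >= 2. *)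
Lemma abelian_ideal_uniq (I J : {vspace V}) : (3 <= n)%N -> [set` I] = hyper ->
  abelian_ideal_codim1 J -> J = I.
Proof.
move=> n3 IE [_ Jab dJ]; have [_ _ dI] := abelian_ideal_hyper IE.
have memI x : (x \in I) = (x 0 0 == 0).
  by apply/idP/eqP => [xI|x0]; [have : [set` I] x by []|have : hyper x by []]; rewrite ?IE // -IE.
have [[x xJ x0]|H] := pselect (exists2 x, x \in J & x 0 0 != 0); last first.
  have JI : (J <= I)%VS.
    by apply/subvP => x xJ; rewrite memI; apply: contraT => x0; case: H; exists x.
  by apply/eqP; rewrite eqEdim JI; move: dI dJ; lia.
have cap1 : (J :&: I <= <[en]>)%VS.
  apply/subvP => y; rewrite memv_cap memI => /andP[yJ /eqP y0].
  have := Jab x y xJ yJ; rewrite lbrE y0 scale0r subr0 => /eqP.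
  rewrite scaler_eq0 (negPf x0) /= => /eqP yA.
  apply/vlineP; exists (y 0 ord_max); apply/rowP => i; rewrite !mxE eqxx /=.
  have [->|ni] := eqVneq i ord_max; first by rewrite mulr1.
  have [i0|i0] := eqVneq i 0; first by rewrite i0 y0 mulr0.
  rewrite mulr0; apply: ad_kernel => //; move: ni i0 (ltn_ord i).
  rewrite -!val_eqE /=; lia.
have := dimvS cap1; rewrite dim_vline.
have := dimv_sum_cap J I; have := dimvS (subvf (J + I)%VS).
rewrite dimvf /dim /= mul1n; move: dI dJ; case: (_ != 0) => /=; lia.
Qed.

(** * Left invariant symplectic forms and the orthogonal of the centre *)

Section InvariantForm.
Variable om : form2 R n.+1 V.
Hypotheses (om_inv : left_invariant om) (om_sympl : symplectic (Fn R n) om).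
Local Notation eu := (euclid_chart R n.+1).
Local Notation W0 := (om eu 0).

Lemma om_fmul (g u : V) :
  om eu u = exp_ad n (g 0 0) *m om eu (fmul g u) *m (exp_ad n (g 0 0))^T.
Proof.
have [_ H] := om_inv g.
rewrite (H eu eu u (fmul g) erefl erefl I) ?jacobian_fmul //; split=> //.
  exact: smooth_fmul.
exact: near_all.
Qed.

Lemma om_translate g : om eu g = exp_ad n (- g 0 0) *m W0 *m (exp_ad n (- g 0 0))^T.
Proof.
have := om_fmul g 0; rewrite fmulg0 => ->.
rewrite !mulmxA -exp_adD addNr exp_ad0 mul1mx -mulmxA -trmx_mul -exp_adD addNr.
by rewrite exp_ad0 trmx1 mulmx1.
Qed.

Lemma is_derive_coordX k (v : V) :
  is_derive (0 : V) v (fun w : V => w 0 0 ^+ k) ((k == 1%N)%:R * v 0 0).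
Proof.
elim: k => [|k IH]; first by rewrite mul0r; exact: is_derive_cst.
have D : is_derive (0 : V) v (fun w : V => w 0 0) (v 0 0).
  by apply: DeriveDef; [apply: diff_derivable; exact: differentiable_coord|exact: derive_coord].
have -> : (fun w : V => w 0 0 ^+ k.+1) = fun w : V => w 0 0 * w 0 0 ^+ k.
  by rewrite funeqE => w; rewrite exprS.
apply: is_derive_eq (is_derive_mulfun D IH) _.
by rewrite mxE mul0r add0r expr0n eqSS.
Qed.

Lemma is_derive_exp_ad (v : V) i j :
  is_derive (0 : V) v (fun w : V => exp_ad n (- w 0 0) i j) (- v 0 0 * A i j).
Proof.
have E : (fun w : V => exp_ad n (- w 0 0) i j) =
    fun w : V => \sum_(k < n.+1) (w 0 0 ^+ k * ((-1) ^+ k / k`!%:R * (A ^+ k) i j)).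
  rewrite funeqE => w; rewrite /exp_ad summxE; apply: eq_bigr => k _.
  rewrite [LHS]mxE (_ : (- w 0 0) ^+ k = (-1) ^+ k * w 0 0 ^+ k); last exact: exprNn.
  move: ((-1) ^+ k) (w 0 0 ^+ k) (k`!%:R^-1) ((A ^+ k) i j) => a b c e; ring.
rewrite E; have D k : is_derive (0 : V) v
    (fun w : V => w 0 0 ^+ k * ((-1) ^+ k / k`!%:R * (A ^+ k) i j))
    ((k == 1%N)%:R * v 0 0 * ((-1) ^+ k / k`!%:R * (A ^+ k) i j)).
  apply: is_derive_eq (is_derive_mulfun (is_derive_coordX k v) (is_derive_cst _ _ _)) _.
  by rewrite mulr0 add0r mulrC.
apply: is_derive_eq (is_derive_bigsum (fun k : 'I_n.+1 => D k)) _.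
have [n0|n0] := posnP n.
  rewrite big1 => [|k _]; last first.
    by rewrite (_ : (k == 1 :> nat) = false) ?mul0r //; have := ltn_ord k; rewrite {2}n0; lia.
  rewrite mxE; have := ltn_ord j; rewrite {2}n0 => j0.
  by rewrite (_ : (j == i.+1 :> nat) = false) ?andbF ?mulr0 //; lia.
have lt1 : (1 < n.+1)%N by [].
rewrite (bigD1 (Ordinal lt1)) //= big1 ?addr0 => [|k nk].
  by rewrite mul1r !expr1 divr1 mulN1r mulrN mulNr.
by rewrite (_ : (k == 1 :> nat) = false) ?mul0r //; apply/negbTE.
Qed.

(** By [om_translate] the form depends on the point only through its coordinate x_0, so its
    derivative at the identity is proportional to v_0. *)
Lemma derive_om (v : V) j k :
  'D_v (fun w => om eu w j k) 0 = - v 0 0 * (W0 *m A^T + A *m W0) j k.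
Proof.
have E : (fun w => om eu w j k) = fun w : V => \sum_b (\sum_a
    exp_ad n (- w 0 0) j a * W0 a b) * exp_ad n (- w 0 0) k b.
  rewrite funeqE => w; rewrite om_translate mxE; apply: eq_bigr => b _.
  by rewrite mxE [X in _ * X]mxE.
rewrite E; have dsum := is_derive_bigsum (fun b => is_derive_mulfun
    (is_derive_bigsum (fun a => is_derive_mulfun (is_derive_exp_ad v j a)
       (is_derive_cst (W0 a b) (0 : V) v))) (is_derive_exp_ad v k b)).
rewrite (@derive_val _ _ _ _ _ _ _ dsum) {dsum E} !mxE oppr0 exp_ad0.
have delta1 (l : 'I_n.+1) (X : 'I_n.+1 -> R) : \sum_a (1%:M : 'M[R]_n.+1) l a * X a = X l.
  rewrite (bigD1 l) //= mxE eqxx mul1r big1 ?addr0 // => i il.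
  by rewrite mxE eq_sym (negPf il) mul0r.
rewrite big_split /= delta1 mulrDr; congr (_ + _).
  rewrite mulr_sumr; apply: eq_bigr => b _.
  by rewrite (delta1 j (fun a => W0 a b)) [A^T b k]mxE mulrCA.
rewrite mulr_sumr; apply: eq_bigr => a _.
by rewrite mulr0 add0r /= [RHS]mulrA mulrC.
Qed.

(** Closedness is evaluated on e_0, e_j, e_k: the derivatives along e_j and e_k vanish by
    [derive_om], which leaves one term. *)
Lemma W0_cocycle (j k : 'I_n.+1) : j != 0 -> k != 0 -> (W0 *m A^T + A *m W0) j k = 0.
Proof.
move=> j0 k0; have [_ cl _] := om_sympl.
have := cl eu 0 0 j k erefl I; rewrite !derive_om ![basis_vec _ _ _ _]mxE !eqxx /=.
rewrite ![0 == _ :> 'I_n.+1]eq_sym (negPf j0) (negPf k0) !oppr0 !mul0r !addr0.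
by move=> /eqP; rewrite mulN1r oppr_eq0 => /eqP.
Qed.

Local Notation B i j := (W0 (inord i) (inord j)).

Lemma W0_antisym i j : W0 i j = - W0 j i.
Proof.
have [[asym _ _] _ _] := om_sympl.
by have /matrixP /(_ j i) := asym eu 0 erefl I; rewrite !mxE.
Qed.

Lemma ad_row (M : 'M[R]_n.+1) (i j : 'I_n.+1) :
  (A *m M) i j = if (0 < i < n)%N then M (inord i.+1) j else 0.
Proof.
rewrite mxE; case: ifP => [/andP[i0 lt_in]|H].
  rewrite (bigD1 (inord i.+1)) //= mxE i0 inordK // eqxx mul1r big1 ?addr0 // => l nl.
  rewrite mxE i0 /=; case: eqP => [E|]; last by rewrite mul0r.
  by case/eqP: nl; apply: val_inj; rewrite /= inordK.
rewrite big1 // => l _; rewrite mxE; case: andP => [[i0 /eqP li]|]; last by rewrite mul0r.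
by have := ltn_ord l; move: H; rewrite i0 li /=; lia.
Qed.

Lemma W0_shift i j : (0 < i < n)%N -> (0 < j < n)%N -> B i.+1 j = - B i j.+1.
Proof.
move=> hi hj; have hi' := hi; have hj' := hj.
have := @W0_cocycle (inord i) (inord j).
rewrite -![inord _ == 0]val_eqE /= !inordK; try lia.
move=> /(_ ltac:(lia) ltac:(lia)); rewrite mxE ad_row inordK ?hi; last by lia.
have -> : (W0 *m A^T) (inord i) (inord j) = - (A *m W0) (inord j) (inord i).
  rewrite !mxE -sumrN; apply: eq_bigr => l _.
  by rewrite [A^T _ _]mxE W0_antisym mulNr mulrC.
rewrite ad_row inordK ?hj'; last by lia.
by rewrite (W0_antisym (inord j.+1)) opprK addrC => /eqP; rewrite addr_eq0 => /eqP.
Qed.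

(** The cocycle identity with second vector e_n, which ad e_0 kills, so that only one term
    remains. *)
Lemma W0_last j : (0 < j < n)%N -> W0 ord_max (inord j.+1) = 0.
Proof.
move=> hj; have nmax : ord_max != 0 :> 'I_n.+1 by rewrite -val_eqE /=; lia.
have := @W0_cocycle (inord j) ord_max.
rewrite -[inord j == 0]val_eqE /= !inordK; try lia.
move=> /(_ ltac:(lia) nmax); rewrite mxE ad_row inordK ?hj; last by lia.
have -> : (W0 *m A^T) (inord j) ord_max = - (A *m W0) ord_max (inord j).
  rewrite !mxE -sumrN; apply: eq_bigr => l _.
  by rewrite [A^T _ _]mxE W0_antisym mulNr mulrC.
rewrite ad_row /= ltnn andbF oppr0 add0r => E.
by rewrite W0_antisym E oppr0.
Qed.

(* B(n,1) = (-1)^i B(n-i,1+i), and the middle term B(m,m) vanishes. *)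
Lemma W0_last1 m : (2 <= m)%N -> n = (2 * m - 1)%N -> W0 ord_max (inord 1) = 0.
Proof.
move=> m2 nE.
have H i : (i < m)%N -> B n 1 = (-1) ^+ i * B (n - i)%N i.+1.
  elim: i => [|i IH] im; first by rewrite expr0 mul1r subn0.
  rewrite IH; last by lia.
  have -> : (n - i = (n - i.+1).+1)%N by lia.
  by rewrite W0_shift; [rewrite exprS mulN1r mulrN mulNr|lia|lia].
have <- : inord n = ord_max :> 'I_n.+1 by apply: val_inj; rewrite /= inordK.
rewrite (H m.-1); last by lia.
have -> : (n - m.-1 = m)%N by lia.
have -> : m.-1.+1 = m by lia.
have : B m m = - B m m by exact: W0_antisym.
move=> /eqP; rewrite -addr_eq0 -mulr2n mulrn_eq0 /= => /eqP ->.
by rewrite mulr0.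
Qed.

(** [b] is the pairing of e_n with e_0, nonzero by nondegeneracy. This formula gives both H^perp and
    the kernel of the restricted form. *)
Lemma W0_row_last m : (2 <= m)%N -> n = (2 * m - 1)%N ->
  exists2 b, b != 0 & en *m W0 = b *: e0.
Proof.
move=> m2 nE; have E : en *m W0 = W0 ord_max 0 *: e0.
  apply/rowP => j; rewrite -rowE !mxE eqxx /=.
  have [->|j0] := eqVneq j 0; first by rewrite mulr1.
  rewrite mulr0.
  have [j1|j1] := eqVneq (j : nat) 1%N.
    have -> : j = inord 1 by apply: val_inj; rewrite /= inordK; lia.
    exact: W0_last1 m2 nE.
  have -> : j = inord (j : nat).-1.+1.
    by apply: val_inj; rewrite /= inordK; move: j0 (ltn_ord j); rewrite -val_eqE /=; lia.
  by apply: W0_last; move: j0 j1 (ltn_ord j); rewrite -val_eqE /=; lia.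
exists (W0 ord_max 0) => //; apply/eqP => b0.
have [_ _ /(_ eu 0 erefl I) uW] := om_sympl.
have : en *m W0 *m invmx W0 = 0 by rewrite E b0 scale0r mul0mx.
rewrite mulmxK // => /rowP /(_ ord_max) /eqP.
by rewrite !mxE !eqxx oner_eq0.
Qed.

Lemma lie_alg_center : (2 <= n)%N ->
  lie_alg (@fcenter R n) = [set z | exists t, z = t *: en].
Proof.
move=> n2; rewrite fcenterE //; apply/seteqP; split=> x.
  move=> [c [[cD cd] cH cx]]; exists (x 0 ord_max).
  rewrite -cx derive_mx //; apply/rowP => i; rewrite !mxE eqxx /=.
  have [->|ni] := eqVneq i ord_max; first by rewrite mulr1.
  rewrite mulr0 (_ : (fun t => c t 0 i) = fun=> 0) ?derive_cst // funeqE => t.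
  by have [s ->] := cH t; rewrite !mxE (negPf ni) andbF mulr0.
move=> [t ->]; have hen : hyper en by apply: delta_hyper; rewrite -val_eqE /=; lia.
have D s : is_derive (s : R) (1 : R) (fun s => s *: (t *: en)) (t *: en).
  exact: is_derive_scalel.
exists (fun s => s *: (t *: en)); split; last by case: (D 0).
  split=> [s s'|s]; last by case: (D s).
  by rewrite fmul_hyper ?scalerDl //; do 2!apply: hyperZ.
by move=> s; exists (s * t); rewrite scalerA.
Qed.

Lemma perp_hyper m : (2 <= m)%N -> n = (2 * m - 1)%N -> perp om (@fcenter R n) = hyper.
Proof.
move=> m2 nE; rewrite /perp lie_alg_center; last by lia.
rewrite -[RHS]conn_hyper; congr conn_subgroup.
have [b b0 bE] := W0_row_last m2 nE.
have HE x t : at_id om x (t *: en) = - (t * b * x 0 0).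
  rewrite /at_id; have -> : (x *m W0 *m (t *: en)^T) 0 0 = ((t *: en) *m W0^T *m x^T) 0 0.
    transitivity ((x *m W0 *m (t *: en)^T)^T 0 0); first by rewrite [RHS]mxE.
    by rewrite !trmx_mul trmxK mulmxA.
  have [[asym _ _] _ _] := om_sympl.
  rewrite asym // mulmxN mulNmx -scalemxAl bE -!scalemxAl -rowE !mxE.
  by rewrite mulrA.
apply/seteqP; split=> x.
  move=> /(_ en (ex_intro _ 1 (esym (scale1r _)))).
  rewrite -[en]scale1r HE mul1r => /eqP; rewrite oppr_eq0 mulf_eq0 (negPf b0) /=.
  by move=> /eqP.
by move=> hx y [t ->]; rewrite HE hx mulr0 oppr0.
Qed.

End InvariantForm.

Lemma fdivE (x y : V) : fmul x (fginv y) = x - y *m exp_ad n (x 0 0 - y 0 0).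
Proof. by rewrite /fmul /fginv mulNmx -mulmxA -exp_adD [- _ + _]addrC. Qed.

(** * Lattices of the filiform group *)

Section Lattice.
Variables (Gam : set V) (gam : V).
Hypothesis latG : lattice (Fn R n) (@fmul R n) 0 Gam.
Hypothesis sdG : semidirect Gam (Gam `&` @Hn R n) gam.

Let sG : subgroup (@fmul R n) 0 Gam. Proof. by case: latG. Qed.

Lemma lattice_discrete0 : exists N : set V, [/\ open N, N 0 & forall g, Gam g -> N g -> g = 0].
Proof.
have [[G0 _ _] _ dG _] := latG; have [N /mopen_euclid oN NE] := dG 0 G0.
exists N; split=> //; first by have [] : (N `&` Gam) 0 by rewrite NE.
by move=> g Gg Ng; have : (N `&` Gam) g by []; rewrite NE.
Qed.

Lemma fzpow_coord0 k : (fzpow gam k) 0 0 = k%:~R * gam 0 0.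
Proof.
have H g p : (iter p (fmul g) (0 : V)) 0 0 = p%:R * g 0 0.
  elim: p => [|p IH]; first by rewrite /= mxE mul0r.
  by rewrite iterS fmul_coord0 IH -natr1 mulrDl mul1r addrC.
case: k => p /=; first exact: H.
rewrite fmul_coord0 H fginv_coord0 -[(Negz p)%:~R]/(- p.+1%:R) -natr1; ring.
Qed.

Lemma fzpow_in k : Gam (fzpow gam k).
Proof.
have [_ H _] := sdG; apply/H; exists 0, k; split; last by rewrite fmul0g.
split; first by case: sG.
by rewrite HnE /hyper /= mxE.
Qed.

(** Otherwise [gam] would lie in [L], against the triviality of the powers of [gam] in [L]. *)
Lemma gam0_neq0 : gam 0 0 != 0.
Proof.
have [_ _ H] := sdG; apply/eqP => g0.
have : (1 : int) = 0; last by [].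
apply: H; split; first exact: fzpow_in.
by rewrite HnE /hyper /= fmulg0.
Qed.

Lemma Gam_coord0 x : Gam x -> `|x 0 0| < `|gam 0 0| -> x 0 0 = 0.
Proof.
have [_ H _] := sdG; move=> /H [l [k [[_ Ll] ->]]].
rewrite HnE in Ll; rewrite fmul_coord0 Ll add0r fzpow_coord0 normrM.
rewrite gtr_pMl ?normr_gt0 ?gam0_neq0 // -intr_norm -[1]/(1%:~R) ltr_int.
by case: k => [[|k]|k] //; rewrite mul0r.
Qed.

Lemma gam_reduce (t : R) : exists k : int, `|k%:~R * gam 0 0 + t| < `|gam 0 0|.
Proof.
exists (- Num.floor (t / gam 0 0)).
have -> : (- Num.floor (t / gam 0 0))%:~R * gam 0 0 + t =
    (t / gam 0 0 - (Num.floor (t / gam 0 0))%:~R) * gam 0 0.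
  by rewrite mulrNz mulNr mulrBl divfK ?gam0_neq0 // addrC.
rewrite normrM gtr_pMl ?normr_gt0 ?gam0_neq0 // ger0_norm ?subr_ge0 ?floor_le //.
by rewrite ltrBlDr addrC; have := floorD1_gt (t / gam 0 0); rewrite intrD.
Qed.

(** The quotient is covered by the images of the sets [S r], since a power of [gam] makes |x_0|
    smaller than |gam_0|; compactness leaves finitely many radii. The bound on x_0 is kept because
    it later forces elements of [Gam] into [L]. *)
Lemma Gam_bounded : exists r : R, forall x, exists2 g, Gam g &
  `|fmul g x| < r /\ `|(fmul g x) 0 0| < `|gam 0 0|.
Proof.
have [_ _ _ cG] := latG; have [G0 GM _] := sG.
pose S (r : nat) := [set y : V | `|y| < r%:R /\ `|y 0 0| < `|gam 0 0|].
have oS r : open (S r).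
  apply: (@openI _ [set y : V | `|y| < r%:R] [set y : V | `|y 0 0| < `|gam 0 0|]).
    apply: (@open_comp _ _ (fun y : V => `|y|) [set y | y < r%:R]); last exact: open_lt.
    by move=> y _; exact: norm_continuous.
  apply: (@open_comp _ _ (fun y : V => `|y 0 0|) [set y | y < `|gam 0 0|]); last exact: open_lt.
  move=> y _; apply: continuous_comp; [exact: coord_continuous|exact: norm_continuous].
pose U r : set V := \bigcup_(g in Gam) (fmul g @^-1` S r).
pose q := coset (@fmul R n) Gam.
have qE x y : q x = q y <-> exists2 g, Gam g & y = fmul g x.
  exact: (coset_mulP (@fmulA R n) (@fmul0g R n) (@fmulVg R n)).
pose F : set (set (set V)) := [set q @` U r | r in setT].
(* [U r] is stable under [Gam], hence is the full preimage of its image, and that image is open. *)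
have qU r x : (q @` U r) (q x) -> U r x.
  move=> [y [g Gg gy] /qE [h Gh ->]]; exists (fmul g (fginv h)).
    by apply: GM => //; apply: (subgroup_inv (@fmulA R n) (@fmul0g R n) (@fmulVg R n) sG).
  by rewrite /= -fmulA [fmul (fginv h) _]fmulA fmulVg fmul0g.
have [||E [finE EF EC]] := cG F.
- move=> _ [r _ <-]; split; first by move=> _ [x _ <-]; exists x.
  apply/mopen_euclid; rewrite setTI (_ : _ @^-1` _ = U r).
    apply: bigcup_open => g _; apply: open_comp => // y _.
    exact: smooth_at_continuous (smooth_fmul _ _).
  by apply/seteqP; split=> [x /qU|x Ux] //; exists x.
- move=> _ [x _ <-]; have [k Hk] := gam_reduce (x 0 0).
  pose r := Num.bound `|fmul (fzpow gam k) x|.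
  exists (q @` U r); [by exists r|exists x => //; exists (fzpow gam k)].
    exact: fzpow_in.
  by split; [exact: archi_boundP|rewrite fmul_coord0 fzpow_coord0].
have rho W : exists r, E W -> W = q @` U r.
  have [EW|nEW] := pselect (E W); last by exists 0%N => /nEW.
  by have [r _ <-] := EF W EW; exists r.
pose rh W := projT1 (cid (rho W)).
have rhE W : E W -> W = q @` U (rh W) by exact: (projT2 (cid (rho W))).
have /finite_seqP [s sE] := finite_image rh finE.
exists (\max_(i <- s) i)%:R => x.
have [W EW Wx] := EC (q x) (ex_intro2 _ _ x I erefl).
move: (Wx); rewrite (rhE W EW) => /qU [g Gg [gx g0]].
exists g => //; split=> //; apply: lt_le_trans gx _; rewrite ler_nat.
apply: leq_bigmax_seq => //; have : [set` s] (rh W) by rewrite -sE; exists W.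
by [].
Qed.

(** For [x] in [hyper] the translate by [g] has coordinate g_0, which is smaller than |gam_0| and
    therefore zero. *)
Lemma L_cocompact : exists r : R, forall x, hyper x ->
  exists2 l, (Gam l /\ hyper l) & `|l + x| <= r.
Proof.
have [r Hr] := Gam_bounded; exists r => x hx; have [g Gg [gx]] := Hr x.
rewrite fmul_coord0 hx addr0 => /(Gam_coord0 Gg) hg; exists g => //.
by rewrite -fmul_hyper // ltW.
Qed.

Lemma act1E l : hyper l -> act1 gam l = l *m exp_ad n (gam 0 0).
Proof.
move=> hl; rewrite /act1 {1}/fmul fmul_coord0 hl addr0 /fmul /fginv mulNmx.
by rewrite -mulmxA -exp_adD addNr exp_ad0 mulmx1 addrAC subrr add0r.
Qed.

Lemma hyper_exp_ad l t : hyper l -> hyper (l *m exp_ad n t).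
Proof. by rewrite /hyper /= exp_ad_col0. Qed.

Lemma L_act l : Gam l -> hyper l -> Gam (l *m exp_ad n (gam 0 0) - l).
Proof.
move=> Gl hl; have [H _ _] := sdG; have [_ GM GV] := sG.
have [|Gal _] := H l; first by rewrite HnE.
have -> : l *m exp_ad n (gam 0 0) - l = fmul (act1 gam l) (fginv l).
  by rewrite act1E // fmul_hyper ?fginv_hyper //; exact: hyper_exp_ad.
by apply: GM => //; exact: (subgroup_inv (@fmulA R n) (@fmul0g R n) (@fmulVg R n) sG).
Qed.

Lemma hyperB x y : hyper x -> hyper y -> hyper (x - y).
Proof. by rewrite /hyper /= !mxE => -> ->; rewrite subr0. Qed.

Lemma coord_le_norm (x : V) i : `|x 0 i| <= `|x|.
Proof. by rewrite [leRHS]/Num.Def.normr /= mx_normrE; exact: (le_bigmax _ _ (ord0, i)). Qed.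

Lemma ad_e0_last (x : V) : (2 <= n)%N -> x *m A ^+ n.-1 = x 0 (inord 1) *: en.
Proof.
move=> n2; apply/rowP => j; rewrite mxE (bigD1 (inord 1)) //= big1 ?addr0.
  rewrite (_ : n.-1 = n.-2.+1) ?ad_e0X; last by lia.
  rewrite inordK /=; last by lia.
  by rewrite !mxE eqxx -val_eqE /= (_ : (1 + n.-2.+1 = n)%N) //; lia.
move=> i ni; rewrite (_ : n.-1 = n.-2.+1) ?ad_e0X; last by lia.
rewrite (_ : (_ && _) = false) ?mulr0 //; apply/negbTE; apply: contra ni.
move=> /andP[i0 /eqP ji]; rewrite -val_eqE /= inordK; last by lia.
by have := ltn_ord j; lia.
Qed.

Lemma center_lattice_neq0 : (2 <= n)%N -> exists2 t, t != 0 & Gam (t *: en).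
Proof.
move=> n2; have [r Hr] := L_cocompact; set g0 := gam 0 0.
(* The displacement (r + 1) e_1 is chosen so that an [l] with l_1 = 0 would leave a coordinate r + 1
   exceeding the bound [r]. *)
have h1 : hyper ((r + 1) *: delta_mx 0 (inord 1)).
  by apply/hyperZ/delta_hyper; rewrite -val_eqE /= inordK //; lia.
have [l [Gl hl] lr] := Hr _ h1.
have l1 : l 0 (inord 1) != 0.
  apply/eqP => l1; have := le_trans (coord_le_norm _ (inord 1)) lr.
  rewrite !mxE l1 !eqxx mulr1 add0r ler_norml => /andP[_].
  by rewrite gerDl ler10.
pose N := exp_ad n g0 - 1%:M.
have LN k : Gam (l *m N ^+ k) /\ hyper (l *m N ^+ k).
  elim: k => [|k [IHG IHh]]; first by rewrite expr0 mulmx1.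
  have -> : l *m N ^+ k.+1 = (l *m N ^+ k) *m exp_ad n g0 - l *m N ^+ k.
    by rewrite exprSr -[_ * N]/(_ *m N) mulmxA mulmxBr mulmx1.
  by split; [exact: L_act|apply: hyperB => //; exact: hyper_exp_ad].
have [W cAW EW] := exp_ad_factor g0.
have NE : N = g0 *: (A * (1 + A * W)) by rewrite /N EW addrAC subrr add0r.
have cAU : GRing.comm A (1 + A * W).
  by apply: commrD; [exact: commr1|apply: commrM].
(* N^(n-1) carries the factor A^(n-1) and A^n = 0, so only the constant term 1 of (1 + AW)^(n-1)
   matters. As l A^(n-1) = l_1 e_n, the central element is g_0^(n-1) l_1 e_n. *)
have [X XE] : exists X, (1 + A * W) ^+ n.-1 = 1 + A * X.
  elim: n.-1 => [|k [X IH]]; first by exists 0; rewrite expr0 mulr0 addr0.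
  exists (X + (1 + X * A) * W); rewrite exprSr IH !mulrDr !mulrDl !mul1r mulr1.
  by rewrite mulrDr !mulrA -!addrA.
have An : A ^+ n.-1 * A = 0.
  rewrite -exprSr; apply/matrixP => i j; rewrite mxE.
  rewrite ad_e0X (_ : (_ && _) = false) //; apply/negbTE/negP => /andP[i0 /eqP].
  by have := ltn_ord j; lia.
exists (g0 ^+ n.-1 * l 0 (inord 1)).
  by rewrite mulf_neq0 // expf_neq0 // gam0_neq0.
have [+ _] := LN n.-1.
rewrite NE exprZn exprMn_comm // XE mulrDr mulr1 mulrA An mul0r addr0.
by rewrite -scalemxAr ad_e0_last // scalerA.
Qed.

End Lattice.

End FiliformGroup.

(** * Tori and linear models *)

Section Auxiliary.
Variable R : realType.
Local Notation eu d := (euclid_chart R d).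
Local Notation Quot d' d f := (quotient_mfd d' (euclid R d) f).

Lemma continuous2_open d (f : 'rV[R]_d -> 'rV[R]_d -> 'rV[R]_d) x y A :
  {for (x, y), continuous (fun p : 'rV[R]_d * 'rV[R]_d => f p.1 p.2)} -> open A -> A (f x y) ->
  exists U W, [/\ open U, open W, U x, W y & forall u w, U u -> W w -> A (f u w)].
Proof.
move=> fc oA Axy; have [[P Q] /= [nP nQ] PQ] := fc _ (open_nbhs_nbhs (conj oA Axy)).
move: nP nQ; rewrite !nbhsE => -[U [oU Ux] UP] [W [oW Wy] WQ].
exists U, W; split=> // u w Uu Ww; apply: (PQ (u, w)).
by split=> /=; [exact: UP|exact: WQ].
Qed.

Lemma sub_continuous2 d (x y : 'rV[R]_d) :
  {for (x, y), continuous (fun p : 'rV[R]_d * 'rV[R]_d => p.1 - p.2)}.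
Proof. by apply: continuousB; [exact: cvg_fst|exact: cvg_snd]. Qed.

Lemma for_continuous_eq (T T' : topologicalType) (f g : T -> T') (x : T) :
  (forall y, f y = g y) -> {for x, continuous f} -> {for x, continuous g}.
Proof. by move=> /funext ->. Qed.

Lemma continuous_bigsum (T : topologicalType) (W : normedModType R) n
    (F : 'I_n -> T -> W) (x : T) :
  (forall i, {for x, continuous (F i)}) -> {for x, continuous (fun y => \sum_i F i y)}.
Proof.
move=> H; elim: (index_enum _) => [|i s IH].
  apply: (@for_continuous_eq _ _ (cst 0)); last exact: cst_continuous.
  by move=> y; rewrite big_nil.
apply: (@for_continuous_eq _ _ (fun y => F i y + \sum_(j <- s) F j y)).
  by move=> y; rewrite big_cons.
exact: continuousD (H i) IH.
Qed.

(** By [fdivE], x y^-1 is [x] minus a finite sum of powers of x_0 - y_0 times linear functions of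
    [y], so continuity is checked term by term. *)
Lemma fdiv_continuous2 n (x y : 'rV[R]_n.+1) :
  {for (x, y), continuous (fun p : 'rV[R]_n.+1 * 'rV[R]_n.+1 => fmul p.1 (fginv p.2))}.
Proof.
pose c (k : 'I_n.+1) (p : 'rV[R]_n.+1 * 'rV[R]_n.+1) : R :=
  (p.1 0 0 - p.2 0 0) ^+ k / k`!%:R.
apply: (@for_continuous_eq _ _ (fun p : 'rV[R]_n.+1 * 'rV[R]_n.+1 =>
    p.1 - \sum_(k < n.+1) c k p *: (p.2 *m ad_e0 R n ^+ k))).
  move=> p; rewrite fdivE /exp_ad mulmx_sumr; congr (_ - _).
  by apply: eq_bigr => k _; rewrite -scalemxAr.
have c1 : {for (x, y), continuous (fst : 'rV[R]_n.+1 * 'rV[R]_n.+1 -> _)} by exact: cvg_fst.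
have c2 : {for (x, y), continuous (snd : 'rV[R]_n.+1 * 'rV[R]_n.+1 -> _)} by exact: cvg_snd.
apply: continuousB => //; apply: continuous_bigsum => k; apply: continuousZ; last first.
  have cm : {for y, continuous (fun z : 'rV[R]_n.+1 => z *m ad_e0 R n ^+ k)}.
    by apply: smooth_at_continuous; exact: smooth_at_mulmx.
  exact: (@continuous_comp _ _ _ (snd : 'rV[R]_n.+1 * 'rV[R]_n.+1 -> _) _ (x, y) c2 cm).
apply: continuousM; last exact: cst_continuous.
have cb : {for (x, y), continuous (fun p : 'rV[R]_n.+1 * 'rV[R]_n.+1 => p.1 0 0 - p.2 0 0)}.
  apply: continuousB.
    by apply: (@continuous_comp _ _ _ fst (fun z : 'rV[R]_n.+1 => z 0 0) (x, y) c1); exact: coord_continuous.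
  by apply: (@continuous_comp _ _ _ snd (fun z : 'rV[R]_n.+1 => z 0 0) (x, y) c2); exact: coord_continuous.
by apply: (@continuous_comp _ _ _ _ (fun z : R => z ^+ k) (x, y) cb); exact: exprn_continuous.
Qed.

Lemma linear_submersion d d' (M : 'M[R]_(d, d')) (M' : 'M[R]_(d', d)) : M' *m M = 1%:M ->
  submersion (euclid R d) (euclid R d') (fun x => x *m M).
Proof.
move=> MM; split=> // c' -> c u v -> _ _ /= uv; split.
  exists (fun x => x *m M); split=> //; first exact: smooth_at_mulmx.
  exact: near_all.
(* The affine section w |-> u + (w - uM)M', which passes through [u]. *)
exists (fun w => (u - u *m M *m M') + w *m M'); split.
- exact: smooth_at_affine.
- by rewrite -uv subrK.
- apply: near_all => w /=; rewrite mulmxDl mulmxBl -!mulmxA MM !mulmx1 subrr.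
  by rewrite add0r.
Qed.

Section VectorGroupCovering.
Variables (d : nat) (T : Type) (mul : T -> T -> T) (th : 'rV[R]_d -> T).
Hypothesis th_inj : injective th.
Hypothesis thD : forall x y, th (x + y) = mul (th x) (th y).
Variable Lam : set 'rV[R]_d.
Hypothesis Lam0 : Lam 0.
Hypothesis LamD : forall x y, Lam x -> Lam y -> Lam (x + y).
Hypothesis LamN : forall x, Lam x -> Lam (- x).
Hypothesis Lam_discrete : exists A : set 'rV[R]_d, [/\ open A, A 0 & forall x, Lam x -> A x -> x = 0].

Lemma vector_coset_eq u v :
  coset mul (th @` Lam) (th u) = coset mul (th @` Lam) (th v) <->
  exists2 l, Lam l & v = l + u.
Proof.
split=> [E|[l Ll ->]].
  have : coset mul (th @` Lam) (th v) (th v).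
    by exists (th 0); [exists 0|rewrite -thD add0r].
  by rewrite -E => -[_ [l Ll <-]]; rewrite -thD => /th_inj <-; exists l.
apply/seteqP; split=> _ [_ [h Lh <-] <-].
  exists (th (h - l)); first by exists (h - l) => //; exact: LamD (LamN Ll).
  by rewrite -!thD addrA subrK.
exists (th (h + l)); first by exists (h + l) => //; exact: LamD.
by rewrite -!thD addrA.
Qed.

Lemma vector_group_covering :
  covering [set +%R g | g in Lam] (coset mul (th @` Lam) \o th).
Proof.
apply: (@group_covering _ _ _ +%R -%R 0 Lam) => //.
- exact: addrA.
- exact: add0r.
- exact: addNr.
- move=> g w; apply: smooth_at_near_eq (smooth_at_affine g 1%:M w).
  by apply: near_all => z; rewrite mulmx1.
- move=> x y A oA Axy.
  apply: (@continuous2_open d (fun x y => x - y)) oA Axy.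
  exact: sub_continuous2.
- split=> // x Lx; exists (- x); [exact: LamN|exact: addNr].
- exact: vector_coset_eq.
Qed.

Lemma vector_group_const_form (B : 'M[R]_d) : B^T = - B ->
  exists2 Om, is_pullback (euclid R d) (Quot d d (coset mul (th @` Lam) \o th))
      (coset mul (th @` Lam) \o th) Om (fun _ _ => B) &
    is_form2 (Quot d d (coset mul (th @` Lam) \o th)) Om.
Proof.
move=> BT; have cf := vector_group_covering.
have [Om pb] : exists Om, is_pullback (euclid R d) (Quot d d (coset mul (th @` Lam) \o th))
    (coset mul (th @` Lam) \o th) Om (fun _ _ => B).
  apply: (covering_form_exists cf) => _ w [g _ <-].
  have -> : 'J (+%R g) w = 1%:M.
    rewrite -[RHS](jacobian_affine g 1%:M w); apply: esym; apply: jacobian_near_eq.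
      exact: smooth_at_affine.
    by apply: near_all => z; rewrite mulmx1.
  by rewrite mul1mx trmx1 mulmx1.
exists Om => //; exact: pullback_form2 pb (covering_atlas cf) (const_form2 BT).
Qed.

End VectorGroupCovering.

(** A section over the chart is a right inverse of [G] near [G x]; the dimensions being equal, the
    Jacobian is invertible. *)
Lemma quotient_rep_unit d T (f : 'rV[R]_d -> T) c x (G : 'rV[R]_d -> 'rV[R]_d) :
  charts (Quot d d f) c -> local_rep f (eu d) c x G -> 'J G x \in unitmx.
Proof.
move=> Qc [/= sG cG HG]; have [oc ci _ /submersive_euclid sub] := Qc.
have [_ [s [ss sx Hs]]] := sub _ _ cG (nbhs_singleton HG).
have gs : \forall w \near G x, id w = (G \o s) w.
  rewrite -sx in sG HG; have n1 := near_comp (smooth_at_comp ss sG) (near_open oc _).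
  have n2 := near_comp ss HG; rewrite /= sx in n1.
  apply: filterS2 (filterI (near_open oc cG) (n1 cG)) (filterI Hs n2).
  by move=> w [cw cGw] [E1 E2] /=; apply: ci; rewrite ?inE // -E2 E1.
have sG' : smooth_at G (s (G x)) by rewrite sx.
have := jacobian_near_eq (smooth_at_id _) gs.
rewrite jacobian_id (jacobian_comp ss sG') sx => /esym /mulmx1_unit.
by case.
Qed.

Section Skip.
Variable d : nat.

(* Right multiplication by [skip h] inserts a zero coordinate in position [h]. *)
Definition skip (h : 'I_d.+1) : 'M[R]_(d, d.+1) := \matrix_(i, j) (j == lift h i)%:R.

Lemma skip_lift h (u : 'rV[R]_d) (i : 'I_d) : (u *m skip h) 0 (lift h i) = u 0 i.
Proof.
rewrite mxE (bigD1 i) //= mxE eqxx mulr1 big1 ?addr0 // => j ji.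
by rewrite mxE (inj_eq lift_inj) eq_sym (negPf ji) mulr0.
Qed.

Lemma skip_hole h (u : 'rV[R]_d) : (u *m skip h) 0 h = 0.
Proof. by rewrite mxE big1 // => j _; rewrite mxE (negPf (neq_lift _ _)) mulr0. Qed.

Lemma skip_tr h (x : 'rV[R]_d.+1) i : (x *m (skip h)^T) 0 i = x 0 (lift h i).
Proof.
rewrite mxE (bigD1 (lift h i)) //= !mxE eqxx mulr1 big1 ?addr0 // => j ji.
by rewrite !mxE (negPf ji) mulr0.
Qed.

Lemma skipK h : skip h *m (skip h)^T = 1%:M.
Proof.
apply/row_matrixP => i; rewrite !rowE mulmxA mulmx1; apply/rowP => j.
by rewrite skip_tr skip_lift.
Qed.

Lemma skip_decomp h (x : 'rV[R]_d.+1) :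
  x = x *m (skip h)^T *m skip h + x 0 h *: delta_mx 0 h.
Proof.
apply/rowP => j; rewrite [RHS]mxE [X in _ + X]mxE [delta_mx _ _ _ _]mxE eqxx /=.
case: (unliftP h j) => [i|] ->; last by rewrite skip_hole eqxx mulr1 add0r.
by rewrite skip_lift skip_tr eq_sym (negPf (neq_lift _ _)) mulr0 addr0.
Qed.

Lemma skip_proj_mul h p (M : 'M[R]_(d.+1, p)) : delta_mx 0 h *m M = 0 :> 'rV_p ->
  (skip h)^T *m skip h *m M = M.
Proof.
move=> eM; apply/row_matrixP => i; rewrite !rowE.
by rewrite [in RHS](skip_decomp h (delta_mx 0 i)) mulmxDl -scalemxAl eM scaler0 addr0 !mulmxA.
Qed.

Lemma skip_tr_norm h (x : 'rV[R]_d.+1) : `|x *m (skip h)^T| <= `|x|.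
Proof.
rewrite [leLHS]/Num.Def.normr /= mx_normrE; apply: bigmax_le => // -[i j] _ /=.
by rewrite (ord1 i) skip_tr; exact: coord_le_norm.
Qed.

Lemma skip_range h : range (fun u : 'rV[R]_d => u *m skip h) = [set x | x 0 h = 0].
Proof.
apply/seteqP; split=> [_ [u _ <-]|x xh]; first exact: skip_hole.
exists (x *m (skip h)^T) => //.
by rewrite [RHS](skip_decomp h) xh scale0r addr0.
Qed.

End Skip.
End Auxiliary.

(** * The reduced torus *)

Section Reduction.
Variables (R : realType) (k : nat).
Hypothesis k2 : (2 <= k)%N.
Local Notation V := 'rV[R]_k.+2.
Local Notation A := (ad_e0 R k.+1).
Local Notation mul := (@fmul R k.+1).
Local Notation en := (delta_mx 0 ord_max : V).
Local Notation H := (@fcenter R k.+1).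
Local Notation hyp := (@hyper R k.+1).
Local Notation eu d := (euclid_chart R d).
Local Notation Quot d' d f := (quotient_mfd d' (euclid R d) f).
Local Notation P1 := (skip R (ord0 : 'I_k.+2)).
Local Notation P2 := (skip R (ord_max : 'I_k.+1)).
Local Notation pr x := (x *m P1^T *m P2^T).

Let n2 : (2 <= k.+1)%N. Proof. by lia. Qed.

(* [thH], [thP] and [thK] parametrize H, H^perp = {x_0 = 0} and K = H\H^perp by
   vector groups; [pr] inverts [thK] by forgetting the coordinates x_0 and x_n. *)
Definition thH (u : 'rV[R]_1) : V := u *m en.
Definition thP (u : 'rV[R]_k.+1) : V := u *m P1.
Definition thK (u : 'rV[R]_k) : set V := coset mul H (u *m P2 *m P1).

Lemma centerP z : H z <-> exists t, z = t *: en.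
Proof. by rewrite fcenterE. Qed.

Lemma en_hyper : hyp en.
Proof. by apply: delta_hyper; rewrite -val_eqE. Qed.

Lemma H_hyper z : H z -> hyp z.
Proof. by move=> /centerP [t ->]; apply: hyperZ; exact: en_hyper. Qed.

Lemma H0 : H 0.
Proof. by apply/centerP; exists 0; rewrite scale0r. Qed.

Lemma H_subgroup : subgroup mul 0 H.
Proof.
split=> [|x y Hx Hy|x Hx]; first exact: H0.
  rewrite fmul_hyper; last exact: H_hyper.
  move: Hx Hy => /centerP [s ->] /centerP [t ->]; apply/centerP; exists (s + t).
  by rewrite scalerDl.
exists (fginv x); last exact: fmulVg.
rewrite fginv_hyper; last exact: H_hyper.
by move: Hx => /centerP [s ->]; apply/centerP; exists (- s); rewrite scaleNr.
Qed.

Lemma H_comm z g : H z -> mul z g = mul g z. Proof. exact. Qed.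

Lemma thH_inj : injective thH.
Proof.
apply: (can_inj (g := fun x => x *m en^T)) => u.
rewrite /thH -mulmxA trmx_delta mul_delta_mx -[RHS]mulmx1; congr (_ *m _).
by apply/matrixP => i j; rewrite !ord1 !mxE.
Qed.

Lemma thHE u : thH u = u 0 0 *: en.
Proof. by rewrite /thH [u in LHS]mx11_scalar mul_scalar_mx. Qed.

Lemma thHD u v : thH (u + v) = mul (thH u) (thH v).
Proof.
rewrite fmul_hyper ?/thH ?mulmxDl // -/(thH _) thHE; apply: hyperZ; exact: en_hyper.
Qed.

Lemma range_thH : range thH = H.
Proof.
apply/seteqP; split=> [_ [u _ <-]|z /centerP [t ->]]; first by apply/centerP; exists (u 0 0); rewrite thHE.
by exists (const_mx t) => //; rewrite thHE mxE.
Qed.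

Lemma thP_hyper u : hyp (thP u).
Proof. exact: skip_hole. Qed.

Lemma thP_inj : injective thP.
Proof. by apply: (can_inj (g := fun x => x *m P1^T)) => u; rewrite /thP -mulmxA skipK mulmx1. Qed.

Lemma thPD u v : thP (u + v) = mul (thP u) (thP v).
Proof. by rewrite fmul_hyper ?/thP ?mulmxDl //; exact: thP_hyper. Qed.

Lemma range_thP : range thP = hyp.
Proof. exact: skip_range. Qed.

Lemma hyper_P1 x : hyp x -> x *m P1^T *m P1 = x.
Proof. by move=> hx; rewrite [RHS](skip_decomp ord0) hx scale0r addr0. Qed.

Lemma en_pr : pr en = 0.
Proof.
have -> : en *m P1^T = delta_mx 0 ord_max.
  apply/rowP => i; rewrite skip_tr !mxE eqxx /= -val_eqE /= /bump /= add1n.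
  by rewrite eqSS -val_eqE.
apply/rowP => i; rewrite skip_tr !mxE eqxx /=.
by rewrite eq_sym (negPf (neq_lift _ _)).
Qed.

Lemma pr_emb (u : 'rV[R]_k) : pr (u *m P2 *m P1) = u.
Proof. by rewrite -!mulmxA [P1 *m _]mulmxA skipK mul1mx skipK mulmx1. Qed.

Lemma emb_hyper u : hyp (u *m P2 *m P1).
Proof. exact: skip_hole. Qed.

Lemma pr_decomp x : hyp x -> exists t, x = t *: en + pr x *m P2 *m P1.
Proof.
move=> hx; exists ((x *m P1^T) 0 ord_max).
rewrite -[LHS]hyper_P1 // [x *m P1^T in LHS](skip_decomp ord_max) mulmxDl addrC.
congr (_ + _); rewrite -scalemxAl; congr (_ *: _).
apply/rowP => i; by rewrite -rowE !mxE eqxx /=; congr (_%:R).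
Qed.

Lemma coset_HP x y : coset mul H x = coset mul H y <-> exists t, y = t *: en + x.
Proof.
rewrite (coset_mulP (@fmulA R _) (@fmul0g R _) (@fmulVg R _) _ _ H_subgroup).
split=> [[g /[dup] Hg /centerP [t gE] ->]|[t ->]].
  by exists t; rewrite fmul_hyper ?gE //; apply: H_hyper; rewrite -gE.
have Ht : H (t *: en) by apply/centerP; exists t.
by exists (t *: en) => //; rewrite fmul_hyper //; exact: H_hyper.
Qed.

Lemma thK_pr x : hyp x -> thK (pr x) = coset mul H x.
Proof. by move=> hx; apply/coset_HP; exact: pr_decomp. Qed.

Lemma thK_inj : injective thK.
Proof.
move=> u v /coset_HP [t] /(congr1 (fun x => pr x)).
by rewrite !mulmxDl -!scalemxAl en_pr scaler0 add0r !pr_emb.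
Qed.

Lemma mul_coset (S S' : set V) x : set_mul mul S (coset mul S' x) = coset mul (set_mul mul S S') x.
Proof.
apply/seteqP; split=> z.
  by move=> [s Ss [_ [s' Ss' <-] <-]]; exists (mul s s'); [exists s => //; exists s'|rewrite fmulA].
by move=> [_ [s Ss [s' Ss' <-]] <-]; exists s => //; exists (mul s' x); [exists s'|rewrite fmulA].
Qed.

(** Only the commutation of [S'] with [x] is asked: this covers products modulo a central subgroup,
    where [S'] is central, and the action of the circle [C], where [x] is. *)
Lemma mul_coset_coset (S S' : set V) x y : (forall s, S' s -> mul s x = mul x s) ->
  set_mul mul (coset mul S x) (coset mul S' y) = coset mul (set_mul mul S S') (mul x y).
Proof.
move=> C; have E s s' : S' s' -> mul (mul s x) (mul s' y) = mul (mul s s') (mul x y).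
  by move=> Ss'; rewrite -!fmulA [mul x (mul s' y)]fmulA -(C s') // -fmulA.
apply/seteqP; split=> z.
  move=> [_ [s Ss <-] [_ [s' Ss' <-] <-]]; rewrite E //.
  by exists (mul s s') => //; exists s => //; exists s'.
move=> [_ [s Ss [s' Ss' <-]] <-]; rewrite -E //.
by exists (mul s x); [exists s|exists (mul s' y) => //; exists s'].
Qed.

Lemma mul_subgroup_l (S S' : set V) : subgroup mul 0 S -> S' 0 -> S' `<=` S ->
  set_mul mul S S' = S.
Proof.
move=> [_ SM _] S0 SS; apply/seteqP; split=> [_ [a Sa [b Sb <-]]|a Sa]; first exact: SM (SS _ Sb).
by exists a => //; exists 0 => //; rewrite fmulg0.
Qed.

Lemma mul_subgroup_r (S S' : set V) : subgroup mul 0 S -> S' 0 -> S' `<=` S ->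
  set_mul mul S' S = S.
Proof.
move=> [_ SM _] S0 SS; apply/seteqP; split=> [_ [a Sa [b Sb <-]]|a Sa]; first exact: SM (SS _ Sa) Sb.
by exists 0 => //; exists a => //; rewrite fmul0g.
Qed.

Lemma Kmul_coset x y : set_mul mul (coset mul H x) (coset mul H y) = coset mul H (mul x y).
Proof.
rewrite mul_coset_coset; last by move=> s; exact: H_comm.
by rewrite mul_subgroup_l //; [exact: H_subgroup|exact: H0].
Qed.

Lemma thKD u v : thK (u + v) = set_mul mul (thK u) (thK v).
Proof. by rewrite Kmul_coset fmul_hyper ?/thK ?mulmxDl //; exact: emb_hyper. Qed.

Lemma thK0 : thK 0 = H.
Proof.
rewrite /thK !mul0mx; apply/seteqP; split=> [_ [z Hz <-]|z Hz]; first by rewrite fmulg0.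
by exists z => //; rewrite fmulg0.
Qed.

Lemma H_mfdE : submfd 1 H = Quot 1 1 thH.
Proof.
apply: (@submfd_linear _ _ _ en en^T); last by rewrite -range_thH.
by rewrite trmx_delta mul_delta_mx; apply/matrixP => i j; rewrite !ord1 !mxE.
Qed.

Lemma Hp_mfdE : submfd k.+1 hyp = Quot k.+1 k.+1 thP.
Proof. by apply: (submfd_linear (skipK R ord0)); rewrite -range_thP. Qed.

Lemma thP_atlas : atlas (Quot k.+1 k.+1 thP).
Proof. exact: covering_atlas (injective_covering thP_inj). Qed.

(** The projection onto K, read through [thP], is [thK] after the linear submersion forgetting x_n.
    The two quotients are merged, then this submersion is cancelled. *)
Lemma K_mfdE : quotient_mfd k (Quot k.+1 k.+1 thP) (coset mul H) = Quot k k thK.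
Proof.
rewrite (quotient_mfd_comp _ _ (@euclid_atlas R _) thP_atlas (covering_submersion _) erefl).
have -> : coset mul H \o thP = thK \o (fun u => u *m P2^T).
  rewrite funeqE => u /=; rewrite -thK_pr; last exact: thP_hyper.
  by rewrite /thP -!mulmxA [P1 *m _]mulmxA skipK mul1mx.
apply: esym; apply: quotient_mfd_comp (@euclid_atlas R _) (@euclid_atlas R _) _ _.
  by apply: (@linear_submersion _ _ _ _ P2); exact: skipK.
apply/seteqP; split=> // u _; exists (u *m P2) => //.
by rewrite -mulmxA skipK mulmx1.
Qed.

(** * The lattices in H, H^perp and K, and the projections between the quotients *)

Section Lattices.
Variables (Gam : set V) (gam : V).
Hypothesis latG : lattice (Fn R k.+1) mul 0 Gam.
Hypothesis sdG : semidirect Gam (Gam `&` @Hn R k.+1) gam.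
Local Notation g0 := (gam 0 0).
Local Notation N := (exp_ad k.+1 g0 - 1%:M).

(* Parameters of Gam `&` H, Gam `&` H^perp and Gam1. *)
Definition LamH : set 'rV[R]_1 := [set u | Gam (thH u)].
Definition LamP : set 'rV[R]_k.+1 := [set u | Gam (thP u)].
Definition LamK : set 'rV[R]_k := [set u | exists l, [/\ Gam l, hyp l & u = pr l]].

Let sG : subgroup mul 0 Gam. Proof. by case: latG. Qed.

Lemma Gam0 : Gam 0. Proof. by case: sG. Qed.

Lemma GamD x y : Gam x -> hyp x -> Gam y -> Gam (x + y).
Proof. by move=> Gx hx Gy; rewrite -fmul_hyper //; case: sG => _ + _; apply. Qed.

Lemma GamN x : Gam x -> hyp x -> Gam (- x).
Proof.
move=> Gx hx; rewrite -fginv_hyper //.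
exact: (subgroup_inv (@fmulA R _) (@fmul0g R _) (@fmulVg R _) sG).
Qed.

Lemma hyperN x : hyp x -> hyp (- x).
Proof. by rewrite /hyper /= mxE => ->; rewrite oppr0. Qed.

Lemma hyperD x y : hyp x -> hyp y -> hyp (x + y).
Proof. by rewrite /hyper /= mxE => -> ->; rewrite addr0. Qed.

Lemma thH_hyper u : hyp (thH u).
Proof. by apply: H_hyper; rewrite -range_thH; exists u. Qed.

Lemma LamP0 : LamP 0. Proof. by rewrite /LamP /= /thP mul0mx; exact: Gam0. Qed.
Lemma LamPD x y : LamP x -> LamP y -> LamP (x + y).
Proof. by move=> Lx Ly; rewrite /LamP /= /thP mulmxDl; apply: GamD => //; exact: thP_hyper. Qed.
Lemma LamPN x : LamP x -> LamP (- x).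
Proof. by move=> Lx; rewrite /LamP /= /thP mulNmx; apply: GamN => //; exact: thP_hyper. Qed.

Lemma LamH0 : LamH 0. Proof. by rewrite /LamH /= /thH mul0mx; exact: Gam0. Qed.
Lemma LamHD x y : LamH x -> LamH y -> LamH (x + y).
Proof. by move=> Lx Ly; rewrite /LamH /= /thH mulmxDl; apply: GamD => //; exact: thH_hyper. Qed.
Lemma LamHN x : LamH x -> LamH (- x).
Proof. by move=> Lx; rewrite /LamH /= /thH mulNmx; apply: GamN => //; exact: thH_hyper. Qed.

Lemma LamK0 : LamK 0.
Proof. by exists 0; split; [exact: Gam0|rewrite /hyper /= mxE|rewrite !mul0mx]. Qed.
Lemma LamKD x y : LamK x -> LamK y -> LamK (x + y).
Proof.
move=> [l [Gl hl ->]] [l' [Gl' hl' ->]]; exists (l + l'); split.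
- exact: GamD.
- exact: hyperD.
- by rewrite !mulmxDl.
Qed.
Lemma LamKN x : LamK x -> LamK (- x).
Proof.
by move=> [l [Gl hl ->]]; exists (- l); split; [exact: GamN|exact: hyperN|rewrite !mulNmx].
Qed.

Lemma linear_open d d' (M : 'M[R]_(d, d')) (B : set 'rV[R]_d') : open B ->
  open ((fun u : 'rV[R]_d => u *m M) @^-1` B).
Proof.
move=> oB; apply: open_comp => // u _.
by apply: smooth_at_continuous; exact: smooth_at_mulmx.
Qed.

Lemma linear_discrete d (M : 'M[R]_(d, k.+2)) (Lam : set 'rV[R]_d) :
  (forall u, Lam u -> Gam (u *m M)) -> (forall u, Lam u -> u *m M = 0 -> u = 0) ->
  exists B : set 'rV[R]_d, [/\ open B, B 0 & forall u, Lam u -> B u -> u = 0].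
Proof.
move=> LG L0; have [B [oB B0 BG]] := lattice_discrete0 latG.
exists ((fun u => u *m M) @^-1` B); split; first exact: linear_open.
  by rewrite /= mul0mx.
by move=> u Lu Bu; apply: L0 => //; apply: BG => //; exact: LG.
Qed.

Lemma LamP_discrete : exists B : set 'rV[R]_k.+1,
  [/\ open B, B 0 & forall u, LamP u -> B u -> u = 0].
Proof.
apply: (@linear_discrete _ P1) => // u _ uP; apply: thP_inj.
by rewrite [LHS]uP /thP mul0mx.
Qed.

Lemma LamH_discrete : exists B : set 'rV[R]_1,
  [/\ open B, B 0 & forall u, LamH u -> B u -> u = 0].
Proof.
apply: (@linear_discrete _ en) => // u _ uP; apply: thH_inj.
by rewrite [LHS]uP /thH mul0mx.
Qed.

Lemma hyper_ad0 l : hyp l -> l *m A = 0 -> exists t, l = t *: en.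
Proof.
move=> hl lA; exists (l 0 ord_max); apply/rowP => i; rewrite !mxE eqxx /=.
have [->|ni] := eqVneq i ord_max; first by rewrite mulr1.
have [i0|i0] := eqVneq i 0; first by rewrite i0 hl mulr0.
rewrite mulr0; apply: ad_kernel => //; move: ni i0 (ltn_ord i).
rewrite -!val_eqE /=; lia.
Qed.

(** Since gam_0 is nonzero, the vectors fixed by exp(gam_0 A) form the kernel of A, which meets x_0
    = 0 in the line of e_n. *)
Lemma exp_fix_center l : hyp l -> l *m exp_ad k.+1 g0 = l <-> H l.
Proof.
move=> hl; split=> [/(exp_ad_fix (gam0_neq0 latG sdG)) /(hyper_ad0 hl) /centerP //|].
by move=> /centerP [t ->]; rewrite -scalemxAl kernel_exp_ad // en_ad.
Qed.

(* g(1) - Id maps L into the discrete group L and is linear and injective modulo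
   the centre. *)
Lemma LamK_discrete : exists B : set 'rV[R]_k,
  [/\ open B, B 0 & forall u, LamK u -> B u -> u = 0].
Proof.
have uN l : hyp l -> pr l *m (P2 *m P1 *m N) = l *m exp_ad k.+1 g0 - l.
  move=> hl; have [t lE] := pr_decomp hl.
  have eN : en *m N = 0 by rewrite mulmxBr mulmx1 kernel_exp_ad ?subrr // en_ad.
  have -> : l *m exp_ad k.+1 g0 - l = l *m N by rewrite mulmxBr mulmx1.
  by rewrite [in RHS]lE mulmxDl -scalemxAl eN scaler0 add0r !mulmxA.
apply: (@linear_discrete _ (P2 *m P1 *m N)) => u [l [Gl hl ->]].
  by rewrite uN //; exact: (L_act latG sdG).
rewrite uN // => /eqP; rewrite subr_eq0 => /eqP /(exp_fix_center hl) /centerP [t ->].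
by rewrite -!scalemxAl en_pr scaler0.
Qed.

Lemma LamP_cocompact : exists r : R, forall x, exists2 l, LamP l & `|l + x| <= r.
Proof.
have [r Hr] := L_cocompact latG sdG; exists r => x.
have [l [Gl hl] lr] := Hr _ (thP_hyper x); exists (l *m P1^T).
  by rewrite /LamP /= /thP hyper_P1.
have -> : l *m P1^T + x = (l + thP x) *m P1^T.
  by rewrite mulmxDl /thP -mulmxA skipK mulmx1.
exact: le_trans (skip_tr_norm _ _) lr.
Qed.

Lemma LamK_cocompact : exists r : R, forall x, exists2 l, LamK l & `|l + x| <= r.
Proof.
have [r Hr] := L_cocompact latG sdG; exists r => x.
have [l [Gl hl] lr] := Hr _ (emb_hyper x); exists (pr l); first by exists l.
have -> : pr l + x = pr (l + x *m P2 *m P1) by rewrite !mulmxDl pr_emb.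
apply: le_trans (skip_tr_norm _ _) _; exact: le_trans (skip_tr_norm _ _) lr.
Qed.

Lemma LamHM x (i : int) : LamH x -> LamH (x *~ i).
Proof.
move=> Lx; have H p : LamH (x *+ p).
  elim: p => [|p IH]; first exact: LamH0.
  by rewrite mulrS; exact: LamHD.
by case: i => p; [exact: H|exact/LamHN/H].
Qed.

(** The multiples of a single nonzero central element t e_n of [Gam] suffice: subtracting the
    integer part of x/t leaves a remainder of norm at most |t|. *)
Lemma LamH_cocompact : exists r : R, forall x, exists2 l, LamH l & `|l + x| <= r.
Proof.
have [t t0 Gt] := center_lattice_neq0 latG sdG n2.
exists `|t| => x; have Lt : LamH (const_mx t) by rewrite /LamH /= thHE mxE.
exists (const_mx t *~ - Num.floor (x 0 0 / t)); first exact: LamHM.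
rewrite [leLHS]/Num.Def.normr /= mx_normrE; apply: bigmax_le => // -[i j] _ /=.
rewrite !ord1 mxE -scaler_int mxE [const_mx _ _ _]mxE.
have -> : (- Num.floor (x 0 0 / t))%:~R * t + x 0 0 =
    (x 0 0 / t - (Num.floor (x 0 0 / t))%:~R) * t.
  by rewrite mulrNz mulNr mulrBl divfK // addrC.
rewrite normrM ler_piMl // ger0_norm ?subr_ge0 ?floor_le //.
by rewrite lerBlDr addrC ltW //; have := floorD1_gt (x 0 0 / t); rewrite intrD.
Qed.

Lemma image_LamH : thH @` LamH = Gam `&` H.
Proof.
apply/seteqP; split=> [_ [u Lu <-]|z [Gz]]; first by split=> //; rewrite -range_thH; exists u.
by rewrite -range_thH => -[u _ uz]; exists u => //; rewrite /LamH /= uz.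
Qed.

Lemma image_LamP : thP @` LamP = Gam `&` hyp.
Proof.
apply/seteqP; split=> [_ [u Lu <-]|z [Gz]]; first by split=> //; exact: thP_hyper.
by rewrite -range_thP => -[u _ uz]; exists u => //; rewrite /LamP /= uz.
Qed.

Lemma H_lattice : lattice (Quot 1 1 thH) mul 0 (Gam `&` H).
Proof.
have := vector_group_lattice thH_inj thHD LamH0 LamHD LamHN LamH_discrete LamH_cocompact.
by rewrite image_LamH /thH mul0mx.
Qed.

Lemma Hp_lattice : lattice (Quot k.+1 k.+1 thP) mul 0 (Gam `&` hyp).
Proof.
have := vector_group_lattice thP_inj thPD LamP0 LamPD LamPN LamP_discrete LamP_cocompact.
by rewrite image_LamP /thP mul0mx.
Qed.

Lemma K_lattice : lattice (Quot k k thK) (set_mul mul) H (thK @` LamK).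
Proof.
have := vector_group_lattice thK_inj thKD LamK0 LamKD LamKN LamK_discrete LamK_cocompact.
by rewrite thK0.
Qed.

(** On [L] the action g(1) is multiplication by exp(gam_0 A), so [exp_fix_center] applies. Hence L /
    ker (g(1) - Id) is what remains of [L] modulo the centre. *)
Lemma ker_act1E : ker_act1 gam (Gam `&` @Hn R k.+1) = Gam `&` H.
Proof.
rewrite HnE; apply/seteqP; split=> l.
  move=> [[Gl hl] E]; split=> //; apply/(exp_fix_center hl).
  rewrite -act1E //; have := fmul0g l; rewrite -{1}E -fmulA fmulVg fmulg0.
  by [].
move=> [Gl Hl]; have hl := H_hyper Hl; split=> //.
by rewrite act1E // ((exp_fix_center hl).2 Hl) fmulgV.
Qed.

Lemma mul_H_coset x : set_mul mul H (coset mul (Gam `&` H) x) = coset mul H x.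
Proof.
rewrite mul_coset mul_subgroup_l //; first exact: H_subgroup.
by split; [exact: Gam0|exact: H0].
Qed.

(** The central element carrying [l] to [l'] is their difference, which lies in [Gam]. This is the
    injectivity of Gam1 into K. *)
Lemma coset_GamH_inj l l' : Gam l -> hyp l -> Gam l' -> hyp l' ->
  coset mul H l = coset mul H l' -> coset mul (Gam `&` H) l = coset mul (Gam `&` H) l'.
Proof.
move=> Gl hl Gl' hl' /coset_HP [t E].
have sH : subgroup mul 0 (Gam `&` H) by have [] := H_lattice.
apply/(coset_mulP (@fmulA R _) (@fmul0g R _) (@fmulVg R _) _ _ sH); exists (t *: en).
  split; last by apply/centerP; exists t.
  by rewrite -[t *: en](addrK l) -E; apply: GamD => //; exact: GamN.
by rewrite fmul_hyper //; apply: hyperZ; exact: en_hyper.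
Qed.

Lemma coset_GamH_mul x y : set_mul mul (coset mul (Gam `&` H) x) (coset mul (Gam `&` H) y) =
  coset mul (Gam `&` H) (mul x y).
Proof.
have sH : subgroup mul 0 (Gam `&` H) by have [] := H_lattice.
rewrite mul_coset_coset; last by move=> s [_]; exact: H_comm.
by rewrite mul_subgroup_l //; case: sH.
Qed.

Lemma GamKE : set_mul mul H @` (coset mul (Gam `&` H) @` (Gam `&` hyp)) = thK @` LamK.
Proof.
apply/seteqP; split=> [_ [_ [l [Gl hl] <-] <-]|_ [_ [l [Gl hl ->]] <-]].
  by exists (pr l); [exists l|rewrite thK_pr // mul_H_coset].
exists (coset mul (Gam `&` H) l); first by exists l.
by rewrite mul_H_coset thK_pr.
Qed.

(* The projections onto M, N and Rm, in the parameters above. *)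
Definition fM := coset mul Gam.
Definition fN := coset mul (thP @` LamP) \o thP.
Definition fR := coset (set_mul mul) (thK @` LamK) \o thK.

Lemma fM_covering : covering [set mul g | g in Gam] fM.
Proof.
apply: (group_covering (@fmulA R _) (@fmul0g R _) (@fmulVg R _)) => //.
- exact: smooth_fmul.
- move=> x y B; apply: (@continuous2_open _ _ (fun x y => mul x (fginv y))).
  exact: fdiv_continuous2.
- exact: (lattice_discrete0 latG).
- by move=> x y; exact: (coset_mulP (@fmulA R _) (@fmul0g R _) (@fmulVg R _)).
Qed.

Definition fN_covering := vector_group_covering thP_inj thPD LamP0 LamPD LamPN LamP_discrete.
Definition fR_covering := vector_group_covering thK_inj thKD LamK0 LamKD LamKN LamK_discrete.

Lemma fN_fM u : set_mul mul Gam (fN u) = fM (thP u).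
Proof.
rewrite /fN /= image_LamP mul_coset mul_subgroup_l //.
by split; [exact: Gam0|rewrite /hyper /= mxE].
Qed.

(** In the linear parameters the projection from N to Rm is a coordinate projection, along which
    [BR] will be pulled back to [BN]. *)
Lemma fN_fR u : coset mul H @` (fN u) = fR (u *m P2^T).
Proof.
have E : thK (u *m P2^T) = coset mul H (thP u).
  rewrite -thK_pr; last exact: thP_hyper.
  by rewrite /thP -!mulmxA [P1 *m _]mulmxA skipK mul1mx.
rewrite /fR /= E /fN /= image_LamP -GamKE; apply/seteqP; split=> z.
  move=> [_ [l [Gl hl] <-] <-]; exists (coset mul H l); last exact: Kmul_coset.
  by exists (coset mul (Gam `&` H) l); [exists l|exact: mul_H_coset].
move=> [_ [_ [l Ll <-] <-] <-]; exists (mul l (thP u)); first by exists l.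
by rewrite mul_H_coset Kmul_coset.
Qed.

Lemma NmE : quotient_mfd k.+1 (Quot k.+1 k.+1 thP) (coset mul (thP @` LamP)) =
  Quot k.+1 k.+1 fN.
Proof. exact: quotient_mfd_comp (@euclid_atlas R _) thP_atlas (covering_submersion _) erefl. Qed.

Lemma RmE : quotient_mfd k (Quot k k thK) (coset (set_mul mul) (thK @` LamK)) = Quot k k fR.
Proof.
have aK := covering_atlas (injective_covering thK_inj).
exact: quotient_mfd_comp (@euclid_atlas R _) aK (covering_submersion _) erefl.
Qed.

Lemma H_coset_translate (S : set V) h x : H h -> coset mul H @` (coset mul S (mul h x)) =
  coset mul H @` (coset mul S x).
Proof.
move=> Hh; have E s : coset mul H (mul s (mul h x)) = coset mul H (mul s x).
  rewrite fmulA -(H_comm s Hh) -fmulA; apply: esym.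
  apply/(coset_mulP (@fmulA R _) (@fmul0g R _) (@fmulVg R _) _ _ H_subgroup).
  by exists h.
apply/seteqP; split=> _ [_ [s Ss <-] <-]; first by rewrite E; exists (mul s x) => //; exists s.
by rewrite -E; exists (mul s (mul h x)) => //; exists s.
Qed.

Lemma C_action h u : H h ->
  set_mul mul (coset mul (Gam `&` H) h) (fN u) = coset mul (thP @` LamP) (mul h (thP u)).
Proof.
move=> Hh; rewrite /fN /= image_LamP mul_coset_coset; last first.
  by move=> s _; exact: esym (H_comm s Hh).
have [sP _ _ _] := Hp_lattice.
rewrite mul_subgroup_r //; first by split; [exact: Gam0|exact: H0].
by move=> z [Gz Hz]; split=> //; exact: H_hyper.
Qed.

Lemma fN_eq u v : fN u = fN v <-> exists2 l, LamP l & v = l + u.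
Proof. exact: (vector_coset_eq thP_inj thPD LamP0 LamPD LamPN). Qed.

Lemma fR_eq u v : fR u = fR v <-> exists2 l, LamK l & v = l + u.
Proof. exact: (vector_coset_eq thK_inj thKD LamK0 LamKD LamKN). Qed.

Lemma fM_eq x y : fM x = fM y <-> exists2 g, Gam g & y = mul g x.
Proof. exact: (coset_mulP (@fmulA R _) (@fmul0g R _) (@fmulVg R _)). Qed.

Lemma embedding_N : embedding (Quot k.+1 k.+1 fN) (Quot k.+2 k.+2 fM) (set_mul mul Gam).
Proof.
have cN := fN_covering; have cM := fM_covering.
have aN : atlas (Quot k.+1 k.+1 fN) := covering_atlas cN.
have sP (x : 'rV[R]_k.+1) : smooth_at thP x by exact: smooth_at_mulmx.
split.
- split; first exact: (@lift_smooth_map _ _ _ _ _ _ _ fN fM _ thP aN sP fN_fM).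
  move=> c c' u g Nc Mc cu rg.
  (* The Jacobian of the local expression is that of [thP] between two invertible factors, so its
     rank is that of [P1]. *)
  have [s [G [ss Hs rG _ ->]]] := local_rep_lift aN sP fN_fM Nc Mc cu rg.
  have [g' [_ _ /mulmx1_unit [uJ _]]] := quotient_section_rep Nc cu ss Hs.
  have uG := quotient_rep_unit Mc rG.
  rewrite mxrankMfree ?row_free_unit // (eqmxMfull _ _) ?row_full_unit //.
  rewrite jacobian_mulmx; apply/eqP; apply/row_freeP.
  by exists P1^T; exact: skipK.
- move=> A B; rewrite !inE => -[u _ <-] [v _ <-].
  rewrite !fN_fM => /fM_eq [g Gg vg].
  apply/fN_eq; exists (v - u); last by rewrite subrK.
  have hg : hyp g.
    have := congr1 (fun x : V => x 0 0) vg; rewrite fmul_coord0.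
    by rewrite [thP v 0 0]thP_hyper [thP u 0 0]thP_hyper addr0 => /esym.
  rewrite /LamP /= (_ : thP (v - u) = g) // /thP mulmxBl -!/(thP _) vg.
  by rewrite fmul_hyper // addrK.
move=> W /(mopen_covering cN) [WN oW].
(* [W] is extended constantly along e_0 over the slab |y_0| < |gam_0|. An element of [Gam] moving a
   point of the hyperplane into the slab has zero coordinate x_0, so the image of the slab meets N
   only in the image of [W]. *)
pose S := [set y : V | `|y 0 0| < `|g0| /\ (fN @^-1` W) (y *m P1^T)].
have oS : open S.
  apply: (@openI _ [set y : V | `|y 0 0| < `|g0|] ((fun y : V => y *m P1^T) @^-1` (fN @^-1` W))).
    apply: (@open_comp _ _ (fun y : V => `|y 0 0|) [set y | y < `|g0|]); last exact: open_lt.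
    by move=> y _; apply: continuous_comp; [exact: coord_continuous|exact: norm_continuous].
  exact: linear_open.
have PS u : (fN @^-1` W) u -> S (thP u).
  move=> Wu; split; last by rewrite /thP -mulmxA skipK mulmx1.
  by rewrite thP_hyper normr0 normr_gt0; exact: (gam0_neq0 latG sdG).
exists (fM @` S); first exact: (covering_open cM oS).
apply/seteqP; split.
  move=> _ [B WB <-]; have [u _ uB] := WN _ WB.
  have {}uB : fN u = B by exact: uB.
  rewrite -uB fN_fM; split.
    by exists (thP u) => //; apply: PS; rewrite /= uB.
  by exists (fN u); [exists u|exact: fN_fM].
move=> _ [[y [y0 Wy] <-] [_ [u _ <-]]]; rewrite fN_fM.
move=> /fM_eq [g Gg yg].
have hg : hyp g.
  apply: (Gam_coord0 latG sdG Gg); have := congr1 (fun x : V => x 0 0) yg.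
  by rewrite fmul_coord0 [thP u 0 0]thP_hyper addr0 => <-.
exists (fN (y *m P1^T)) => //; rewrite fN_fM; congr fM; apply: hyper_P1.
by rewrite yg fmul_hyper //; apply: hyperD => //; exact: thP_hyper.
Qed.

Lemma orbits_N u v : coset mul H @` (fN u) = coset mul H @` (fN v) <->
  exists2 c, (coset mul (Gam `&` H) @` H) c & fN v = set_mul mul c (fN u).
Proof.
split.
  rewrite !fN_fR => /fR_eq [_ [l [Gl hl ->]] E].
  have hv : hyp (thP v - (l + thP u)).
    by apply: hyperB; [exact: thP_hyper|apply: hyperD => //; exact: thP_hyper].
  have [t tE] := pr_decomp hv.
  (* The part not accounted for by [l] has no component outside the line of e_n, so it is central
     and defines the required element of [C]. *)
  have pr0 : pr (thP v - (l + thP u)) = 0.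
    have prP w : pr (thP w) = w *m P2^T by rewrite /thP -[w *m _ *m _]mulmxA skipK mulmx1.
    by rewrite !mulmxBl !mulmxDl !prP E addrC addNr.
  rewrite pr0 !mul0mx addr0 in tE.
  have Ht : H (t *: en) by apply/centerP; exists t.
  exists (coset mul (Gam `&` H) (t *: en)); first by exists (t *: en).
  rewrite (C_action _ Ht) /fN /= image_LamP; apply: esym.
  have [sP _ _ _] := Hp_lattice.
  apply/(coset_mulP (@fmulA R _) (@fmul0g R _) (@fmulVg R _) _ _ sP).
  exists l => //; rewrite fmul_hyper // -tE fmul_hyper //.
  by rewrite opprD addrA [l + _]addrCA addNKr subrK.
move=> [_ [h Hh <-]]; rewrite (C_action _ Hh) => ->.
by rewrite (H_coset_translate _ _ Hh).
Qed.

(** * The reduced symplectic form *)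

Section Symplectic.
Variables (m : nat) (om : form2 R k.+2 V).
Hypotheses (hm : (2 <= m)%N) (hn : k.+1 = (2 * m - 1)%N).
Hypotheses (om_inv : left_invariant om) (om_sympl : symplectic (Fn R k.+1) om).
Local Notation W0 := (om (eu k.+2) 0).
Local Notation BN := (P1 *m W0 *m P1^T).
Local Notation BR := (P2 *m BN *m P2^T).

Let W0T : W0^T = - W0. Proof. by have [[asym _ _] _ _] := om_sympl; exact: asym. Qed.

Lemma BN_antisym : BN^T = - BN.
Proof. by rewrite !trmx_mul trmxK W0T mulNmx mulmxN mulmxA. Qed.

Lemma BR_antisym : BR^T = - BR.
Proof. by rewrite [LHS]trmx_mul trmxK trmx_mul BN_antisym mulNmx mulmxN mulmxA. Qed.

(** The restricted form kills e_n: e_n W0 is a multiple of e_0, and [P1^T] discards the coordinate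
    x_0. *)
Lemma BN_proj_l : P2^T *m P2 *m BN = BN.
Proof.
have [b b0 bE] := W0_row_last om_inv om_sympl hm hn.
have eB : delta_mx 0 ord_max *m BN = 0 :> 'rV_k.+1.
  have -> : delta_mx 0 ord_max = en *m P1^T.
    apply/rowP => i; rewrite skip_tr !mxE eqxx /= -!val_eqE /= /bump /= add1n.
    by rewrite eqSS.
  rewrite !mulmxA -[en *m _ *m _ in LHS](_ : en = _); last by rewrite hyper_P1 //; exact: en_hyper.
  rewrite bE -scalemxAl; apply/rowP => i; rewrite mxE skip_tr !mxE eqxx /=.
  by rewrite mulr0.
exact: skip_proj_mul.
Qed.

Lemma BN_proj : P2^T *m BR *m P2 = BN.
Proof.
have E : BN *m (P2^T *m P2) = BN.
  apply: trmx_inj; rewrite trmx_mul BN_antisym trmx_mul trmxK mulmxN.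
  by rewrite BN_proj_l.
by move: BN_proj_l E; move: BN => B E1 E2; rewrite -[in RHS]E2 -[in RHS]E1 !mulmxA.
Qed.

(** If x is in the kernel, its lift y to x_0 = 0 has y W0 proportional to e_0, hence to e_n W0. So y
    is a multiple of e_n by invertibility of W0, and [pr] gives x = 0. *)
Lemma BR_unit : BR \in unitmx.
Proof.
have [b b0 bE] := W0_row_last om_inv om_sympl hm hn.
have [_ _ /(_ (eu _) 0 erefl I) uW] := om_sympl.
rewrite -row_free_unit; apply: inj_row_free => x xB.
have : x *m P2 *m BN = 0.
  transitivity (x *m (P2 *m P2^T) *m BR *m P2).
    by rewrite -[in LHS]BN_proj; move: BR => B; rewrite !mulmxA.
  by rewrite skipK mulmx1 xB mul0mx.
rewrite !mulmxA; set y := x *m P2 *m P1 => yP.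
have yW : y *m W0 = (y *m W0) 0 0 *: delta_mx 0 0.
  by rewrite [LHS](skip_decomp ord0) yP mul0mx add0r.
have yE : y = ((y *m W0) 0 0 / b) *: en.
  apply: (can_inj (mulmxK uW)).
  by rewrite -scalemxAl bE scalerA divfK.
by rewrite -[x]pr_emb -/y yE -!scalemxAl en_pr scaler0.
Qed.

Lemma M_form : exists2 Om, symplectic (Quot k.+2 k.+2 fM) Om &
  is_pullback (Fn R k.+1) (Quot k.+2 k.+2 fM) fM Om om.
Proof.
have cM := fM_covering.
have [Om pb] : exists Om, is_pullback (euclid R k.+2) (Quot k.+2 k.+2 fM) fM Om om.
  apply: (covering_form_exists cM) => _ w [g _ <-].
  by rewrite jacobian_fmul; exact: om_fmul.
by exists Om => //; exact: covering_symplectic cM om_sympl pb.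
Qed.

Lemma reduction Om : is_pullback (Fn R k.+1) (Quot k.+2 k.+2 fM) fM Om om ->
  reduced_manifold mul 0 Gam Om (Quot 1 1 thH) (Quot k.+1 k.+1 thP) (Quot k k fR)
    (fun B => coset mul H @` B).
Proof.
move=> pbM; have cM := fM_covering; have cN := fN_covering; have cR := fR_covering.
have aN : atlas (Quot k.+1 k.+1 fN) := covering_atlas cN.
have aR : atlas (Quot k k fR) := covering_atlas cR.
rewrite /reduced_manifold.
have -> : pts (Quot 1 1 thH) = H by exact: range_thH.
have -> : Gam `&` pts (Quot k.+1 k.+1 thP) = thP @` LamP.
  by rewrite image_LamP -range_thP.
rewrite NmE; split.
- by split; [exact: covering_manifold cN|exact: embedding_N].
- split=> //; split; first exact: H_lattice.
  by exists thH; [exact: covering_diffeo thH_inj|exact: thHD].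
- split=> _ _ [h Hh <-] [u _ <-]; rewrite (C_action _ Hh).
    have -> : mul h (thP u) = thP (h *m P1^T + u).
      rewrite fmul_hyper; last exact: H_hyper.
      by rewrite /thP mulmxDl hyper_P1 //; exact: H_hyper.
    by exists (h *m P1^T + u).
  (* Freeness: if the class of [h] fixes a coset, then h u = l u with [l] in [Gam]. Cancelling u
     puts [h] in [Gam], so its class is trivial. *)
  have [sP _ _ _] := Hp_lattice; rewrite -image_LamP in sP.
  move=> /esym /(coset_mulP (@fmulA R _) (@fmul0g R _) (@fmulVg R _) _ _ sP) [l Ll].
  move=> /(congr1 (fun x => mul x (fginv (thP u)))).
  rewrite !(group_mulK (@fmulA R _) (@fmul0g R _) (@fmulVg R _)) => hl.
  have Gh : (Gam `&` H) h by split=> //; rewrite hl; move: Ll; rewrite image_LamP => -[].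
  have [sH _ _ _] := H_lattice.
  transitivity (coset mul (Gam `&` H) 0); last first.
    by apply/seteqP; split=> [_ [z Gz <-]|z Gz]; [rewrite fmulg0|exists z; rewrite ?fmulg0].
  apply: esym; apply/(coset_mulP (@fmulA R _) (@fmul0g R _) (@fmulVg R _) _ _ sH).
  by exists h => //; rewrite fmulg0.
- have p2s : submersion (euclid R k.+1) (euclid R k) (fun u => u *m P2^T).
    by apply: (@linear_submersion _ _ _ _ P2); exact: skipK.
  have piE : (fun B => coset mul H @` B) \o fN = fR \o (fun u => u *m P2^T).
    by rewrite funeqE => u; exact: fN_fR.
  have ptsR u : pts (Quot k k fR) (coset mul H @` (fN u)).
    by rewrite fN_fR; exists (u *m P2^T).
  split; first exact: covering_manifold cR.
  (* Submersivity is tested after [fN], where the projection becomes [fR] composed with a linear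
     submersion. *)
  + split=> [_ [u _ <-]|c' Rc']; first exact: ptsR.
    apply: (submersive_factor (@euclid_atlas R _) aN (covering_submersion fN) erefl).
    rewrite piE; apply: (submersive_comp (@euclid_atlas R _) (@euclid_atlas R _) p2s).
    by case: Rc'.
  + apply/seteqP; split=> [_ [_ [u _ <-] <-]|_ [u _ <-]]; first exact: ptsR.
    exists (fN (u *m P2)); first by exists (u *m P2).
    by rewrite fN_fR -mulmxA skipK mulmx1.
  + by move=> _ _ [u _ <-] [v _ <-]; exact: orbits_N.
have [th pbN fth] := vector_group_const_form thP_inj thPD LamP0 LamPD LamPN
  LamP_discrete BN_antisym.
have [OmR pbR fOmR] := vector_group_const_form thK_inj thKD LamK0 LamKD LamKN
  LamK_discrete BR_antisym.
exists OmR, th; split.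
- apply: (covering_symplectic cR _ pbR); split.
  + exact: const_form2 BR_antisym.
  + exact: const_closed_form.
  + by move=> c u _ _; exact: BR_unit.
- exact: fth.
- apply: (@pullback_descend _ _ _ _ _ _ _ fN fM _ thP _ _ _ _ aN _ fN_fM _ pbN pbM).
    by move=> x; exact: smooth_at_mulmx.
  (* On x_0 = 0 the exponent in [om_translate] is zero: [om] is constantly [W0] there and restricts
     to [BN]. *)
  move=> x; rewrite jacobian_mulmx (om_translate om_inv (thP x)) thP_hyper oppr0 exp_ad0.
  by rewrite trmx1 mulmx1 mul1mx.
- apply: (@pullback_descend _ _ _ _ _ _ _ fN fR _ (fun u => u *m P2^T) _ _ _ _ aN _ fN_fR _ pbN pbR).
    by move=> x; exact: smooth_at_mulmx.
  by move=> x; rewrite jacobian_mulmx trmxK BN_proj.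
Qed.

End Symplectic.
End Lattices.
End Reduction.

Theorem proposition3 (R : realType) (m n : nat) (hm : (2 <= m)%N)
    (hn : n = (2 * m - 1)%N)
    (om : form2 R n.+1 'rV[R]_n.+1)
    (om_inv : left_invariant om) (om_sympl : symplectic (Fn R n) om)
    (Gam : set 'rV[R]_n.+1) (gam : 'rV[R]_n.+1)
    (Gam_lattice : lattice (Fn R n) (@fmul R n) 0 Gam)
    (Gam_semidirect : semidirect Gam (Gam `&` @Hn R n) gam) :
  let mul := @fmul R n in
  let L := Gam `&` @Hn R n in
  let H := @fcenter R n in
  let Hp := perp om H in
  let H_mfd := submfd 1 H in
  let Hp_mfd := submfd n Hp in
  let K := quotient_mfd n.-1 Hp_mfd (coset mul H) in
  let Kmul := set_mul mul in
  let ker := ker_act1 gam L in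
  let Gam1 := coset mul ker @` L in
  let iota := set_mul mul H in
  let GamK := iota @` Gam1 in
  let M := quotient_mfd n.+1 (Fn R n) (coset mul Gam) in
  let Rm := quotient_mfd n.-1 K (coset Kmul GamK) in
  [/\ (* (1) H^perp is independent of the form: it is the subgroup of the unique
         abelian ideal of codimension 1 *)
      (forall om', left_invariant om' -> symplectic (Fn R n) om' ->
         perp om' H = Hp) /\
      (exists I : {vspace 'rV[R]_n.+1},
         [/\ abelian_ideal_codim1 I,
             (forall J, abelian_ideal_codim1 J -> J = I)
           & Hp = conn_subgroup [set` I]]),
      (* (2) Gam meets H and H^perp in lattices *)
      [/\ lie_group H_mfd mul 0, lattice H_mfd mul 0 (Gam `&` H),
          lie_group Hp_mfd mul 0 & lattice Hp_mfd mul 0 (Gam `&` Hp)],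
      (* (3) Gam1 = L / ker (g(1) - Id), embedded in K = H\H^perp by iota, is a
         lattice of the abelian Lie group K *)
      [/\ lie_group K Kmul H /\
          (forall x y, pts K x -> pts K y -> Kmul x y = Kmul y x),
          {in Gam1 &, injective iota} /\
          (forall A B, Gam1 A -> Gam1 B ->
             iota (Kmul A B) = Kmul (iota A) (iota B))
        & lattice K Kmul H GamK]
    & (* (4) the torus Rm = Gam1\K is a reduced manifold of (M, Om); the
         projection N -> Rm sends (Gam cap H^perp) h to Gam1 (H h) *)
      [/\ torus_presentation K Kmul H GamK,
          is_manifold M,
          (exists2 Om, symplectic M Om &
             is_pullback (Fn R n) M (coset mul Gam) Om om)
        & forall Om, symplectic M Om ->
            is_pullback (Fn R n) M (coset mul Gam) Om om ->
            reduced_manifold mul 0 Gam Om H_mfd Hp_mfd Rm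
              (fun A => coset mul H @` A)]].
Proof.
(* Writing n = k + 1 makes [n.-1] compute to k, the dimension of the linear model of K; n = 0
   contradicts m >= 2, and k >= 2 is n >= 3. *)
case: n hn om om_inv om_sympl Gam gam Gam_lattice Gam_semidirect => [|k] hn om om_inv
  om_sympl Gam gam latG sdG; first by lia.
have k2 : (2 <= k)%N by lia.
move=> mul L H Hp H_mfd Hp_mfd K Kmul ker Gam1 iota GamK M Rm.
have perpE om' : left_invariant om' -> symplectic (Fn R k.+1) om' -> perp om' H = @hyper R k.+1.
  by move=> i s; exact: (perp_hyper i s hm hn).
have HpE : Hp = @hyper R k.+1 := perpE om om_inv om_sympl.
have LE : L = Gam `&` @hyper R k.+1 by rewrite /L HnE.
have HmE : H_mfd = quotient_mfd 1 (euclid R 1) (@thH R k) by exact: H_mfdE.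
have HpmE : Hp_mfd = quotient_mfd k.+1 (euclid R k.+1) (@thP R k).
  by rewrite /Hp_mfd HpE; exact: Hp_mfdE.
have KE : K = quotient_mfd k (euclid R k) (@thK R k).
  by rewrite /K HpmE; exact: K_mfdE.
have kerE : ker = Gam `&` H by exact: ker_act1E.
have GamKE' : GamK = @thK R k @` LamK Gam.
  by rewrite -GamKE // /GamK /Gam1 kerE LE.
have RmE' : Rm = quotient_mfd k (euclid R k) (fR Gam).
  by rewrite /Rm KE GamKE'; exact: RmE.
have thKi := thK_inj k2.
have HL := H_lattice k2 latG sdG.
rewrite HmE HpmE RmE' KE HpE GamKE'; split.
- split=> [om' i s|]; first exact: perpE.
  have [I IE] : exists I : {vspace 'rV[R]_k.+2}, [set` I] = @hyper R k.+1.
    by eexists; exact: span_hyper.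
  exists I; split.
  + exact: abelian_ideal_hyper.
  + by move=> J; apply: abelian_ideal_uniq IE; lia.
  + by rewrite IE conn_hyper.
- split.
  + have := vector_group_lie (@thH_inj R k) (@thHD R k).
    by rewrite /thH mul0mx.
  + exact: HL.
  + have := vector_group_lie (@thP_inj R k) (@thPD R k).
    by rewrite /thP mul0mx.
  + exact: Hp_lattice latG sdG.
- split.
  + split; first by have := vector_group_lie (thKi R) (@thKD R k k2); rewrite thK0.
    move=> _ _ [u _ <-] [v _ <-].
    by rewrite /Kmul -!thKD // addrC.
  + rewrite /Gam1 kerE LE /iota; split.
      move=> _ _ /set_mem [l [Gl hl] <-] /set_mem [l' [Gl' hl'] <-].
      by rewrite !(mul_H_coset k2 latG); exact: (coset_GamH_inj k2 latG sdG).
    move=> _ _ [l [Gl hl] <-] [l' [Gl' hl'] <-].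
    by rewrite /Kmul (coset_GamH_mul k2 latG sdG) !(mul_H_coset k2 latG) Kmul_coset.
  + exact: (K_lattice k2 latG sdG).
- split.
  + split; first exact: (K_lattice k2 latG sdG).
    by exists (@thK R k); [exact: covering_diffeo|exact: thKD].
  + exact: covering_manifold (fM_covering latG).
  + exact: (M_form latG om_inv om_sympl).
  + by move=> Om _ pb; exact: (reduction k2 latG sdG hm hn om_inv om_sympl pb).
Qed.
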